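(* Consider the KRW system with $N\ge2$ fixed and $\boldsymbol\omega=\mathbf 0$. There exists a set $\Omega\subset\mathbb{T}^N$ of full Lebesgue measure such that for any compact subset $\Omega'\subset\Omega$ and any $\eta>0$ there exists $\epsilon_0=\epsilon_0(\Omega',\eta)>0$ such that for any $\epsilon\in(0,\epsilon_0)$ and any $\boldsymbol\alpha\in\Omega'$, with probability at least $1-\eta$ the unique solution of the KRW system initialized at $\boldsymbol\theta^\epsilon(0)=\boldsymbol\alpha$ converges to $\mathbf 0$ (up to a global translation) as $t\to\infty$.
   Context: Skeleton. $\mathbb{G}=(V,E)$ is a finite connected graph with symmetric weights $\pi(u,v)=\pi(v,u)\in[0,\infty)$ for $u,v\in V$; the edges are the pairs $\{u,v\}$ (possibly $u=v$) with $\pi(u,v)>0$, and every vertex has a self-loop: $\pi(u,u)>0$ for all $u\in V$. Put $\pi(u)=\sum_{v\in V}\pi(u,v)$. $K>0$ is a constant. $\mathbb{T}^N=(\mathbb{R}/2\pi\mathbb{Z})^N$. Kuramoto Random Walk (KRW). For $\epsilon\in(0,\infty)$, $\mathbf X^\epsilon(t)=(X^\epsilon_1(t),\dots,X^\epsilon_N(t))$ consists of $N$ independent continuous-time random walks on $\mathbb{G}$: each walk jumps at constant rate $\epsilon^{-1}$, and from $u$ it jumps to $v$ with probability $\pi(u,v)/\pi(u)$. The starting point $\mathbf X^\epsilon(0)=\mathbf x_0^\epsilon\in V^N$ is given. For $\mathbf x\in V^N$ let $a_{ij}(\mathbf x)=\pi(x_i,x_j)$. With natural frequencies $\boldsymbol\omega=(\omega_i)_{i=1}^N$,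 the KRW system for $\boldsymbol\theta^\epsilon(t)\in\mathbb{T}^N$ is $$\frac{d}{dt}\theta^\epsilon_i(t)=\omega_i+\frac{K}{N}\sum_{j=1}^N a_{ij}(\mathbf X^\epsilon(t))\sin\big(\theta^\epsilon_j(t)-\theta^\epsilon_i(t)\big),\quad i=1,\dots,N,\ t\ge0,$$ whose solutions (in the Carathéodory sense, for every realization of the walks) exist and are unique given the initial condition. ''$\boldsymbol\theta(t)$ converges to $\mathbf 0$ up to a global translation'' means that there is $c\in\mathbb{T}$ such that every component of $\boldsymbol\theta(t)$ converges to $c$ as $t\to\infty$. *)

(* Defs.v *)
From HB Require Import structures.
From mathcomp Require Import all_boot all_order all_algebra.
From mathcomp Require Import generic_quotient.
From mathcomp Require Import all_classical all_reals all_analysis.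

Set Implicit Arguments.
Unset Strict Implicit.
Unset Printing Implicit Defensive.

Import Order.TTheory GRing.Theory Num.Theory.
Import numFieldTopology.Exports numFieldNormedType.Exports.

Local Open Scope classical_set_scope.
Local Open Scope ring_scope.
Local Open Scope quotient_scope.

Section Torus.
Variable R : realType.

Definition angle_eq (x y : R) : bool :=
  `[< exists k : int, x - y = 2 * pi * k%:~R >].

Lemma angle_eq_refl : reflexive angle_eq.
Proof. by move=> x; apply/asboolP; exists 0; rewrite subrr mulr0. Qed.

Lemma angle_eq_sym : symmetric angle_eq.
Proof.
have H x y : angle_eq x y -> angle_eq y x.
  by move=> /asboolP[k xy]; apply/asboolP; exists (- k);
     rewrite -opprB xy mulrNz mulrN.
by move=> x y; apply/idP/idP; apply: H.
Qed.

Lemma angle_eq_trans : transitive angle_eq.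
Proof.
move=> y x z /asboolP[k xy] /asboolP[l yz]; apply/asboolP; exists (k + l).
by rewrite intrD mulrDr -xy -yz addrA subrK.
Qed.

Canonical angle_equiv : equiv_rel R :=
  EquivRel angle_eq angle_eq_refl angle_eq_sym angle_eq_trans.

Definition circle := quotient_topology {eq_quot angle_equiv}.

Definition angle (x : R) : circle := \pi_(circle) x.

Lemma angleE (x y : R) :
  angle x = angle y <-> exists k : int, x - y = 2 * pi * k%:~R.
Proof.
split=> [xy|xy].
  by apply/asboolP; apply/(@eqmodP R angle_equiv x y).
by apply/(@eqmodP R angle_equiv x y); apply/asboolP.
Qed.

Definition torus (N : nat) := {ptws 'I_N -> circle}.

Definition box N (a b : 'I_N -> R) : set ('I_N -> R) :=
  [set x | forall i, a i <= x i <= b i].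

Definition lebesgue_outer N (A : set ('I_N -> R)) : \bar R :=
  ereal_inf [set s | exists a b : nat -> 'I_N -> R,
    [/\ forall k i, a k i <= b k i,
        A `<=` \bigcup_k box (a k) (b k) &
        s = (\sum_(0 <= k <oo) (\prod_i (b k i - a k i))%:E)%E]].

(* Lebesgue measure on the torus is Lebesgue measure on the fundamental domain
   [0, 2pi)^N. *)
Definition full_measure N (A : set (torus N)) : Prop :=
  lebesgue_outer [set x : 'I_N -> R |
    (forall i, 0 <= x i < 2 * pi) /\ ~ A (fun i => angle (x i))] = 0%E.

Definition syncs N (theta : R -> torus N) : Prop :=
  exists c : circle, forall i, theta t i @[t --> +oo] --> c.

End Torus.

Record weighted_graph (R : realType) (V : finType) (w : V -> V -> R) : Prop := {
  weight_ge0 : forall u v, 0 <= w u v;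
  weight_sym : forall u v, w u v = w v u;
  weight_loop : forall u, 0 < w u u;
  weight_connected : forall u v, connect [rel x y | 0 < w x y] u v }.

Section Walks.
Context (R : realType) (d : measure_display) (T : measurableType d).
Variable P : probability T R.

Definition mutually_independent (I : eqType) (F : I -> set_system T) : Prop :=
  forall (J : seq I) (E : I -> set T), uniq J ->
    (forall i, i \in J -> F i (E i)) ->
    P (\bigcap_(i in [set` J]) E i) = (\prod_(i <- J) P (E i))%E.

(* The state space S is countable in all uses and carries its discrete
   sigma-algebra. *)
Definition process_events (I S : Type) (D : set I) (Z : I -> T -> S) :
  set_system T := <<s \bigcup_(t in D) range (preimage (Z t)) >>.

(* The second argument of poisson_prob is not used by the library. *)
Record poisson_process (rate : R) (C : R -> T -> nat) : Prop := {
  poisson_measurable : forall t, 0 <= t -> measurable_fun setT (C t);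
  poisson_start : forall o, C 0 o = 0%N;
  poisson_mono : forall o s t, 0 <= s -> s <= t -> (C s o <= C t o)%N;
  poisson_rcont : forall o t, 0 <= t -> \forall s \near t^'+, C s o = C t o;
  poisson_law : forall s t, 0 <= s -> s <= t -> forall B : set nat,
    P [set o | B (C t o - C s o)%N] = poisson_prob (rate * (t - s)) 0 B;
  poisson_indep : forall t : nat -> R, 0 <= t 0%N -> nondecreasing_seq t ->
    mutually_independent
      (fun k => range (preimage (fun o => (C (t k.+1) o - C (t k) o)%N))) }.

Variables (V : finType) (w : V -> V -> R).

Definition step_prob (u v : V) : R := w u v / \sum_z w u z.

Definition chain_path (Y : nat -> T -> V) (n : nat) (p : nat -> V) : set T :=
  [set o | forall k, (k <= n)%N -> Y k o = p k].

Record jump_chain (x0 : V) (Y : nat -> T -> V) : Prop := {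
  chain_measurable : forall n v, measurable [set o | Y n o = v];
  chain_start : forall o, Y 0%N o = x0;
  chain_step : forall n (p : nat -> V),
    P (chain_path Y n.+1 p) =
    (P (chain_path Y n p) * (step_prob (p n) (p n.+1))%:E)%E }.

(* Jumps of each walk occur at the jump times of a Poisson clock C i of the
   given rate, and the successive positions are the chain Y i; steps along
   self-loops are jumps too. *)
Definition independent_walks (N : nat) (rate : R) (x0 : 'I_N -> V)
    (X : R -> T -> 'I_N -> V) : Prop :=
  exists (Y : 'I_N -> nat -> T -> V) (C : 'I_N -> R -> T -> nat),
    [/\ forall i, jump_chain (x0 i) (Y i),
        forall i, poisson_process rate (C i),
        mutually_independent (fun k : 'I_N + 'I_N =>
          match k with
          | inl i => process_events setT (Y i)
          | inr i => process_events [set t : R | 0 <= t] (C i)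
          end) &
        forall t o i, 0 <= t -> X t o i = Y i (C i t o) o].

End Walks.

Section KRW.
Context (R : realType) (V : finType) (N : nat).
Variables (w : V -> V -> R) (K : R) (omega : 'I_N -> R).

Definition krw_field (x : 'I_N -> V) (y : 'I_N -> R) (i : 'I_N) : R :=
  omega i + K / N%:R * \sum_j w (x i) (x j) * sin (y j - y i).

(* y is a continuous lift of theta to R^N; the Caratheodory condition
   (absolute continuity and the equation at almost every time) is written as
   the integral equation. *)
Definition krw_solution (x : R -> 'I_N -> V) (alpha : torus R N)
    (theta : R -> torus R N) : Prop :=
  theta 0 = alpha /\
  exists y : R -> 'I_N -> R, forall i,
    {within `[0, +oo[, continuous (fun t => y t i)} /\
    forall t, 0 <= t ->
      [/\ theta t i = angle (y t i),
          lebesgue_measure.-integrable `[0, t]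
            (fun s => (krw_field (x s) (y s) i)%:E) &
          y t i = y 0 i +
            \int[lebesgue_measure]_(s in `[0, t]) krw_field (x s) (y s) i].

Definition unique_krw_solution (x : R -> 'I_N -> V) (alpha : torus R N)
    (theta : R -> torus R N) : Prop :=
  krw_solution x alpha theta /\
  forall theta', krw_solution x alpha theta' ->
    forall t, 0 <= t -> theta' t = theta t.

End KRW.

(* Main.v *)
Require Import Defs.
From mathcomp Require Import all_boot all_order all_algebra.
From mathcomp Require Import all_classical all_reals all_analysis.
From mathcomp Require Import ring lra zify.

Set Implicit Arguments.
Unset Strict Implicit.
Unset Printing Implicit Defensive.

Import Order.TTheory GRing.Theory Num.Theory.
Import numFieldTopology.Exports numFieldNormedType.Exports.

Local Open Scope classical_set_scope.
Local Open Scope ring_scope.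

(* As epsilon tends to 0 the walks equilibrate, so on bounded time intervals the
   solution stays close to the mean-field flow with constant coupling m, the mean
   of pi(u,v) under the product of two stationary laws.  A mean-field trajectory
   with nonzero order parameter settles at phases that differ by multiples of pi.
   The initial phases leading to two antipodal clusters form, for each itinerary,
   an antichain for a reflected coordinate order, because ordered trajectories
   separate exponentially near such an equilibrium; an antichain is Lebesgue null,
   and so is the set of phases with zero order parameter.  All other phases reach
   near-synchrony in finite time, uniformly on compact sets.  With probability
   close to 1 the random solution is then nearly synchronised at that time, and
   from there the spread of the phases decays at a rate bounded below by the total
   time during which all walks sit at one vertex, which is almost surely infinite. *)

(** * Right derivatives and ordinary differential equations *)

(** At a jump of a walk the coupling is discontinuous in time, so solutions have right derivatives
    everywhere but in general no derivatives; monotonicity and Gronwall bounds are therefore proved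
    for right derivatives of continuous functions. The obstacle to full measure is the set attracted
    to two-cluster states. No stable manifold is constructed: it suffices that no two points of the
    set, taken at a time n, are strictly ordered. An antichain in dimension N+1 meets only about
    h^(-N) cells of a grid of mesh h, and the time-n map has a Lipschitz inverse, so nullity is
    pulled back to the initial phases. The probabilistic input is one second-moment bound: an
    observable centred for the product of stationary laws decorrelates once rate times time lag
    exceeds a constant that does not depend on the starting point. A large rate on a bounded
    interval gives averaging; a large time at a fixed rate gives the infinite total meeting time,
    which therefore puts no condition on epsilon. *)

Lemma le_of_eq (R : realType) (a b : R) : a = b -> a <= b.
Proof. by move=> ->. Qed.

Section RightDerivative.
Variable R : realType.
Implicit Types (f g : R -> R) (t l : R).

(** Continuous induction: the supremum of the times up to which [P] holds satisfies [P] by the limit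
    clause, and the step clause would then push past it. *)
Lemma real_induction (P : R -> Prop) (a : R) :
  P a ->
  (forall t, a <= t -> (forall s, a <= s <= t -> P s) ->
     exists d, 0 < d /\ forall s, t <= s < t + d -> P s) ->
  (forall t, a < t -> (forall s, a <= s < t -> P s) -> P t) ->
  forall t, a <= t -> P t.
Proof.
move=> Pa step lim t at_; apply: contrapT => nPt.
pose S := [set u | a <= u /\ forall s, a <= s <= u -> P s].
have Sa : S a by split=> // s /andP[h1 h2]; have -> : s = a by lra.
have ubS : ubound S t.
  move=> u [au Pu]; rewrite leNgt; apply/negP => tu.
  by apply: nPt; apply: Pu; rewrite at_ ltW.
have supS : has_sup S by split; [exists a | exists t].
set m := sup S.
have am : a <= m by apply: sup_upper_bound.
have below s : a <= s < m -> P s.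
  move=> /andP[as_ sm].
  have [u [au Pu] su] := sup_adherent (eps := m - s) ltac:(lra) supS.
  by apply: Pu; rewrite as_ /=; move: su; rewrite -/m; lra.
have Pm : P m.
  move: am; rewrite le_eqVlt => /predU1P[<- //|am]; exact: lim.
have upto s : a <= s <= m -> P s.
  move=> /andP[as_]; rewrite le_eqVlt => /predU1P[-> //|sm].
  by apply: below; rewrite as_.
have [d [d0 Pd]] := step m am upto.
have : S (m + d / 2).
  split=> [|s /andP[as_ sm]]; first by lra.
  by have [/= ?|?] := leP s m; [apply: upto; lra|apply: Pd; lra].
by move/(sup_upper_bound supS); rewrite -/m; lra.
Qed.

Definition rder f t l : Prop := h^-1 * (f (t + h) - f t) @[h --> 0^'+] --> l.

Lemma slope_norm (h u l : R) : 0 < h ->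
  `|h^-1 * u - l| * h = `|u - h * l|.
Proof.
move=> h0; rewrite -[X in _ * X](gtr0_norm h0) -normrM; congr Num.norm.
by field; lra.
Qed.

Lemma rder_eps f t l : rder f t l <->
  forall e, 0 < e -> exists d, 0 < d /\
    forall s, t < s < t + d -> `|f s - f t - (s - t) * l| <= e * (s - t).
Proof.
split=> [fl e e0|H].
- have /cvgrPdist_le/(_ e e0) := fl.
  move=> [d /= d0 Hd]; exists d; split=> // s /andP[ts sd].
  have h0 : 0 < s - t by lra.
  have := Hd (s - t); rewrite /= sub0r normrN gtr0_norm// => /(_ ltac:(lra) h0).
  have -> : t + (s - t) = s by ring.
  by rewrite distrC -(ler_pM2r h0) slope_norm.
- apply/cvgrPdist_le => e e0; have [d [d0 Hd]] := H e e0.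
  exists d => //= h hd h0; rewrite /= sub0r normrN in hd.
  rewrite gtr0_norm// in hd.
  have := Hd (t + h) ltac:(lra).
  have -> : t + h - t = h by ring.
  by rewrite -slope_norm// ler_pM2r// distrC.
Qed.

Lemma rder_cst c t : rder (fun=> c) t 0.
Proof.
rewrite /rder; under eq_fun do rewrite subrr mulr0; exact: cvg_cst.
Qed.

Lemma rder_id t : rder id t 1.
Proof.
apply/rder_eps => e e0; exists 1; split=> // s /andP[ts _].
by rewrite mulr1 subrr normr0 mulr_ge0//; lra.
Qed.

Lemma rderD f g t l m : rder f t l -> rder g t m ->
  rder (fun s => f s + g s) t (l + m).
Proof.
move=> fl gm; rewrite /rder.
under eq_fun do rewrite opprD addrACA mulrDr.
exact: cvgD.
Qed.

Lemma rderN f t l : rder f t l -> rder (fun s => - f s) t (- l).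
Proof.
move=> fl; rewrite /rder.
under eq_fun do rewrite -opprD mulrN.
exact: cvgN.
Qed.

Lemma rderB f g t l m : rder f t l -> rder g t m ->
  rder (fun s => f s - g s) t (l - m).
Proof. by move=> fl /rderN; exact: rderD. Qed.

Lemma rderZ c f t l : rder f t l -> rder (fun s => c * f s) t (c * l).
Proof.
move=> fl; rewrite /rder.
under eq_fun do rewrite -mulrBr mulrCA.
exact: cvgMr.
Qed.

Lemma rder_sum (I : Type) (r : seq I) (P : pred I) (f : I -> R -> R) t
    (l : I -> R) :
  (forall i, P i -> rder (f i) t (l i)) ->
  rder (fun s => \sum_(i <- r | P i) f i s) t (\sum_(i <- r | P i) l i).
Proof.
move=> H; elim: r => [|i r IH].
  by rewrite big_nil; under eq_fun do rewrite big_nil; exact: rder_cst.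
rewrite big_cons; under eq_fun do rewrite big_cons.
by case: ifP => // Pi; exact: (rderD (H i Pi) IH).
Qed.

Lemma cvg_at_right_shift f t : {for t, continuous f} ->
  f (t + h) @[h --> 0^'+] --> f t.
Proof.
move=> cf; apply: (@cvg_comp _ _ _ (fun h => t + h) f _ (nbhs t)) => //.
apply: cvg_at_right_filter; rewrite -{2}[t]addr0.
by apply: cvgD; [exact: cvg_cst|exact: cvg_id].
Qed.

Lemma rderM f g t l m : {for t, continuous g} -> rder f t l -> rder g t m ->
  rder (fun s => f s * g s) t (l * g t + f t * m).
Proof.
move=> cg fl gm; rewrite /rder.
under eq_fun => h.
  have -> : h^-1 * (f (t + h) * g (t + h) - f t * g t) =
    h^-1 * (f (t + h) - f t) * g (t + h) + f t * (h^-1 * (g (t + h) - g t)).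
    by ring.
  over.
apply: cvgD; last by apply: cvgMr.
by apply: cvgM => //; exact: cvg_at_right_shift.
Qed.

Lemma rder_comp (phi : R -> R) f t l p : {for t, continuous f} ->
  is_derive (f t) 1 phi p -> rder f t l -> rder (phi \o f) t (p * l).
Proof.
move=> cf [dphi phip] fl.
have {dphi phip} dp : h^-1 *: (phi (h + f t) - phi (f t)) @[h --> 0^'] --> p.
  rewrite -phip; have := dphi; rewrite /derivable /derive.
  under eq_fun do rewrite [_ *: 1]mulr1.
  by [].
have near_phi e : 0 < e -> exists d, 0 < d /\ forall u, `|u - f t| < d ->
    `|phi u - phi (f t) - p * (u - f t)| <= e * `|u - f t|.
  move=> e0; have /cvgrPdist_le/(_ e e0)[d /= d0 Hd] := dp.
  exists d; split=> // u ud; have [->|uf] := eqVneq u (f t).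
    by rewrite !subrr mulr0 subrr !normr0 mulr0.
  have u0 : u - f t != 0 by rewrite subr_eq0.
  have := Hd (u - f t); rewrite /= sub0r normrN => /(_ ud u0).
  rewrite subrK distrC -(ler_pM2r (x := `|u - f t|)) ?normr_gt0//.
  apply: le_trans; rewrite -normrM; apply: le_of_eq.
  by congr Num.norm; rewrite /GRing.scale /=; field.
apply/rder_eps => e e0.
pose K := `|l| + `|p| + 2.
have K0 : 0 < K by rewrite /K; have := normr_ge0 l; have := normr_ge0 p; lra.
pose e1 := Num.min 1 (e / K).
have e10 : 0 < e1 by rewrite lt_min ltr01 divr_gt0.
have [d1 [d10 H1]] := near_phi e1 e10.
have [d2 [d20 H2]] := (rder_eps f t l).1 fl e1 e10.
have /cvgrPdist_lt/(_ d1 d10)[d3 /= d30 H3] := cf.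
exists (Num.min d2 d3); split; first by rewrite lt_min d20.
move=> s /andP[ts]; rewrite -ltrBlDl lt_min => /andP[s2 s3].
have {}H3 : `|f s - f t| < d1.
  by rewrite distrC; apply: H3; rewrite /= distrC gtr0_norm; lra.
have {}H2 := H2 s ltac:(lra).
have {}H1 := H1 _ H3.
have e1K : e1 * K <= e.
  by rewrite -ler_pdivlMr//; rewrite /e1 ge_min lexx orbT.
have e11 : e1 <= 1 by rewrite /e1 ge_min lexx.
have st : 0 < s - t by lra.
have fst : `|f s - f t| <= (`|l| + e1) * (s - t).
  have -> : f s - f t = (f s - f t - (s - t) * l) + (s - t) * l by ring.
  apply: le_trans (ler_normD _ _) _; rewrite normrM (gtr0_norm st); lra.
have -> : (phi \o f) s - (phi \o f) t - (s - t) * (p * l) =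
  (phi (f s) - phi (f t) - p * (f s - f t)) + p * (f s - f t - (s - t) * l).
  by rewrite /=; ring.
apply: le_trans (ler_normD _ _) _; rewrite normrM.
have A1 : `|p| * `|f s - f t - (s - t) * l| <= `|p| * (e1 * (s - t)).
  by rewrite ler_wpM2l.
have A2 : e1 * `|f s - f t| <= e1 * ((`|l| + e1) * (s - t)).
  by rewrite ler_wpM2l// ltW.
have A3 : e1 * K * (s - t) <= e * (s - t) by rewrite ler_pM2r.
have A4 : e1 * (e1 * (s - t)) <= 1 * (e1 * (s - t)).
  by rewrite ler_wpM2r// mulr_ge0// ltW.
apply: le_trans (lerD H1 A1) _; apply: le_trans A3.
apply: le_trans (lerD A2 (lexx _)) _.
rewrite mulrDl mulrDr /K; have := e10; nra.
Qed.

Lemma le_left_limit f a t (c : R) : a < t -> continuous f ->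
  (forall s, a <= s < t -> c <= f s) -> c <= f t.
Proof.
move=> at_ cf H; rewrite leNgt; apply/negP => ft.
have /cvgrPdist_lt/(_ (c - f t))[|d /= d0 Hd] := cf t; first by rewrite subr_gt0.
pose s := Num.max a (t - d / 2).
have sa : a <= s by rewrite le_max lexx.
have st : s < t by rewrite gt_max at_; lra.
have sd : t - d / 2 <= s by rewrite le_max lexx orbT.
have := Hd s; rewrite /= gtr0_norm; last by lra.
by move=> /(_ ltac:(lra)) /ltr_normlP[]; have := H s ltac:(lra); lra.
Qed.

Lemma continuous_affine c a : continuous (fun s : R => c * (s - a)).
Proof.
by move=> t; apply: cvgM; [exact: cvg_cst|apply: cvgB; [exact: cvg_id|exact: cvg_cst]].
Qed.

Lemma rder_affine c a t : rder (fun s => c * (s - a)) t c.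
Proof.
suff : rder (fun s => c * (s - a)) t (c * (1 - 0)) by rewrite subr0 mulr1.
by apply: rderZ; apply: rderB; [exact: rder_id|exact: rder_cst].
Qed.

(** A slope [e1 > 0] gives the room: the barrier [f a + e1 * (t - a)] survives the remainder of the
    right expansion at each time and passes to left limits by continuity. *)
Lemma nonincr_rder f a b : a <= b -> continuous f ->
  (forall t, a <= t < b -> exists2 l, rder f t l & l <= 0) -> f b <= f a.
Proof.
move=> ab cf df; apply/ler_addgt0Pr => e e0.
pose e1 := e / (b - a + 1).
have e10 : 0 < e1 by rewrite divr_gt0//; lra.
suff H t : a <= t -> t <= b -> f t <= f a + e1 * (t - a).
  apply: le_trans (H b ab (lexx _)) _; rewrite lerD2l /e1 mulrAC.
  rewrite ler_pdivrMr; last by lra.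
  by rewrite ler_pM2l//; lra.
move: t; apply: real_induction.
- by rewrite subrr mulr0 addr0.
- move=> t at_ Ps; have [tb|bt] := ltP t b; last first.
    exists 1; split=> // s /andP[ts _] sb.
    have -> : s = t by lra.
    by apply: Ps; lra.
  have [l fl l0] := df t ltac:(lra).
  have [d [d0 Hd]] := (rder_eps f t l).1 fl e1 e10.
  exists d; split=> // s /andP[]; rewrite le_eqVlt => /predU1P[<- _|ts sd] sb.
    by apply: Ps; lra.
  have := Hd s ltac:(lra); have := Ps t ltac:(lra) ltac:(lra).
  move=> Ht /ler_normlP[_]; have : (s - t) * l <= 0 by rewrite mulr_ge0_le0//; lra.
  nra.
- move=> t at_ Ps tb; rewrite -subr_ge0.
  apply: (@le_left_limit (fun s => f a + e1 * (s - a) - f s) a) => // [s|s sat].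
    by apply: cvgB; [apply: cvgD; [exact: cvg_cst|exact: continuous_affine]|exact: cf].
  by rewrite subr_ge0; apply: Ps; lra.
Qed.

(** Integrating factor: [f t * expR (- c * (t - a))] has a nonpositive right derivative. The rate
    [c] may be negative, as it is in [sqdist_backward]. *)
Lemma gronwall_rder f a b (c : R) : a <= b -> continuous f ->
  (forall t, a <= t < b -> exists2 l, rder f t l & l <= c * f t) ->
  f b <= f a * expR (c * (b - a)).
Proof.
move=> ab cf df.
pose h s := - c * (s - a).
have ch : continuous h by exact: continuous_affine.
pose g t := f t * expR (h t).
have ce t : {for t, continuous (expR \o h)}.
  by apply: continuous_comp; [exact: ch|exact: continuous_expR].
have cg : continuous g by move=> t; apply: cvgM; [exact: cf|exact: ce].
have gab : g b <= g a.
  apply: nonincr_rder => // t /df[l fl ll].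
  have de : rder (expR \o h) t (expR (h t) * - c).
    by apply: rder_comp; [exact: ch|exact: rder_affine].
  exists (l * expR (h t) + f t * (expR (h t) * - c)); first exact: rderM.
  have -> : l * expR (h t) + f t * (expR (h t) * - c) = (l - c * f t) * expR (h t) by ring.
  by rewrite mulr_le0_ge0 ?expR_ge0//; lra.
have e1 : expR (h b) * expR (c * (b - a)) = 1.
  by rewrite -expRD /h mulNr addNr expR0.
move: gab; rewrite /g {2}/h subrr mulr0 expR0 mulr1.
by rewrite -(ler_pM2r (expR_gt0 (c * (b - a)))) -mulrA e1 mulr1.
Qed.

Lemma gronwall_affine_rder f a b (c d : R) : a <= b -> continuous f ->
  (forall t, a <= t < b -> exists2 l, rder f t l & l <= c * f t + d) ->
  0 < c -> 0 <= d -> f b <= (f a + d / c) * expR (c * (b - a)).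
Proof.
move=> ab cf df c0 d0.
have : f b + d / c <= (f a + d / c) * expR (c * (b - a)).
  apply: (@gronwall_rder (fun s => f s + d / c)) => //.
    by move=> t; apply: cvgD; [exact: cf|exact: cvg_cst].
  move=> t /df[l fl ll]; exists (l + 0); first by apply: rderD => //; exact: rder_cst.
  by rewrite addr0 mulrDr mulrCA divff ?gt_eqF// mulr1.
by apply: le_trans; rewrite lerDl divr_ge0// ltW.
Qed.

Lemma rder_lipschitz f a b (C : R) : a <= b -> continuous f ->
  (forall t, a <= t < b -> exists2 l, rder f t l & `|l| <= C) ->
  `|f b - f a| <= C * (b - a).
Proof.
move=> ab cf df.
rewrite ler_norml; apply/andP; split.
- have := @nonincr_rder (fun s => - f s - C * (s - a)) a b ab.
  rewrite subrr mulr0 subr0 => H.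
  suff : - f b - C * (b - a) <= - f a by lra.
  apply: H => [t|t /df[l fl /ler_normlP[lC _]]].
    by apply: cvgB; [apply: cvgN; exact: cf|exact: continuous_affine].
  exists (- l - C); last by lra.
  by apply: rderB; [exact: rderN|exact: rder_affine].
- have := @nonincr_rder (fun s => f s - C * (s - a)) a b ab.
  rewrite subrr mulr0 subr0 => H.
  suff : f b - C * (b - a) <= f a by lra.
  apply: H => [t|t /df[l fl /ler_normlP[_ lC]]].
    by apply: cvgB; [exact: cf|exact: continuous_affine].
  exists (l - C); last by lra.
  by apply: rderB; [exact: fl|exact: rder_affine].
Qed.

End RightDerivative.

Lemma cvg_sumr (R : realType) (T : Type) (G : set_system T) (FG : Filter G)
    (I : Type) (r : seq I) (P : pred I) (f : I -> T -> R) (l : I -> R) :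
  (forall i, P i -> f i x @[x --> G] --> l i) ->
  \sum_(i <- r | P i) f i x @[x --> G] --> \sum_(i <- r | P i) l i.
Proof.
move=> H; elim: r => [|i r IH].
  by rewrite big_nil; under eq_fun do rewrite big_nil; exact: cvg_cst.
rewrite big_cons; under eq_fun do rewrite big_cons.
by case: ifP => // Pi; exact: (cvgD (H i Pi) IH).
Qed.

(** * Primitives of bounded measurable functions *)

Section Primitive.
Variable R : realType.
Implicit Types (f g : R -> R) (s t c e C : R).
Local Notation mu := (@lebesgue_measure R).

(** The interval is empty for [t < 0], so a primitive vanishes there and is Lipschitz on the whole
    line. Paths can thus be total continuous functions although the equation only concerns
    [t >= 0]. *)
Definition primitive f t : R := \int[mu]_(s in `[0, t]) f s.

Definition bounded_measurable C f :=
  measurable_fun (`[0, +oo[ : set R) f /\ forall s, 0 <= s -> `|f s| <= C.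

Lemma bounded_measurable_integrable C f (a b : itv_bound R) :
  bounded_measurable C f -> [set` Interval a b] `<=` `[0, +oo[ ->
  (mu [set` Interval a b] < +oo)%E ->
  mu.-integrable [set` Interval a b] (EFin \o f).
Proof.
move=> [mf bf] sub fin; apply: measurable_bounded_integrable => //.
- by apply: measurable_funS mf.
- exists C; split; first exact: num_real.
  move=> M CM x /sub /=; rewrite in_itv /= andbT => x0.
  by apply: le_trans (bf x x0) _; exact: ltW.
Qed.

Lemma primitive_integrable C f t : bounded_measurable C f ->
  mu.-integrable `[0, t] (EFin \o f).
Proof.
move=> bf; apply: (bounded_measurable_integrable bf).
  by move=> x /=; rewrite !in_itv /= andbT => /andP[].
by rewrite /= lebesgue_measure_itv /=; case: ifP; rewrite ?ltry.
Qed.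

Lemma primitive_neg f t : t <= 0 -> primitive f t = 0.
Proof.
rewrite le_eqVlt => /predU1P[->|t0].
  by rewrite /primitive set_itv1 Rintegral_set1.
by rewrite /primitive set_itv_ge ?Rintegral_set0// bnd_simp -ltNge.
Qed.

Lemma primitive0 f : primitive f 0 = 0. Proof. exact: primitive_neg. Qed.

(** One estimate for three ends: [c = 0] gives the Lipschitz bound, the value at the left end the
    right derivative, and the value at the right end the Riemann error. *)
Lemma primitive_increment C f s t c e : bounded_measurable C f ->
  0 <= s -> s <= t -> (forall u, s < u <= t -> `|f u - c| <= e) ->
  `|primitive f t - primitive f s - (t - s) * c| <= e * (t - s).
Proof.
move=> bf s0 st H.
have mst : mu `]s, t] = (t - s)%:E.
  rewrite lebesgue_measure_itv /= lte_fin; case: ltP => // ts.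
  by have -> : s = t by [lra]; rewrite subrr.
have fi : mu.-integrable `]s, t] (EFin \o f).
  apply: (bounded_measurable_integrable bf); last by rewrite /= mst ltry.
  by move=> x /=; rewrite !in_itv /= andbT => /andP[sx _]; lra.
have ci (k : R) : mu.-integrable `]s, t] (EFin \o (fun=> k)).
  apply: measurable_bounded_integrable => //; first by rewrite /= mst ltry.
  by exists `|k|; split=> [|M kM x _]; [exact: num_real|exact: ltW].
have -> : primitive f t - primitive f s = \int[mu]_(x in `]s, t]) f x.
  rewrite /primitive Rintegral_itvB//.
  exact: primitive_integrable bf.
have int_cst (k : R) : \int[mu]_(x in `]s, t]) k = (t - s) * k.
  rewrite Rintegral_cst// mulrC; congr (_ * _).
  by rewrite -[RHS]/(fine (t - s)%:E) -mst.
rewrite -int_cst -RintegralB// mulrC -int_cst.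
have bi : mu.-integrable `]s, t] (EFin \o (fun u => f u - c)).
  have bfc : bounded_measurable (C + `|c|) (fun u => f u - c).
    case: bf => mf bf; split; first by apply: measurable_realfun.measurable_funB => //; exact: measurable_cst.
    by move=> u u0; apply: le_trans (ler_normB _ _) _; rewrite lerD2r bf.
  apply: (bounded_measurable_integrable bfc); last by rewrite /= mst ltry.
  by move=> x /=; rewrite !in_itv /= andbT => /andP[sx _]; lra.
apply: le_trans (le_normr_Rintegral _ bi) _ => //.
by apply: le_Rintegral => //; exact: integrable_norm.
Qed.

Lemma primitive_lipschitz C f s t : bounded_measurable C f -> s <= t ->
  `|primitive f t - primitive f s| <= C * (t - s).
Proof.
move=> bf st; have C0 : 0 <= C by case: bf => _ /(_ 0 (lexx _)); exact: le_trans.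
have [t0|t0] := leP t 0.
  by rewrite !primitive_neg//; [rewrite subrr normr0 mulr_ge0//; lra|lra].
have [s0|s0] := leP s 0.
  rewrite (primitive_neg f s0) -(primitive0 f).
  have := @primitive_increment C f 0 t 0 C bf (lexx _) (ltW t0).
  rewrite mulr0 subr0 => H; apply: le_trans (H _) _.
    by move=> u /andP[u0 _]; rewrite subr0; apply bf; exact: ltW.
  by rewrite ler_wpM2l//; lra.
have := @primitive_increment C f s t 0 C bf (ltW s0) st.
rewrite mulr0 subr0; apply => u /andP[su _].
by rewrite subr0; apply bf; lra.
Qed.

Lemma lipschitz_continuous f C :
  (forall s t, s <= t -> `|f t - f s| <= C * (t - s)) -> continuous f.
Proof.
move=> lf; have C0 : 0 <= C.
  by have := lf 0 1 ler01; rewrite subr0 mulr1; exact: le_trans.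
move=> t; apply/cvgrPdist_le => e e0; exists (e / (C + 1)) => /=.
  by rewrite divr_gt0//; lra.
move=> s; rewrite /= ltr_pdivlMr; last by lra.
move=> H; have [st|/ltW ts] := leP s t.
  by apply: le_trans (lf _ _ st) _; move: H; rewrite ger0_norm; [nra|lra].
rewrite distrC; apply: le_trans (lf _ _ ts) _.
by move: H; rewrite distrC ger0_norm; [nra|lra].
Qed.

Lemma primitive_continuous C f : bounded_measurable C f ->
  continuous (primitive f).
Proof.
by move=> bf; apply: (@lipschitz_continuous _ C) => s t; exact: primitive_lipschitz.
Qed.

Lemma primitive_rder C f t : bounded_measurable C f -> 0 <= t ->
  f s @[s --> t^'+] --> f t -> rder (primitive f) t (f t).
Proof.
move=> bf t0 /cvgrPdist_le cf; apply/rder_eps => e e0.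
have [d /= d0 Hd] := cf e e0; exists d; split=> // s /andP[ts sd].
rewrite (primitive_increment bf) ?(ltW ts)// => u /andP[tu us].
by rewrite distrC; apply: Hd => //=; rewrite distrC gtr0_norm; lra.
Qed.

End Primitive.

Section Geometric.
Variable R : realType.

Lemma le_of_geometric_slack (a b M : R) :
  (forall k, a <= b + M / 2 ^+ k) -> a <= b.
Proof.
move=> H; rewrite leNgt; apply/negP => ba.
have [M0|M0] := leP M 0.
  by have := H 0%N; rewrite expr0 divr1; lra.
have ab0 : 0 < a - b by lra.
have [n Hn] : exists n : nat, M / (a - b) < n%:R.
  by exists (Num.truncn (M / (a - b))).+1; rewrite truncnS_gt.
have : M / 2 ^+ n < a - b.
  rewrite ltr_pdivrMr ?exprn_gt0// mulrC -ltr_pdivrMr//.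
  by apply: lt_trans Hn _; rewrite -natrX ltr_nat ltn_expl.
by have := H n; lra.
Qed.

(** The intervals with centre [u k] and radius [2 * M / 2 ^+ k] are nested, and the supremum of
    their left ends lies in all of them. *)
Lemma geometric_limit (u : nat -> R) (M : R) :
  (forall k, `|u k.+1 - u k| <= M / 2 ^+ k) ->
  exists l, forall k, `|l - u k| <= 2 * M / 2 ^+ k.
Proof.
move=> H.
have M0 : 0 <= M by have := H 0%N; rewrite expr0 divr1; exact: le_trans.
have p0 k : 0 < (2 : R) ^+ k by rewrite exprn_gt0.
pose q k := M / 2 ^+ k.
have qS k : q k.+1 = q k / 2 by rewrite /q exprS; field; rewrite gt_eqF.
have q0 k : 0 <= q k by rewrite divr_ge0// ltW.
pose a k := u k - 2 * q k; pose b k := u k + 2 * q k.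
have aS k m : a k <= a (k + m)%N.
  elim: m => [|m IH]; first by rewrite addn0.
  apply: le_trans IH _; rewrite addnS /a qS.
  by have := H (k + m)%N; rewrite -/(q _) ler_norml => /andP[]; lra.
have bS k m : b (k + m)%N <= b k.
  elim: m => [|m IH]; first by rewrite addn0.
  apply: le_trans _ IH; rewrite addnS /b qS.
  by have := H (k + m)%N; rewrite -/(q _) ler_norml => /andP[]; lra.
have ab k m : a k <= b m.
  apply: le_trans (aS k m) _; apply: le_trans (bS m k); rewrite addnC.
  by rewrite /a /b; have := q0 (m + k)%N; lra.
have sa : has_sup (range a).
  by split; [exists (a 0%N); exists 0%N|exists (b 0%N) => _ [k _ <-]].
exists (sup (range a)) => k.
have h1 : a k <= sup (range a) by apply: sup_upper_bound => //; exists k.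
have h2 : sup (range a) <= b k by apply: sup_le_ub => [|_ [m _ <-]//]; case: sa.
by move: h1 h2; rewrite /a /b -mulrA -/(q k) => h1 h2; apply/ler_normlP; split; lra.
Qed.

Lemma rder_exp_bound (f : R -> R) (c b t : R) : 0 < b -> 0 <= t ->
  continuous f -> f 0 = 0 ->
  (forall s, 0 <= s -> exists2 l, rder f s l & `|l| <= c * b * expR (b * s)) ->
  `|f t| <= c * expR (b * t).
Proof.
move=> b0 t0 cf f0 df.
have c0 : 0 <= c.
  have [l _] := df 0 (lexx _); rewrite mulr0 expR0 mulr1 => h.
  by rewrite -(pmulr_lge0 c b0); exact: le_trans (normr_ge0 l) h.
have ce : continuous (fun s => c * expR (b * s)).
  move=> s; apply: cvgM; first exact: cvg_cst.
  apply: (@continuous_comp _ _ _ (fun s => b * s) expR); last exact: continuous_expR.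
  by apply: cvgM; [exact: cvg_cst|exact: cvg_id].
have de s : rder (fun s => c * expR (b * s)) s (c * (expR (b * s) * (b * 1))).
  apply: rderZ; apply: (@rder_comp _ expR (fun s => b * s)).
    by apply: cvgM; [exact: cvg_cst|exact: cvg_id].
  by apply: rderZ; exact: rder_id.
have wrap g : continuous g -> g 0 = 0 ->
    (forall s, 0 <= s -> exists2 l, rder g s l & `|l| <= c * b * expR (b * s)) ->
    g t <= c * expR (b * t).
  move=> cg g0 dg.
  have := @nonincr_rder _ (fun s => g s - c * expR (b * s)) 0 t t0.
  rewrite g0 mulr0 expR0 mulr1 => H.
  suff : g t - c * expR (b * t) <= 0 - c by lra.
  apply: H => [s|s /andP[s0 _]]; first by apply: cvgB; [exact: cg|exact: ce].
  have [l dl ll] := dg s s0; exists (l - c * (expR (b * s) * (b * 1))).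
    by apply: rderB.
  by move: ll; rewrite ler_norml => /andP[_]; nra.
apply/ler_normlP; split; last exact: wrap.
apply: (wrap (fun s => - f s)) => [s||s s0]; first by apply: cvgN; exact: cf.
  by rewrite f0 oppr0.
by have [l dl ll] := df s s0; exists (- l); [exact: rderN|rewrite normrN].
Qed.

End Geometric.

(** * Existence, uniqueness and stability for ordinary differential equations *)

Section Ode.
Variables (R : realType) (I : finType).
Implicit Types (x : I -> R) (y : R -> I -> R).
Variables (F : R -> (I -> R) -> I -> R) (B L : R).

Definition continuous_path y := forall i, continuous (y^~ i).

(** The last two clauses are stated along continuous paths: they make the integral of the field
    along an iterate meaningful and right differentiable, while jumps of the field in time stay
    allowed. *)
Record lipschitz_field : Prop := {
  field_bound : forall t x i, 0 <= t -> `|F t x i| <= B;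
  field_lip : forall t x x' r i, 0 <= t -> (forall j, `|x j - x' j| <= r) ->
    `|F t x i - F t x' i| <= L * r;
  field_measurable : forall y i, continuous_path y ->
    measurable_fun (`[0, +oo[ : set R) (fun s => F s (y s) i);
  field_right_cvg : forall y i t, continuous_path y -> 0 <= t ->
    F s (y s) i @[s --> t^'+] --> F t (y t) i }.

Definition ode_solution y := forall i, continuous (y^~ i) /\
  forall t, 0 <= t -> rder (y^~ i) t (F t (y t) i).

Hypothesis L0 : 0 < L.
Hypothesis FH : lipschitz_field.

Lemma field_path_bounded y i : continuous_path y ->
  bounded_measurable B (fun s => F s (y s) i).
Proof.
by move=> cy; split=> [|s s0]; [exact: field_measurable FH _ i cy|exact: field_bound FH _ _ i s0].
Qed.

Lemma integral_ode_solution y : continuous_path y ->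
  (forall i t, 0 <= t ->
    y t i = y 0 i + primitive (fun s => F s (y s) i) t) -> ode_solution y.
Proof.
move=> cy Hy i; split=> // t t0.
have := primitive_rder (field_path_bounded i cy) t0 (field_right_cvg FH (i := i) cy t0).
move=> /rder_eps H; apply/rder_eps => e e0; have [d [d0 Hd]] := H e e0.
exists d; split=> // s std; rewrite (Hy _ s) ?(Hy _ t)//; last by lra.
rewrite [X in `|X|](_ : _ = primitive (fun s => F s (y s) i) s - primitive (fun s => F s (y s) i) t -
   (s - t) * F t (y t) i); first exact: Hd.
by ring.
Qed.

Definition sqdist (x x' : I -> R) : R := \sum_i (x i - x' i) ^+ 2.

Lemma sqdist_ge0 x x' : 0 <= sqdist x x'.
Proof. by apply: sumr_ge0 => i _; exact: sqr_ge0. Qed.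

Lemma sqdist_coord x x' i : (x i - x' i) ^+ 2 <= sqdist x x'.
Proof.
by rewrite /sqdist (bigD1 i)//= lerDl sumr_ge0// => j _; exact: sqr_ge0.
Qed.

Lemma sqdist_le x x' r : 0 <= r -> (forall i, `|x i - x' i| <= r) ->
  sqdist x x' <= #|I|%:R * r ^+ 2.
Proof.
move=> r0 H; rewrite mulr_natl -sumr_const; apply: ler_sum => i _.
by rewrite -[leLHS]real_normK ?num_real// lerXn2r ?nnegrE.
Qed.

Lemma sqdist_coord_norm x x' i : `|x i - x' i| <= Num.sqrt (sqdist x x').
Proof. by rewrite -sqrtr_sqr ler_sqrt ?sqdist_ge0 ?sqdist_coord. Qed.

Lemma rder_sqdist y y' t : ode_solution y -> ode_solution y' -> 0 <= t ->
  exists2 l, rder (fun s => sqdist (y s) (y' s)) t l &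
    `|l| <= 2 * #|I|%:R * L * sqdist (y t) (y' t).
Proof.
move=> sy sy' t0.
pose D i : R := F t (y t) i - F t (y' t) i.
exists (\sum_i (D i * (y t i - y' t i) + (y t i - y' t i) * D i)).
  apply: rder_sum => i _.
  have [cy dy] := sy i; have [cy' dy'] := sy' i.
  have dd : rder (fun s => y s i - y' s i) t (D i) by apply: rderB; [exact: dy|exact: dy'].
  have cd : {for t, continuous (fun s => y s i - y' s i)}.
    by apply: cvgB; [exact: cy|exact: cy'].
  exact: (rderM cd dd dd).
set r := Num.sqrt (sqdist (y t) (y' t)).
have r2 : sqdist (y t) (y' t) = r * r by rewrite -expr2 sqr_sqrtr ?sqdist_ge0.
have r0 : 0 <= r by exact: sqrtr_ge0.
apply: le_trans (ler_norm_sum _ _ _) _.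
have -> : 2 * #|I|%:R * L * sqdist (y t) (y' t) = \sum_(i : I) (2 * L * (r * r)).
  by rewrite sumr_const -mulr_natl r2; ring.
apply: ler_sum => i _.
rewrite [X in `|X|](_ : _ = 2 * (D i * (y t i - y' t i))); last by ring.
rewrite !normrM ger0_norm// -!mulrA ler_pM2l// mulrA.
by apply: ler_pM => //; [apply: field_lip FH _ _ _ _ _ t0 _ => j|]; exact: sqdist_coord_norm.
Qed.

Lemma sqdist_continuous y y' : continuous_path y -> continuous_path y' ->
  continuous (fun s => sqdist (y s) (y' s)).
Proof.
move=> cy cy' t; apply: cvg_sumr => i _.
have cd : {for t, continuous (fun s => y s i - y' s i)}.
  by apply: cvgB; [exact: cy|exact: cy'].
by apply: cvgM; exact: cd.
Qed.

Lemma ode_path y : ode_solution y -> continuous_path y.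
Proof. by move=> sy i; case: (sy i). Qed.

Lemma sqdist_forward y y' t : ode_solution y -> ode_solution y' -> 0 <= t ->
  sqdist (y t) (y' t) <= sqdist (y 0) (y' 0) * expR (2 * #|I|%:R * L * t).
Proof.
move=> sy sy' t0; rewrite -{3}[t]subr0.
apply: (@gronwall_rder _ (fun s => sqdist (y s) (y' s))) => //.
  by apply: sqdist_continuous; exact: ode_path.
move=> s /andP[s0 _]; have [l dl ll] := rder_sqdist sy sy' s0.
by exists l => //; apply: le_trans ll; exact: ler_norm.
Qed.

(** Gronwall for the negated distance: solutions approach each other at most exponentially fast.
    This makes the inverse of the time-[t] map Lipschitz without solving the equation backwards. *)
Lemma sqdist_backward y y' t : ode_solution y -> ode_solution y' -> 0 <= t ->
  sqdist (y 0) (y' 0) <= sqdist (y t) (y' t) * expR (2 * #|I|%:R * L * t).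
Proof.
move=> sy sy' t0; set c := 2 * #|I|%:R * L.
have := @gronwall_rder _ (fun s => - sqdist (y s) (y' s)) 0 t (- c) t0.
move=> H.
have {}H : - sqdist (y t) (y' t) <= - sqdist (y 0) (y' 0) * expR (- c * (t - 0)).
  apply: H => [s|s /andP[s0 _]].
    by apply: cvgN; apply: sqdist_continuous; exact: ode_path.
  have [l dl ll] := rder_sqdist sy sy' s0; exists (- l); first exact: rderN.
  by rewrite mulrNN; move: ll; rewrite -/c ler_norml => /andP[+ _]; lra.
by move: H; rewrite !mulNr subr0 lerN2 expRN ler_pdivrMr ?expR_gt0.
Qed.

Lemma ode_unique y y' : ode_solution y -> ode_solution y' -> y 0 = y' 0 ->
  forall t, 0 <= t -> y t = y' t.
Proof.
move=> sy sy' y0 t t0; have := sqdist_forward sy sy' t0.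
have -> : sqdist (y 0) (y' 0) = 0.
  by rewrite y0 /sqdist big1// => i _; rewrite subrr expr0n.
rewrite mul0r => d0; apply: funext => i.
have := le_trans (sqdist_coord _ _ i) d0.
by move=> h; apply/eqP; rewrite -subr_eq0 -sqrf_eq0 eq_le sqr_ge0 andbT.
Qed.

Fixpoint picard x (k : nat) (t : R) (i : I) : R :=
  if k is k'.+1 then x i + primitive (fun s => F s (picard x k' s) i) t else x i.

Lemma field_bound_ge0 (i : I) : 0 <= B.
Proof. exact: le_trans (field_bound FH (fun=> 0) i (lexx 0)). Qed.

Lemma picard_continuous x k : continuous_path (picard x k).
Proof.
elim: k => [|k IH] i /=; first by move=> t; exact: cvg_cst.
move=> t; apply: cvgD; first exact: cvg_cst.
exact: primitive_continuous (field_path_bounded i IH) t.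
Qed.

Lemma picard_lipschitz x k i s t : s <= t ->
  `|picard x k t i - picard x k s i| <= B * (t - s).
Proof.
move=> st; case: k => [|k] /=.
  by rewrite subrr normr0 mulr_ge0 ?(field_bound_ge0 i)//; lra.
rewrite opprD addrACA subrr add0r.
exact: (primitive_lipschitz (@field_path_bounded _ i (@picard_continuous x k)) st).
Qed.

Lemma primitive_field_rder y i t : continuous_path y -> 0 <= t ->
  rder (primitive (fun s => F s (y s) i)) t (F t (y t) i).
Proof.
move=> cy t0.
by apply: (primitive_rder (field_path_bounded i cy) t0); exact: field_right_cvg FH _ _ _ cy t0.
Qed.

Lemma picard_rder x k i t : 0 <= t ->
  rder (fun s => picard x k.+1 s i) t (F t (picard x k t) i).
Proof.
move=> t0; rewrite -[F _ _ _]add0r; apply: rderD; first exact: rder_cst.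
exact: (@primitive_field_rder (picard x k) i t (@picard_continuous x k) t0).
Qed.

Lemma picard_weight_ge0 (i : I) t : 0 <= B / (2 * L) * expR (2 * L * t).
Proof.
by rewrite mulr_ge0 ?expR_ge0// divr_ge0 ?(field_bound_ge0 i)// mulr_ge0// ltW.
Qed.

(** In the weight [expR (2 * L * t)] one integration of the Lipschitz bound costs the factor
    [L / (2 * L)], so successive differences halve on the whole half-line at once and no local
    solutions have to be glued. The constant [B / (2 * L)] starts the induction through
    [1 + x <= expR x]. *)
Lemma picard_step x k t i : `|picard x k.+1 t i - picard x k t i| <=
  B / (2 * L) * expR (2 * L * t) / 2 ^+ k.
Proof.
have B0 := field_bound_ge0 i.
have L20 : 0 < 2 * L by rewrite mulr_gt0.
have [t0|t0] := leP t 0.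
  have -> : picard x k t i = x i by case: k => //= k; rewrite primitive_neg ?addr0.
  rewrite /= primitive_neg// addr0 subrr normr0.
  by rewrite divr_ge0 ?exprn_ge0 ?(picard_weight_ge0 i).
elim: k => [|k IH] in t t0 i B0 *.
  rewrite expr0 divr1 /= addrC addKr.
  have := primitive_lipschitz (@field_path_bounded _ i (@picard_continuous x 0)) (ltW t0).
  rewrite primitive0 !subr0 => /le_trans; apply.
  have := expR_ge1Dx (2 * L * t) => h.
  rewrite -mulrA ler_wpM2l// -ler_pdivrMl ?invr_gt0// invrK.
  by lra.
have : `|(picard x k.+2 t i - picard x k.+1 t i)| <=
    (B / (2 * L) / 2 ^+ k.+1) * expR (2 * L * t).
  apply: (@rder_exp_bound _ (fun s => picard x k.+2 s i - picard x k.+1 s i)) => //.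
  - exact: ltW.
  - by move=> s; apply: cvgB; exact: picard_continuous.
  - by rewrite /= !primitive0 subrr.
  move=> s; rewrite le_eqVlt => s0.
  have s0' : 0 <= s by case/orP: s0 => [/eqP<-//|/ltW].
  exists (F s (picard x k.+1 s) i - F s (picard x k s) i).
    by apply: rderB; exact: picard_rder.
  apply: le_trans (field_lip FH (r := B / (2 * L) * expR (2 * L * s) / 2 ^+ k) i s0' _) _.
    move=> j; case/predU1P: s0 => [<-|s0]; last exact: IH.
    have -> : picard x k 0 j = x j by case: k {IH} => //= k; rewrite primitive0 addr0.
    rewrite /= primitive0 addr0 subrr normr0.
    by rewrite divr_ge0 ?exprn_ge0 ?(picard_weight_ge0 i).
  apply: le_of_eq; rewrite exprS; field.
  by rewrite gt_eqF ?exprn_gt0// gt_eqF.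
move/le_trans; apply; apply: le_of_eq.
by rewrite mulrAC.
Qed.

Theorem ode_exists x : exists y,
  [/\ y 0 = x, ode_solution y & forall i t, 0 <= t ->
    y t i = y 0 i + primitive (fun s => F s (y s) i) t].
Proof.
pose M t := B / (2 * L) * expR (2 * L * t).
have /choice[y0 Hy0] : forall ti : R * I, exists l, forall k,
    `|l - picard x k ti.1 ti.2| <= 2 * M ti.1 / 2 ^+ k.
  by move=> [t i]; apply: geometric_limit => k; exact: picard_step.
pose y t i := y0 (t, i).
have {}Hy0 t i k : `|y t i - picard x k t i| <= 2 * M t / 2 ^+ k := Hy0 (t, i) k.
have ylip i s t : s <= t -> `|y t i - y s i| <= B * (t - s).
  move=> st; apply: (@le_of_geometric_slack _ _ _ (2 * M t + 2 * M s)) => k.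
  have := picard_lipschitz x k i st; have := Hy0 t i k; have := Hy0 s i k.
  rewrite mulrDl !ler_norml => /andP[? ?] /andP[? ?] /andP[? ?].
  by apply/andP; split; lra.
have cy : continuous_path y by move=> i; exact: lipschitz_continuous (ylip i).
have y0x : y 0 = x.
  apply: funext => i; apply/eqP; rewrite -subr_eq0 -normr_le0.
  apply: (@le_of_geometric_slack _ _ _ (2 * M 0)) => k; rewrite add0r.
  have <- : picard x k 0 i = x i by case: k => //= k; rewrite primitive0 addr0.
  exact: Hy0.
have inty i t : 0 <= t -> y t i = y 0 i + primitive (fun s => F s (y s) i) t.
  move=> t0; apply/eqP; rewrite -subr_eq0 -normr_le0 y0x.
  (* The slack has two sources: the distance from [y] to the iterate [k.+1], and [L * t] times its
     distance to the iterate [k] under the integral. *)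
  apply: (@le_of_geometric_slack _ _ _ (2 * M t + L * (2 * M t) * t)) => k; rewrite add0r.
  have H1 : `|y t i - picard x k.+1 t i| <= 2 * M t / 2 ^+ k.
    have B0 := field_bound_ge0 i.
    have M0 : 0 <= M t.
      exact: picard_weight_ge0 i _.
    apply: le_trans (Hy0 _ _ _) _; apply: ler_wpM2l; first by rewrite mulr_ge0.
    by rewrite lef_pV2 ?posrE ?exprn_gt0// ler_weXn2l// ler1n.
  have H2 : `|picard x k.+1 t i - (x i + primitive (fun s => F s (y s) i) t)| <=
      L * (2 * M t / 2 ^+ k) * t.
    pose g s := primitive (fun s => F s (picard x k s) i) s - primitive (fun s => F s (y s) i) s.
    have := @rder_lipschitz _ g 0 t (L * (2 * M t / 2 ^+ k)) t0.
    rewrite /g !primitive0 !subr0 /= opprD addrACA subrr add0r; apply.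
      move=> s; apply: cvgB; apply: primitive_continuous; apply: field_path_bounded => //.
      exact: picard_continuous.
    move=> s /andP[s0 st].
    exists (F s (picard x k s) i - F s (y s) i).
      by apply: rderB; apply: primitive_field_rder => //; exact: picard_continuous.
    apply: (field_lip FH) => // j; rewrite distrC; apply: le_trans (Hy0 _ _ _) _.
    rewrite ler_wpM2r ?invr_ge0 ?exprn_ge0// ler_pM2l// /M.
    have B0 := field_bound_ge0 i.
    apply: ler_wpM2l; first by rewrite divr_ge0// mulr_ge0// ltW.
    by rewrite ler_expR ler_pM2l ?mulr_gt0// ltW.
  have -> : y t i - (x i + primitive (fun s => F s (y s) i) t) = (y t i - picard x k.+1 t i) +
    (picard x k.+1 t i - (x i + primitive (fun s => F s (y s) i) t)) by ring.
  apply: le_trans (ler_normD _ _) _; apply: le_trans (lerD H1 H2) _.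
  apply: le_of_eq; field.
  by rewrite gt_eqF ?exprn_gt0.
by exists y; split=> //; exact: integral_ode_solution.
Qed.

End Ode.

(** * Elementary estimates for the sine *)

Section SineBounds.
Variable R : realType.
Implicit Types u v x : R.

Lemma sin_rder x : rder sin x (cos x).
Proof.
have := @rder_comp R sin id x 1 (cos x); rewrite mulr1; apply.
- exact: cvg_id.
- exact: rder_id.
Qed.

Lemma sin_lip_le u v : u <= v -> - (v - u) <= sin v - sin u <= v - u.
Proof.
move=> uv; apply/andP; split.
- suff : (- sin v - v) <= (- sin u - u) by lra.
  apply: (@nonincr_rder R (fun s => - sin s - s)) => //.
    by move=> s; apply: cvgB; [apply: cvgN; exact: continuous_sin|exact: cvg_id].
  move=> t _; exists (- cos t - 1).
    by apply: rderB; [apply: rderN; exact: sin_rder|exact: rder_id].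
  by have := cos_geN1 t; lra.
- suff : (sin v - v) <= (sin u - u) by lra.
  apply: (@nonincr_rder R (fun s => sin s - s)) => //.
    by move=> s; apply: cvgB; [exact: continuous_sin|exact: cvg_id].
  move=> t _; exists (cos t - 1).
    by apply: rderB; [exact: sin_rder|exact: rder_id].
  by have := cos_le1 t; lra.
Qed.

Lemma sin_lip u v : `|sin u - sin v| <= `|u - v|.
Proof.
wlog uv : u v / u <= v.
  move=> H; have [/H//|/ltW/H] := leP u v.
  by rewrite distrC [`|v - u|]distrC.
have := sin_lip_le uv; rewrite (distrC u) (distrC (sin u)) [`|v - u|]ger0_norm; last by lra.
by move=> /andP[? ?]; rewrite ler_norml; apply/andP; split; lra.
Qed.

Lemma pi_ge2 : 2 <= pi :> R.
Proof.
have := sin_lip (pi / 2) 0; rewrite sin_pihalf sin0 !subr0 normr1.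
by rewrite ger0_norm ?divr_ge0 ?pi_ge0//; lra.
Qed.

Lemma cos_ge_half x : -1 <= x <= 1 -> 2^-1 <= cos x.
Proof.
move=> x1; have -> : x = x / 2 *+ 2 by rewrite mulr2n; lra.
rewrite cos_mulr2n cos2sin2.
have : sin (x / 2) ^+ 2 <= (x / 2) ^+ 2.
  rewrite -[leLHS]real_normK ?num_real// -[leRHS]real_normK ?num_real//.
  by rewrite lerXn2r ?nnegrE//; have := sin_lip (x / 2) 0; rewrite sin0 !subr0.
have : (x / 2) ^+ 2 <= 4^-1 by nra.
set s := sin _ ^+ 2; have -> : (1 - s) *+ 2 = 2 * (1 - s) by rewrite mulr_natl.
lra.
Qed.

Lemma sin_expansive u v : -1 <= u -> u <= v -> v <= 1 ->
  (v - u) / 2 <= sin v - sin u.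
Proof.
move=> u1 uv v1; suff : v / 2 - sin v <= u / 2 - sin u by lra.
apply: (@nonincr_rder R (fun s => s / 2 - sin s)) => //.
  move=> s; apply: cvgB; last exact: continuous_sin.
  by apply: cvgM; [exact: cvg_id|exact: cvg_cst].
move=> t tuv; exists (2^-1 * 1 - cos t).
  apply: rderB; last exact: sin_rder.
  have -> : (fun s => s / 2) = (fun s : R => 2^-1 * s) by apply: funext => s; rewrite mulrC.
  by apply: rderZ; exact: rder_id.
by rewrite mulr1; have := @cos_ge_half t ltac:(lra); lra.
Qed.

Lemma sin_norm_expansive u : `|u| <= 1 -> `|u| <= 2 * `|sin u|.
Proof.
move=> /ler_normlP[u1 u2]; have [u0|/ltW u0] := leP 0 u.
  have := @sin_expansive 0 u ltac:(lra) u0 u2; rewrite sin0 => h.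
  by rewrite !ger0_norm; lra.
have := @sin_expansive u 0 ltac:(lra) u0 ltac:(lra); rewrite sin0 => h.
by rewrite !ler0_norm; lra.
Qed.

Lemma sin_far x : 2^-1 <= `|x| -> `|x| <= pi / 2 -> 4^-1 <= `|sin x|.
Proof.
wlog x0 : x / 0 <= x.
  move=> H; have [/H//|/ltW x0] := leP 0 x.
  by rewrite -normrN => h1 h2; rewrite -normrN -sinN; apply: H; rewrite ?oppr_ge0.
rewrite ger0_norm// => x1 x2; apply: le_trans (ler_norm _).
have h : 4^-1 <= sin (2^-1 : R).
  have := @sin_expansive 0 (2^-1) ltac:(lra) ltac:(lra) ltac:(lra).
  by rewrite sin0; lra.
apply: le_trans h _; move: x1; rewrite le_eqVlt => /predU1P[<-//|x1].
by apply/ltW; rewrite ltr_sin// in_itv /=; have := pi_ge2; lra.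
Qed.

Definition parity_sign (k : int) : R := (-1) ^+ `|k|%N.

Lemma sinDnpi u (n : nat) : sin (u + pi * n%:R) = (-1) ^+ n * sin u.
Proof.
elim: n => [|n IH]; first by rewrite mulr0 addr0 expr0 mul1r.
by rewrite -natr1 mulrDr mulr1 addrA sinDpi IH exprS mulN1r mulNr.
Qed.

Lemma sinDzpi u (k : int) : sin (u + pi * k%:~R) = parity_sign k * sin u.
Proof.
have E (n : nat) : parity_sign (- n%:Z) = (-1) ^+ n by rewrite /parity_sign abszN.
case: (intP k) => [|n|n]; rewrite ?mulr0z ?mulr0 ?addr0 /parity_sign ?expr0 ?mul1r//.
  by rewrite -pmulrn sinDnpi.
rewrite abszN mulrNz mulrN -[in RHS](subrK (pi * n.+1%:R) u).
by rewrite sinDnpi -pmulrn mulrA -exprD addnn -mul2n exprM sqrrN expr1n expr1n mul1r.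
Qed.

Lemma parity_signB k l :
  parity_sign (k - l) = parity_sign k * parity_sign l.
Proof.
have E (i : int) : parity_sign i = (-1) ^ i.
  case: i => n; first by [].
  by rewrite -[RHS]/((-1) ^- n.+1) -exprVn invrN1.
rewrite !E expfzDr ?oppr_eq0 ?oner_eq0//.
congr (_ * _); rewrite -!E /parity_sign abszN //.
Qed.

Lemma parity_sign_cases k : {parity_sign k = 1} + {parity_sign k = -1}.
Proof.
rewrite /parity_sign -signr_odd; case: odd; [right|left]; by rewrite ?expr1.
Qed.

Lemma nearest_multiple_pi x : exists k : int, `|x - pi * k%:~R| <= pi / 2.
Proof.
have p0 := pi_gt0 R.
exists (Num.floor (x / pi + 2^-1)).
have /andP[h1 h2] := Num.Theory.floor_itv (x / pi + 2^-1).
move: h1 h2; set q : R := _%:~R; rewrite intrD -/q => h1 h2.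
have -> : x - pi * q = pi * (x / pi - q) by rewrite mulrBr mulrCA divff ?mulr1 ?gt_eqF.
rewrite normrM gtr0_norm// ler_pM2l//.
by apply/ler_normlP; split; lra.
Qed.

(** Leaving the nearest multiple of pi would force the distance to it through the value 1/2, where
    the sine has size at least 1/4; the intermediate value theorem excludes this. *)
Lemma trapped_near_multiple_pi (f : R -> R) (T : R) : continuous f ->
  (forall t, T <= t -> `|sin (f t)| < 4^-1) ->
  exists k : int, forall t, T <= t -> `|f t - pi * k%:~R| <= 2^-1.
Proof.
move=> cf Hf; have [k Hk] := nearest_multiple_pi (f T); exists k => t Tt.
pose g s := `|f s - pi * k%:~R|.
have cg : continuous g.
  by move=> s; apply: cvg_norm; apply: cvgB; [exact: cf|exact: cvg_cst].
have sg s : `|sin (f s)| = `|sin (f s - pi * k%:~R)|.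
  rewrite -{1}(subrK (pi * k%:~R) (f s)) sinDzpi normrM.
  by case: (parity_sign_cases k) => ->; rewrite ?normrN normr1 mul1r.
have avoid s : T <= s -> g s <= pi / 2 -> g s < 2^-1.
  move=> Ts gp; rewrite ltNge; apply/negP => h.
  by have := sin_far h gp; have := Hf s Ts; rewrite sg; lra.
have gT := avoid T (lexx _) Hk.
rewrite leNgt; apply/negP => gt.
have [||c] := @IVT R g T t 2^-1 Tt.
- exact: continuous_subspaceT.
- by rewrite ge_min (ltW gT) /= le_max (ltW gt) orbT.
rewrite in_itv /= => /andP[Tc ct] gc.
by have := avoid c Tc; rewrite gc ltxx => H; have := H ltac:(have := pi_ge2; lra).
Qed.

End SineBounds.

(** * The Kuramoto field with time-dependent coupling *)

Section CoupledField.
Variables (R : realType) (N : nat) (K M : R).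
Implicit Types (a : 'I_N -> 'I_N -> R) (x : 'I_N -> R).

Definition coupled_field a x (i : 'I_N) : R :=
  K / N%:R * \sum_j a i j * sin (x j - x i).

Record admissible_coupling (a : R -> 'I_N -> 'I_N -> R) : Prop := {
  coupling_bound : forall t i j, 0 <= t -> `|a t i j| <= M;
  coupling_measurable : forall i j,
    measurable_fun (`[0, +oo[ : set R) (fun s => a s i j);
  coupling_right_cvg : forall t i j, 0 <= t ->
    a s i j @[s --> t^'+] --> a t i j }.

Hypothesis K0 : 0 < K.

Lemma mean_norm_le (I : finType) (f : I -> R) (C : R) :
  0 <= C -> (forall i, `|f i| <= C) -> `|#|I|%:R^-1 * \sum_i f i| <= C.
Proof.
move=> C0 fC; rewrite normrM.
have [I0|I0] := posnP #|I|; first by rewrite I0 invr0 normr0 mul0r.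
rewrite gtr0_norm ?invr_gt0 ?ltr0n// ler_pdivrMl ?ltr0n//.
apply: le_trans (ler_norm_sum _ _ _) _.
by rewrite mulr_natl -sumr_const; apply: ler_sum.
Qed.

Lemma coupled_field_diff_bound a a' x x' i C :
  0 <= C -> (forall j, `|a i j * sin (x j - x i) - a' i j * sin (x' j - x' i)| <= C) ->
  `|coupled_field a x i - coupled_field a' x' i| <= K * C.
Proof.
move=> C0 H; rewrite /coupled_field -mulrBr -mulrA normrM gtr0_norm//.
rewrite ler_pM2l// -sumrB -{1}[N]card_ord.
exact: mean_norm_le.
Qed.

Lemma coupled_field_lipschitz (a : R -> 'I_N -> 'I_N -> R) :
  0 <= M -> admissible_coupling a ->
  lipschitz_field (fun t => coupled_field (a t)) (K * M) (2 * K * M).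
Proof.
move=> M0 Ha; split.
- move=> t x i t0.
  have := @coupled_field_diff_bound (a t) (fun _ _ => 0) x x i M M0.
  rewrite {2}/coupled_field.
  under [X in _ - _ * X]eq_bigr do rewrite mul0r.
  rewrite big1 ?mulr0 ?subr0//; apply=> j.
  rewrite mul0r subr0 normrM -[leRHS]mulr1.
  by apply: ler_pM => //; [exact: coupling_bound|exact: sin_max].
- move=> t x x' r i t0 Hr.
  have r0 : 0 <= r by exact: le_trans (Hr i).
  have -> : 2 * K * M * r = K * (M * (2 * r)) by ring.
  apply: coupled_field_diff_bound => [|j].
    by rewrite !mulr_ge0.
  rewrite -mulrBr normrM; apply: ler_pM => //; first exact: coupling_bound.
  apply: le_trans (sin_lip _ _) _.
  have -> : x j - x i - (x' j - x' i) = (x j - x' j) - (x i - x' i) by ring.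
  by apply: le_trans (ler_normB _ _) _; have := Hr i; have := Hr j; lra.
- move=> y i cy; rewrite /coupled_field.
  apply: measurable_realfun.measurable_funM; first exact: measurable_cst.
  apply: measurable_sum => j.
  apply: measurable_realfun.measurable_funM; first exact: coupling_measurable.
  apply: measurable_funTS; apply: measurable_realfun.continuous_measurable_fun.
  move=> s; apply: (@continuous_comp _ _ _ (fun s => y s j - y s i) sin).
    by apply: cvgB; exact: cy.
  exact: continuous_sin.
- move=> y i t cy t0; apply: cvgM; first exact: cvg_cst.
  apply: cvg_sumr => j _; apply: cvgM; first exact: coupling_right_cvg.
  apply: cvg_at_right_filter.
  apply: (@continuous_comp _ _ _ (fun s => y s j - y s i) sin).
    by apply: cvgB; exact: cy.
  exact: continuous_sin.
Qed.

End CoupledField.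

(** * The mean-field flow *)

Section BoundedLipschitz.
Variable R : realType.
Implicit Types f g : R -> R.

(** A class closed under sums and products and containing sines and cosines of Lipschitz functions,
    hence the dissipation of the order parameter. *)
Definition bounded_lipschitz f := exists C, 0 <= C /\
  forall s t, 0 <= s -> s <= t -> `|f t| <= C /\ `|f t - f s| <= C * (t - s).

Lemma bounded_lipschitzD f g : bounded_lipschitz f -> bounded_lipschitz g ->
  bounded_lipschitz (fun s => f s + g s).
Proof.
move=> [C [C0 fC]] [D [D0 gD]]; exists (C + D); split; first lra.
move=> s t s0 st; have [f1 f2] := fC s t s0 st; have [g1 g2] := gD s t s0 st.
split; first by apply: le_trans (ler_normD _ _) _; lra.
by rewrite opprD addrACA; apply: le_trans (ler_normD _ _) _; lra.
Qed.

Lemma bounded_lipschitzM f g : bounded_lipschitz f -> bounded_lipschitz g ->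
  bounded_lipschitz (fun s => f s * g s).
Proof.
move=> [C [C0 fC]] [D [D0 gD]]; exists (2 * C * D + C * D); split.
  by rewrite addr_ge0// !mulr_ge0.
move=> s t s0 st; have [f1 f2] := fC s t s0 st; have [g1 g2] := gD s t s0 st.
have CD : 0 <= C * D by rewrite mulr_ge0.
split; first by rewrite normrM; apply: le_trans (ler_pM _ _ f1 g1) _ => //; lra.
have -> : f t * g t - f s * g s = f t * (g t - g s) + (f t - f s) * g s by ring.
apply: le_trans (ler_normD _ _) _; rewrite !normrM.
have g3 : `|g s| <= D by have [] := gD s s s0 (lexx _).
apply: le_trans (lerD (ler_pM _ _ f1 g2) (ler_pM _ _ f2 g3)) _ => //.
have : 0 <= C * D * (t - s) by rewrite mulr_ge0//; lra.
lra.
Qed.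

Lemma bounded_lipschitz_cst c : bounded_lipschitz (fun=> c).
Proof.
exists `|c|; split=> // s t _ st; split=> //.
by rewrite subrr normr0 mulr_ge0//; lra.
Qed.

Lemma bounded_lipschitzB f g : bounded_lipschitz f -> bounded_lipschitz g ->
  bounded_lipschitz (fun s => f s - g s).
Proof.
move=> bf bg; apply: bounded_lipschitzD => //.
have := bounded_lipschitzM (bounded_lipschitz_cst (-1)) bg.
by under eq_fun do rewrite mulN1r.
Qed.

Lemma bounded_lipschitz_sum (I : Type) (r : seq I) (P : pred I) (f : I -> R -> R) :
  (forall i, P i -> bounded_lipschitz (f i)) ->
  bounded_lipschitz (fun s => \sum_(i <- r | P i) f i s).
Proof.
move=> H; elim: r => [|i r IH].
  by under eq_fun do rewrite big_nil; exact: bounded_lipschitz_cst.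
under eq_fun do rewrite big_cons.
by case Pi: (P i) => //; exact: (bounded_lipschitzD (H i Pi) IH).
Qed.

Lemma bounded_lipschitz_sin f C : 0 <= C ->
  (forall s t, 0 <= s -> s <= t -> `|f t - f s| <= C * (t - s)) ->
  bounded_lipschitz (fun s => sin (f s)).
Proof.
move=> C0 H; exists (1 + C); split; first lra.
move=> s t s0 st; split; first by apply: le_trans (sin_max _) _; lra.
apply: le_trans (sin_lip _ _) _; apply: le_trans (H s t s0 st) _.
by rewrite ler_wpM2r//; lra.
Qed.

Lemma bounded_lipschitz_cos f C : 0 <= C ->
  (forall s t, 0 <= s -> s <= t -> `|f t - f s| <= C * (t - s)) ->
  bounded_lipschitz (fun s => cos (f s)).
Proof.
move=> C0 H; under eq_fun do rewrite -sinDpihalf.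
apply: (@bounded_lipschitz_sin _ C) => // s t s0 st.
by rewrite opprD addrACA subrr addr0; exact: H.
Qed.

(* Barbalat's argument: U cannot increase by a fixed amount infinitely often. *)
Lemma barbalat (U W : R -> R) (c u : R) : 0 < c -> continuous U ->
  (forall t, 0 <= t -> rder U t (c * W t)) -> (forall t, 0 <= W t) ->
  bounded_lipschitz W -> (forall t, 0 <= t -> U t <= u) ->
  forall e, 0 < e -> exists T, 0 <= T /\ forall t, T <= t -> W t <= e.
Proof.
move=> c0 cU dU W0 [C [C0 HW]] Uu e e0.
have incr a b q : 0 <= a -> a <= b -> (forall s, a <= s < b -> q <= W s) ->
    U a + c * q * (b - a) <= U b.
  move=> a0 ab Wq.
  suff : c * q * (b - a) - U b <= c * q * (a - a) - U a by lra.
  apply: (@nonincr_rder R (fun s => c * q * (s - a) - U s)) => //.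
    by move=> s; apply: cvgB; [exact: continuous_affine|exact: cU].
  move=> s sab; exists (c * q - c * W s).
    by apply: rderB; [exact: rder_affine|apply: dU; lra].
  have : c * q <= c * W s by rewrite ler_pM2l// Wq.
  lra.
(* Within time [h] the function [W] drops by at most [e / 2], so a time with [W t > e] raises [U] by
   at least [g] over [[t, t + h]]. *)
pose h := e / (2 * (C + 1)).
have h0 : 0 < h by rewrite divr_gt0// mulr_gt0//; lra.
have Ch : C * h <= e / 2.
  rewrite /h mulrA ler_pdivrMr ?mulr_gt0//; last lra.
  by have : 0 < e / 2 by [lra]; nra.
pose g := c * (e / 2) * h.
have g0 : 0 < g by rewrite /g mulr_gt0// mulr_gt0// mulr_gt0// invr_gt0.
have sS : has_sup [set U t | t in [set t | 0 <= t]].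
  by split; [exists (U 0); exists 0 => //=|exists u => _ [t t0 <-]; exact: Uu].
(* From [T] on, less than [g] separates [U] from its supremum, because [U] never decreases. *)
have [_ [T T0 <-] UT] := sup_adherent g0 sS.
exists T; split=> // t Tt; rewrite leNgt; apply/negP => We.
have t0 : 0 <= t by apply: le_trans Tt.
have : U (t + h) <= sup [set U t | t in [set t | 0 <= t]].
  by apply: sup_upper_bound => //; exists (t + h) => //=; lra.
have h1 : U t + c * (e / 2) * (t + h - t) <= U (t + h).
  apply: incr => [//||s sth]; first by lra.
  have [_] := HW t s t0 ltac:(lra); rewrite ler_norml => /andP[H _].
  have : C * (s - t) <= C * h by rewrite ler_wpM2l//; lra.
  lra.
have h2 : U T + c * 0 * (t - T) <= U t by apply: incr.
move: h1 h2; rewrite mulr0 mul0r addr0.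
have -> : t + h - t = h by ring.
rewrite -/g; lra.
Qed.

End BoundedLipschitz.

(** * Gradient structure and two-cluster limits of the mean-field flow *)

Section MeanFlow.
Variables (R : realType) (N : nat) (K m : R).
Hypotheses (K0 : 0 < K) (m0 : 0 < m) (N0 : (0 < N)%N).
Implicit Types (x : 'I_N -> R) (z : R -> 'I_N -> R).

Definition mean_solution z :=
  ode_solution (fun _ : R => coupled_field K (fun _ _ : 'I_N => m)) z.

Lemma cst_admissible : admissible_coupling m (fun (_ : R) (_ _ : 'I_N) => m).
Proof.
split=> [t i j _|i j|t i j _]; first by rewrite ger0_norm// ltW.
  exact: measurable_cst.
exact: cvg_cst.
Qed.

Lemma mean_lipschitz_field :
  lipschitz_field (fun _ : R => coupled_field K (fun _ _ : 'I_N => m))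
    (K * m) (2 * K * m).
Proof. by apply: coupled_field_lipschitz => //; [exact: ltW|exact: cst_admissible]. Qed.

Definition cos_sum x := \sum_j cos (x j).
Definition sin_sum x := \sum_j sin (x j).
(** Let [Z] be the sum of the [exp(I x_j)], with [I] the imaginary unit. Then [torque x i] is the
    imaginary part of [Z exp(-I x_i)] and half the partial derivative in [x_i] of [order_sq], the
    squared modulus of [Z]: the mean-field flow is a gradient ascent of [order_sq]. *)
Definition torque x i := sin_sum x * cos (x i) - cos_sum x * sin (x i).
Definition order_sq x := cos_sum x ^+ 2 + sin_sum x ^+ 2.

Let kappa := K * m / N%:R.

Let kappa0 : 0 < kappa.
Proof. by rewrite /kappa divr_gt0 ?mulr_gt0 ?ltr0n. Qed.

Lemma mean_fieldE x i : coupled_field K (fun _ _ => m) x i = kappa * torque x i.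
Proof.
rewrite /coupled_field /torque /kappa -mulr_sumr /sin_sum /cos_sum.
rewrite mulrA [K / _ * m]mulrAC; congr (_ * _).
rewrite !mulr_suml -sumrB; apply: eq_bigr => j _.
by rewrite sinB; ring.
Qed.

Lemma mean_solution_lip z i s t : mean_solution z -> 0 <= s -> s <= t ->
  `|z t i - z s i| <= K * m * (t - s).
Proof.
move=> Hz s0 st; have [cz dz] := Hz i.
apply: (@rder_lipschitz R (z^~ i)) => // u /andP[su _].
exists (coupled_field K (fun _ _ => m) (z u) i); first by apply: dz; lra.
by apply: (field_bound mean_lipschitz_field _ _ (t := 0)).
Qed.

Lemma order_sq_rder z t : mean_solution z -> 0 <= t ->
  rder (fun s => order_sq (z s)) t (2 * kappa * \sum_i torque (z t) i ^+ 2).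
Proof.
move=> Hz t0.
pose d j := kappa * torque (z t) j.
have cs : continuous (fun s => cos_sum (z s)).
  move=> s; apply: cvg_sumr => j _.
  by apply: (@continuous_comp _ _ _ (z^~ j) cos); [exact: (Hz j).1|exact: continuous_cos].
have ss : continuous (fun s => sin_sum (z s)).
  move=> s; apply: cvg_sumr => j _.
  by apply: (@continuous_comp _ _ _ (z^~ j) sin); [exact: (Hz j).1|exact: continuous_sin].
have dz j : rder (z^~ j) t (d j).
  by rewrite /d -mean_fieldE; exact: (Hz j).2.
have dc : rder (fun s => cos_sum (z s)) t (\sum_j - sin (z t j) * d j).
  by apply: rder_sum => j _; apply: (@rder_comp R cos (z^~ j)); [exact: (Hz j).1|exact: dz].
have ds : rder (fun s => sin_sum (z s)) t (\sum_j cos (z t j) * d j).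
  by apply: rder_sum => j _; apply: (@rder_comp R sin (z^~ j)); [exact: (Hz j).1|exact: dz].
have := rderD (rderM (cs t) dc dc) (rderM (ss t) ds ds).
set l := (X in rder _ _ X -> _) => H.
have E : kappa * \sum_i torque (z t) i ^+ 2 =
    cos_sum (z t) * (\sum_j - sin (z t j) * d j) +
    sin_sum (z t) * (\sum_j cos (z t j) * d j).
  rewrite !mulr_sumr -big_split /=; apply: eq_bigr => j _.
  by rewrite /d expr2 {1}/torque; ring.
suff -> : 2 * kappa * \sum_i torque (z t) i ^+ 2 = l by [].
by rewrite /l -mulrA E; ring.
Qed.

Lemma norm_sum_le1 (f : 'I_N -> R) : (forall j, `|f j| <= 1) ->
  `|\sum_j f j| <= N%:R.
Proof.
move=> H; apply: le_trans (ler_norm_sum _ _ _) _.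
by apply: le_trans (ler_sum _ (fun i _ => H i)) _; rewrite sumr_const card_ord.
Qed.

Lemma order_sq_bounded x : order_sq x <= 2 * N%:R ^+ 2.
Proof.
have H (f : R -> R) : (forall u, `|f u| <= 1) -> (\sum_(j < N) f (x j)) ^+ 2 <= N%:R ^+ 2.
  move=> Hf; rewrite -[leLHS]real_normK ?num_real// lerXn2r ?nnegrE//.
  exact: norm_sum_le1.
by rewrite /order_sq mulr_natl mulr2n lerD// H//; [exact: cos_max|exact: sin_max].
Qed.

Lemma torque_to_zero z : mean_solution z -> forall e, 0 < e ->
  exists T, 0 <= T /\ forall t, T <= t -> \sum_i torque (z t) i ^+ 2 <= e.
Proof.
move=> Hz.
have Km : 0 <= K * m by rewrite mulr_ge0// ltW.
have bc i : bounded_lipschitz (fun s => cos (z s i)).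
  by apply: (bounded_lipschitz_cos Km) => s t; exact: mean_solution_lip.
have bs i : bounded_lipschitz (fun s => sin (z s i)).
  by apply: (bounded_lipschitz_sin Km) => s t; exact: mean_solution_lip.
apply: (@barbalat R (fun s => order_sq (z s)) _ (2 * kappa) (2 * N%:R ^+ 2)).
- by rewrite mulr_gt0.
- move=> s; apply: cvgD; apply: cvgM; apply: cvg_sumr => j _;
  by apply: (@continuous_comp _ _ _ (z^~ j)); [exact: (Hz j).1|
    first [exact: continuous_sin|exact: continuous_cos]].
- by move=> t; exact: order_sq_rder.
- by move=> t; apply: sumr_ge0 => i _; exact: sqr_ge0.
- apply: bounded_lipschitz_sum => i _.
  have bt : bounded_lipschitz (fun s => torque (z s) i).
    apply: bounded_lipschitzB; apply: bounded_lipschitzM => //;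
    by apply: bounded_lipschitz_sum.
  exact: bounded_lipschitzM.
- by move=> t _; exact: order_sq_bounded.
Qed.

(** The imaginary part of the product of [Z exp(-I x_i)] with the conjugate of [Z exp(-I x_j)], each
    split into a radial part and a torque. Small torques thus make all sines of differences small
    once [order_sq] is bounded below. *)
Lemma torque_sin x i j :
  order_sq x * sin (x j - x i) =
  torque x i * (cos_sum x * cos (x j) + sin_sum x * sin (x j)) -
  (cos_sum x * cos (x i) + sin_sum x * sin (x i)) * torque x j.
Proof. by rewrite sinB /order_sq /torque; ring. Qed.

Lemma radial_bound x i : `|cos_sum x * cos (x i) + sin_sum x * sin (x i)| <= 2 * N%:R.
Proof.
have H (f : R -> R) : (forall u, `|f u| <= 1) -> `|\sum_(j < N) f (x j)| <= N%:R.
  by move=> Hf; exact: norm_sum_le1.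
apply: le_trans (ler_normD _ _) _; rewrite !normrM.
have h1 : `|cos_sum x| * `|cos (x i)| <= N%:R * 1.
  by apply: ler_pM => //; [apply: H; exact: cos_max|exact: cos_max].
have h2 : `|sin_sum x| * `|sin (x i)| <= N%:R * 1.
  by apply: ler_pM => //; [apply: H; exact: sin_max|exact: sin_max].
by lra.
Qed.

(** [order_sq] never decreases, so its initial value is the lower bound needed in [torque_sin]; the
    4 in [q] counts two terms with radial factor at most [2 * N]. *)
Lemma sin_differences_to_zero z : mean_solution z -> 0 < order_sq (z 0) ->
  forall e, 0 < e -> exists T, 0 <= T /\
    forall t i j, T <= t -> `|sin (z t i - z t j)| <= e.
Proof.
move=> Hz U0 e e0.
have N1 : 0 < N%:R :> R by rewrite ltr0n.
pose q := order_sq (z 0) * e / (4 * N%:R).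
have q0 : 0 < q by rewrite !(divr_gt0, mulr_gt0).
have [T [T0 HT]] := torque_to_zero Hz (exprn_gt0 2 q0).
exists T; split=> // t j i Tt; have t0 : 0 <= t by exact: le_trans Tt.
have Ut : order_sq (z 0) <= order_sq (z t).
  suff : - order_sq (z t) <= - order_sq (z 0) by lra.
  apply: (@nonincr_rder R (fun s => - order_sq (z s))) => //.
    move=> s; apply: cvgN; apply: cvgD; apply: cvgM; apply: cvg_sumr => k _;
    by apply: (@continuous_comp _ _ _ (z^~ k)); [exact: (Hz k).1|
      first [exact: continuous_sin|exact: continuous_cos]].
  move=> s /andP[s0 _]; exists (- (2 * kappa * \sum_i torque (z s) i ^+ 2)).
    by apply: rderN; exact: order_sq_rder.
  by rewrite oppr_le0 mulr_ge0 ?sumr_ge0 => // [|k _]; [rewrite mulr_ge0// ltW|exact: sqr_ge0].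
have tq k : `|torque (z t) k| <= q.
  rewrite -(ler_pXn2r (n := 2))// ?nnegrE ?(ltW q0)// real_normK ?num_real//.
  apply: le_trans (HT t Tt); rewrite (bigD1 k)//= lerDl sumr_ge0// => l _.
  exact: sqr_ge0.
rewrite -(ler_pM2l U0).
have : order_sq (z t) * `|sin (z t j - z t i)| <= order_sq (z 0) * e.
  rewrite -{1}(gtr0_norm (lt_le_trans U0 Ut)) -normrM torque_sin.
  apply: le_trans (ler_normB _ _) _; rewrite !normrM.
  have h1 := ler_pM (normr_ge0 _) (normr_ge0 _) (tq i) (radial_bound (z t) j).
  have h2 := ler_pM (normr_ge0 _) (normr_ge0 _) (radial_bound (z t) i) (tq j).
  apply: le_trans (lerD h1 h2) _.
  apply: le_of_eq; rewrite /q; field.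
  by rewrite gt_eqF.
by apply: le_trans; rewrite ler_wpM2r.
Qed.

Lemma mean_flow_settles z : mean_solution z -> 0 < order_sq (z 0) ->
  exists k : 'I_N -> int, forall e, 0 < e -> exists T, 0 <= T /\
    forall t i j, T <= t -> `|z t i - z t j - pi * (k i - k j)%:~R| <= e.
Proof.
move=> Hz U0; pose i0 := Ordinal N0.
(* Any threshold below the 1/4 of [trapped_near_multiple_pi] fixes the integers [k] once; smaller
   [e] are reached with the same [k], because the sine is expansive near its zeros. *)
have e0 : 0 < 8^-1 :> R by lra.
have [T [T0 HT]] := sin_differences_to_zero Hz U0 e0.
have /choice[k Hk] : forall i, exists k : int, forall t, T <= t ->
    `|z t i - z t i0 - pi * k%:~R| <= 2^-1.
  move=> i; apply: (@trapped_near_multiple_pi R (fun t => z t i - z t i0)).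
    by move=> s; apply: cvgB; exact: (Hz _).1.
  by move=> t Tt; have := HT t i i0 Tt; lra.
exists k => e ep; have e4 : 0 < e / 4 by lra.
have [T' [T0' HT']] := sin_differences_to_zero Hz U0 e4.
exists (Num.max T T'); split; first by rewrite le_max T0.
move=> t i j; rewrite ge_max => /andP[Tt Tt'].
have near l : `|z t l - z t i0 - pi * (k l)%:~R| <= e / 2.
  have h := Hk l t Tt.
  apply: le_trans (sin_norm_expansive _) _; first by lra.
  have -> : `|sin (z t l - z t i0 - pi * (k l)%:~R)| = `|sin (z t l - z t i0)|.
    rewrite -[in RHS](subrK (pi * (k l)%:~R) (z t l - z t i0)) sinDzpi normrM.
    by case: (parity_sign_cases R (k l)) => ->; rewrite ?normrN normr1 mul1r.
  by have := HT' t l i0 Tt'; lra.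
have -> : z t i - z t j - pi * (k i - k j)%:~R =
  (z t i - z t i0 - pi * (k i)%:~R) - (z t j - z t i0 - pi * (k j)%:~R).
  by rewrite intrB; ring.
by apply: le_trans (ler_normB _ _) _; have := near i; have := near j; lra.
Qed.

(* Around a two-cluster equilibrium the flow is cooperative once the second
   cluster is reflected: with e i the reflected difference of two nearby
   solutions, e stays positive and its sum grows exponentially. *)
Lemma cluster_order_expands z z' (k : 'I_N -> int) T :
  mean_solution z -> mean_solution z' -> 0 <= T ->
  (exists i j, parity_sign R (k i) != parity_sign R (k j)) ->
  (forall t i j, T <= t -> `|z t i - z t j - pi * (k i - k j)%:~R| <= 1) ->
  (forall t i j, T <= t -> `|z' t i - z' t j - pi * (k i - k j)%:~R| <= 1) ->
  ~ (forall i, 0 < parity_sign R (k i) * (z' T i - z T i)).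
Proof.
move=> Hz Hz' T0 [i1 [j1 kij]] near near' pos.
pose sg i : R := parity_sign R (k i).
have sgP i : {sg i = 1} + {sg i = -1} by exact: parity_sign_cases.
have sg2 i : sg i * sg i = 1.
  by case: (sgP i) => ->; rewrite ?mulrNN mul1r.
pose e t i := sg i * (z' t i - z t i).
(* [u] and [u'] are phase differences measured from the limiting pattern; [kappa * h t i j] is the
   contribution of [j] to the derivative of [e i]. *)
pose u t i j := z t j - z t i - pi * (k j - k i)%:~R.
pose u' t i j := z' t j - z' t i - pi * (k j - k i)%:~R.
pose h t i j := sg j * (sin (u' t i j) - sin (u t i j)).
have u1 t i j : T <= t -> -1 <= u t i j <= 1.
  by move=> Tt; rewrite -ler_norml; exact: near.
have u1' t i j : T <= t -> -1 <= u' t i j <= 1.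
  by move=> Tt; rewrite -ler_norml; exact: near'.
have uu t i j : u' t i j - u t i j = sg j * e t j - sg i * e t i.
  by rewrite /u /u' /e !mulrA !sg2; ring.
have sinE (v : R) i j : sg i * sin v = sg j * sin (v - pi * (k j - k i)%:~R).
  rewrite -{1}(subrK (pi * (k j - k i)%:~R) v) sinDzpi mulrA; congr (_ * _).
  suff -> : parity_sign R (k j - k i) = sg j * sg i by rewrite mulrCA sg2 mulr1.
  exact: parity_signB.
have de t i : T <= t -> rder (fun s => e s i) t (kappa * \sum_j h t i j).
  move=> Tt; have t0 : 0 <= t by exact: le_trans Tt.
  have -> : kappa * \sum_j h t i j =
      sg i * (coupled_field K (fun _ _ => m) (z' t) i - coupled_field K (fun _ _ => m) (z t) i).
    have -> : \sum_j h t i j =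
        sg i * (\sum_j sin (z' t j - z' t i) - \sum_j sin (z t j - z t i)).
      rewrite -sumrB mulr_sumr; apply: eq_bigr => j _.
      by rewrite /h !mulrBr -!sinE.
    by rewrite /coupled_field -!mulr_sumr /kappa; ring.
  by apply: rderZ; apply: rderB; [exact: (Hz' i).2|exact: (Hz i).2].
have ce i : continuous (fun s => e s i).
  move=> s; apply: cvgM; first exact: cvg_cst.
  by apply: cvgB; [exact: (Hz' i).1|exact: (Hz i).1].
have hlow t i j : T <= t -> 0 <= e t i -> 0 <= e t j -> - e t i <= h t i j.
  move=> Tt ei ej; have /andP[a1 a2] := u1 t i j Tt; have /andP[b1 b2] := u1' t i j Tt.
  have := uu t i j; rewrite /h.
  have [ab|/ltW ab] := leP (u t i j) (u' t i j).
    have := sin_expansive a1 ab b2; have /andP[_] := sin_lip_le ab.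
    by case: (sgP i) => ->; case: (sgP j) => ->; lra.
  have := sin_expansive b1 ab a2; have /andP[_] := sin_lip_le ab.
  by case: (sgP i) => ->; case: (sgP j) => ->; lra.
(* Within a cluster the two contributions cancel. Across clusters the reflection gives them the same
   sign, and they add up to at least [e t i + e t j]. *)
have hsym t i j : T <= t -> 0 <= e t i -> 0 <= e t j ->
    (if sg i == sg j then 0 else e t i) <= h t i j + h t j i.
  move=> Tt ei ej.
  have ou : u t j i = - u t i j by rewrite /u !intrB; ring.
  have ou' : u' t j i = - u' t i j by rewrite /u' !intrB; ring.
  rewrite {2}/h ou ou' !sinN.
  have [->|sij] := eqVneq; first by rewrite /h; lra.
  have sE : sg j = - sg i.
    by move: sij; case: (sgP i) => ->; case: (sgP j) => ->; rewrite ?eqxx ?opprK.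
  have /andP[a1 a2] := u1 t i j Tt; have /andP[b1 b2] := u1' t i j Tt.
  have := uu t i j; rewrite /h sE.
  have [ab|/ltW ab] := leP (u t i j) (u' t i j).
    have := sin_expansive a1 ab b2; have /andP[_] := sin_lip_le ab.
    by case: (sgP i) => ->; lra.
  have := sin_expansive b1 ab a2; have /andP[_] := sin_lip_le ab.
  by case: (sgP i) => ->; lra.
(* Across clusters [e t i + e t j] is the size of [u' - u], and both of these lie in [[-1, 1]]. *)
have ebound t i j : T <= t -> sg i != sg j -> 0 <= e t i -> 0 <= e t j -> e t i <= 2.
  move=> Tt sij ei ej; have /andP[a1 a2] := u1 t i j Tt; have /andP[b1 b2] := u1' t i j Tt.
  have := uu t i j; move: sij.
  by case: (sgP i) => ->; case: (sgP j) => ->; rewrite ?eqxx// => _; lra.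
have partner i : exists j, sg i != sg j.
  have [ii|] := eqVneq (sg i) (sg i1); last by exists i1.
  by exists j1; rewrite ii.
(* [hlow] needs all coordinates nonnegative, so positivity is bootstrapped: continuity keeps it for
   a short time, on which the decay rate is at most [K * m], since each of the [N] contributions
   costs at most [e i]. *)
have epos t : T <= t -> forall i, e T i * expR (- (K * m) * (t - T)) <= e t i.
  have N1 : N%:R != 0 :> R by rewrite pnatr_eq0 -lt0n.
  move: t; apply: real_induction.
  - by move=> i; rewrite subrr mulr0 expR0 mulr1.
  - move=> t Tt Hs.
    have et i : 0 < e t i.
      apply: lt_le_trans (Hs t _ i); last by rewrite Tt lexx.
      by rewrite mulr_gt0 ?expR_gt0//; exact: pos.
    have /choice[d Hd] : forall i, exists d, 0 < d /\ forall s, t <= s < t + d -> 0 <= e s i.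
      move=> i; have /cvgrPdist_lt/(_ _ (et i))[d /= d0 Hd] := ce i t.
      exists d; split=> // s /andP[ts sd].
      have := Hd s; rewrite /= distrC ger0_norm; last by lra.
      by move=> /(_ ltac:(lra)) /ltr_normlP[_]; lra.
    pose d0 := \big[Num.min/1]_i d i.
    exists d0; split.
      rewrite /d0; elim/big_ind: _ => // [a b a0 b0|i _]; first by rewrite lt_min a0.
      by have [] := Hd i.
    have eall s : t <= s < t + d0 -> forall i, 0 <= e s i.
      move=> sd i; apply (Hd i).2; apply/andP; split; first by case/andP: sd.
      case/andP: sd => _ sd; apply: lt_le_trans sd _; rewrite lerD2l.
      by rewrite /d0 (bigD1 i)//= ge_min lexx.
    move=> s /andP[ts sd] i.
    have : - e s i <= - e t i * expR (- (K * m) * (s - t)).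
      apply: (@gronwall_rder R (fun s => - e s i)) => //.
        by move=> r; apply: cvgN; exact: ce.
      move=> r /andP[tr rs]; have Tr : T <= r by exact: le_trans tr.
      have er := eall r ltac:(lra).
      exists (- (kappa * \sum_j h r i j)); first by apply: rderN; exact: de.
      rewrite mulrNN -[leRHS]opprK lerN2 -mulrN.
      have -> : K * m * - e r i = kappa * \sum_(j < N) (- e r i).
        by rewrite sumr_const card_ord -mulr_natr /kappa; field.
      by rewrite ler_pM2l//; apply: ler_sum => j _; exact: hlow.
    rewrite mulNr lerN2; apply: le_trans.
    have -> : - (K * m) * (s - T) = - (K * m) * (t - T) + - (K * m) * (s - t) by ring.
    by rewrite expRD mulrA ler_wpM2r ?expR_ge0// Hs// Tt lexx.
  - move=> t Tt Hs i.
    rewrite -subr_ge0.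
    apply: (@le_left_limit R (fun s => e s i - e T i * expR (- (K * m) * (s - T))) T) => // [s|s sTt].
      apply: cvgB; first exact: ce.
      apply: cvgM; first exact: cvg_cst.
      apply: (@continuous_comp _ _ _ (fun s => - (K * m) * (s - T)) expR).
        exact: continuous_affine.
      exact: continuous_expR.
    by rewrite subr_ge0; apply: Hs.
have eall t i : T <= t -> 0 <= e t i.
  move=> Tt; apply: le_trans (epos t Tt i).
  by rewrite mulr_ge0 ?expR_ge0// ltW//; exact: pos.
pose E t := \sum_i e t i.
have E0 : 0 < E T.
  rewrite /E (bigD1 i1)//= ltr_wpDr//; last exact: pos.
  by apply: sumr_ge0 => i _; rewrite ltW//; exact: pos.
have Eb t : T <= t -> E t <= 2 * N%:R.
  move=> Tt; have -> : 2 * N%:R = \sum_(i < N) (2 : R).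
    by rewrite sumr_const card_ord -[RHS]mulr_natr.
  apply: ler_sum => i _; have [j sij] := partner i.
  by apply: (ebound t i j) => //; exact: eall.
have Egrow t : T <= t -> E T * expR (kappa / 2 * (t - T)) <= E t.
  move=> Tt.
  have k2 : - E t <= - E T * expR (kappa / 2 * (t - T)).
    apply: (@gronwall_rder R (fun s => - E s)) => //.
      by move=> s; apply: cvgN; apply: cvg_sumr => i _; exact: ce.
    move=> s /andP[Ts _]; exists (- \sum_i (kappa * \sum_j h s i j)).
      by apply: rderN; apply: rder_sum => i _; exact: de.
    rewrite mulrN lerN2 -mulr_sumr -mulrA ler_pM2l//.
    (* After symmetrising, all terms are nonnegative and every [i] has a partner in the other
       cluster, whose term alone contributes [e i]. The factor 1/2 gives the rate [kappa / 2]. *)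
    have -> : \sum_i \sum_j h s i j = 2^-1 * \sum_i \sum_j (h s i j + h s j i).
      under [in RHS]eq_bigr do rewrite big_split /=.
      by rewrite big_split /= [X in _ + X]exchange_big /=; field.
    rewrite ler_pM2l ?invr_gt0//; apply: ler_sum => i _.
    have [j sij] := partner i; rewrite (bigD1 j)//=.
    have := hsym s i j Ts (eall s i Ts) (eall s j Ts); rewrite (negbTE sij) => h1.
    apply: le_trans h1 _; rewrite lerDl; apply: sumr_ge0 => l _.
    apply: le_trans (hsym s i l Ts (eall s i Ts) (eall s l Ts)).
    by case: ifP => // _; exact: eall.
  by rewrite -lerN2 -mulNr.
(* By [1 + x <= expR x] the exponential lower bound exceeds [2 * N] at this time. *)
pose t := T + 2 / kappa * (2 * N%:R / E T).
have q0 : 0 <= 2 * N%:R / E T by rewrite divr_ge0 ?mulr_ge0// ltW.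
have Tt : T <= t by rewrite lerDl mulr_ge0// divr_ge0// ltW.
have := le_trans (Egrow t Tt) (Eb t Tt); rewrite leNgt => /negP; apply.
have := expR_ge1Dx (kappa / 2 * (t - T)).
have -> : kappa / 2 * (t - T) = 2 * N%:R / E T by rewrite /t; field; rewrite !gt_eqF.
move=> h1; apply: lt_le_trans (_ : E T * (1 + 2 * N%:R / E T) <= _).
  by rewrite mulrDr mulr1 mulrCA divff ?gt_eqF// mulr1 ltrDr.
by rewrite ler_pM2l.
Qed.

End MeanFlow.

(** * Null sets of initial phases *)

Lemma half_series (R : realType) (e : R) : 0 < e ->
  (\sum_(0 <= n <oo) (e / (2 ^ n.+1)%:R)%:E <= e%:E)%E.
Proof.
move=> e0; have := @epsilon_trick R (fun=> 0%E) e xpredT (fun=> lexx _) (ltW e0).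
rewrite (_ : (\sum_(0 <= i <oo) 0 = 0)%E) ?add0e; last exact: eseries0.
by apply: le_trans; under [leRHS]eq_eseriesr do rewrite add0e.
Qed.

Section NullSets.
Variables (R : realType) (N : nat).
Implicit Types (S : set ('I_N -> R)) (a b : 'I_N -> R) (e : R).

Definition volume a b : R := \prod_i (b i - a i).

Lemma volume_ge0 a b : (forall i, a i <= b i) -> 0 <= volume a b.
Proof. by move=> ab; apply: prodr_ge0 => i _; rewrite subr_ge0. Qed.

Definition null_set S := forall e, 0 < e ->
  exists a b : nat -> 'I_N -> R,
    [/\ forall k i, a k i <= b k i,
        S `<=` \bigcup_k box (a k) (b k) &
        (\sum_(0 <= k <oo) (volume (a k) (b k))%:E <= e%:E)%E].

Lemma null_set_lebesgue_outer S : null_set S -> lebesgue_outer S = 0%E.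
Proof.
move=> nS; apply/eqP; rewrite eq_le; apply/andP; split.
- apply/lee_addgt0Pr => e e0; rewrite add0e.
  have [a [b [ab Sab vab]]] := nS e e0.
  by apply: ge_ereal_inf; eexists; [exists a, b; split|exact: vab].
- apply: le_ereal_inf_tmp => _ [a [b [ab _ ->]]].
  by apply: nneseries_ge0 => k _ _; rewrite lee_fin; exact: volume_ge0.
Qed.

Lemma null_set_subset S S' : S `<=` S' -> null_set S' -> null_set S.
Proof.
move=> SS' nS e e0; have [a [b [ab Sab vab]]] := nS e e0.
by exists a, b; split=> //; exact: subset_trans Sab.
Qed.

Lemma null_set_bigcup (S : nat -> set ('I_N -> R)) :
  (forall n, null_set (S n)) -> null_set (\bigcup_n S n).
Proof.
move=> nS e e0.
have /choice[ab Hab] : forall n, exists ab : (nat -> 'I_N -> R) * (nat -> 'I_N -> R),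
    [/\ forall k i, ab.1 k i <= ab.2 k i,
        S n `<=` \bigcup_k box (ab.1 k) (ab.2 k) &
        (\sum_(0 <= k <oo) (volume (ab.1 k) (ab.2 k))%:E <=
          (e / (2 ^ n.+1)%:R)%:E)%E].
  move=> n; have [|a [b [? ? ?]]] := nS n (e / (2 ^ n.+1)%:R).
    by rewrite divr_gt0// ltr0n expn_gt0.
  by exists (a, b).
have /card_esym/ppcard_eqP[f] := card_nat2.
pose A k := (ab (f k).1).1 (f k).2; pose B k := (ab (f k).1).2 (f k).2.
have AB k i : A k i <= B k i by have [H _ _] := Hab (f k).1; exact: H.
have v0 n j : (0 <= (volume ((ab n).1 j) ((ab n).2 j))%:E)%E.
  by rewrite lee_fin; apply: volume_ge0 => i; have [H _ _] := Hab n; exact: H.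
exists A, B; split=> //.
  move=> x [n _ Sx]; have [_ H _] := Hab n; have [j _ xj] := H x Sx.
  by exists (f^-1%FUN (n, j)) => //; rewrite /A /B invK ?inE.
pose v (p : nat * nat) := (volume ((ab p.1).1 p.2) ((ab p.1).2 p.2))%:E.
rewrite nneseries_esumT; last by move=> k; rewrite lee_fin; exact: volume_ge0.
rewrite -[leLHS](@reindex_esum R _ _ setT setT f v); last exact: bij.
rewrite (_ : [set: nat * nat] = [set: nat] `*`` (fun=> [set: nat])); last first.
  by apply/seteqP; split => // p _; split.
rewrite -(@esum_esum R _ _ _ _ (fun n j => v (n, j))); last by move=> i j _ _; exact: v0.
have E n : (\esum_(j in setT) v (n, j) <= (e / (2 ^ n.+1)%:R)%:E)%E.
  by rewrite -nneseries_esumT; [have [_ _ H] := Hab n|move=> j; exact: v0].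
apply: le_trans (le_esum _) _.
  by move=> n _; exact: E.
rewrite -nneseries_esumT; last first.
  by move=> n; rewrite lee_fin divr_ge0// ltW.
exact: half_series.
Qed.

(** The finite cover is continued by the degenerate box at the origin, which has volume zero only if
    there is at least one coordinate. *)
Lemma null_set_finite_cover S : (0 < N)%N ->
  (forall e, 0 < e -> exists (F : finType) (a b : F -> 'I_N -> R),
    [/\ forall k i, a k i <= b k i,
        forall x, S x -> exists k, box (a k) (b k) x &
        \sum_k volume (a k) (b k) <= e]) -> null_set S.
Proof.
move=> N0 H e e0; have [F [a [b [ab Sab vab]]]] := H e e0.
pose A k := if insub k : option 'I_#|F| is Some j then a (enum_val j) else fun=> 0.
pose B k := if insub k : option 'I_#|F| is Some j then b (enum_val j) else fun=> 0.
have AB k i : A k i <= B k i by rewrite /A /B; case: insub.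
exists A, B; split=> //.
  move=> x /Sab[k xk]; exists (enum_rank k) => //.
  by rewrite /A /B valK enum_rankK.
have v0 k : 0 <= volume (A k) (B k) by exact: volume_ge0.
apply: lime_le; first by apply: is_cvg_nneseries => n _ _; rewrite lee_fin.
apply: nearW => n; rewrite sumEFin lee_fin.
apply: le_trans vab.
apply: (@le_trans _ _ (\sum_(0 <= k < #|F| + n) volume (A k) (B k))).
  rewrite (@big_cat_nat _ _ _ n _ (#|F| + n))//= ?leq_addl// lerDl.
  by apply: sumr_ge0.
rewrite (@big_cat_nat _ _ _ #|F|)//= ?leq_addr//.
rewrite [X in _ + X]big_nat_cond [X in _ + X]big1 ?addr0; last first.
  move=> k /andP[/andP[Fk _] _]; rewrite /volume (bigD1 (Ordinal N0))//= /A /B.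
  by rewrite insubF ?subrr ?mul0r// ltnNge Fk.
rewrite big_mkord (reindex_onto enum_rank enum_val) /=; last by move=> *; exact: enum_valK.
under eq_bigl do rewrite enum_rankK eqxx.
apply: ler_sum => k _.
by rewrite /A /B valK enum_rankK.
Qed.

End NullSets.

(** * Lipschitz preimages of antichains *)

Section AntichainNull.
Variables (R : realType) (N : nat).

(* Cells of a grid of mesh 2M/n met by an antichain: along each diagonal at most
   two consecutive ones, so that the position of the diagonal and one parity
   determine the cell. *)
Lemma antichain_preimage_null (S : set ('I_N.+1 -> R))
    (f : ('I_N.+1 -> R) -> 'I_N.+1 -> R) (s : 'I_N.+1 -> R) (C M : R) :
  0 <= C -> 0 < M -> (forall i, `|s i| = 1) ->
  (forall x i, S x -> `|f x i| <= M) ->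
  (forall x y r, S x -> S y -> 0 <= r -> (forall i, `|f x i - f y i| <= r) ->
     forall i, `|x i - y i| <= C * r) ->
  (forall x y, S x -> S y -> ~ forall i, 0 < s i * (f y i - f x i)) ->
  null_set S.
Proof.
move=> C0 M0 s1 fM fC anti; apply: null_set_finite_cover => // e e0.
have [[x0 Sx0]|S0] := pselect (exists x, S x); last first.
  exists 'I_0, (fun _ _ => 0), (fun _ _ => 0); split=> //.
    by move=> x Sx; case: S0; exists x.
  by rewrite big_ord0 ltW.
(* [D / n] will bound the total volume: there are [2 * (2 * n).+1 ^ N] codes, and boxes of side
   [2 * C * h] with [h = 2 * M / n]. *)
pose D := 2 * (12 * C * M) ^+ N * (4 * C * M).
have D0 : 0 <= D by rewrite /D !mulr_ge0// ?exprn_ge0 ?mulr_ge0// ltW.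
pose n := (Num.truncn (D / e)).+1.
have nD : D / e < n%:R by rewrite /n truncnS_gt.
have n0 : 0 < n%:R :> R by rewrite ltr0n.
pose h := 2 * M / n%:R.
have h0 : 0 < h by rewrite !(divr_gt0, mulr_gt0).
(* Reflection by [s] and a shift reduce the order to the coordinatewise one on [[0, 2 * M]]; [q] is
   the cell index. *)
pose g x i := s i * f x i + M.
have g0 x i : S x -> 0 <= g x i <= 2 * M.
  move=> Sx; have : `|s i * f x i| <= M by rewrite normrM s1 mul1r fM.
  by move=> /ler_normlP[? ?]; rewrite /g; apply/andP; split; lra.
have gB x y i : `|f x i - f y i| = `|g x i - g y i|.
  by rewrite /g opprD addrACA subrr addr0 -mulrBr normrM s1 mul1r.
pose q x i := Num.truncn (g x i / h).
have qP x i : S x -> (q x i)%:R * h <= g x i < (q x i).+1%:R * h.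
  move=> Sx; have /andP[gx0 _] := g0 x i Sx.
  by rewrite -ler_pdivlMr// -ltr_pdivrMr//; apply: truncn_itv; rewrite divr_ge0// ltW.
have qn x i : S x -> (q x i <= n)%N.
  move=> Sx; have /andP[qg _] := qP x i Sx; have /andP[_ gM] := g0 x i Sx.
  rewrite -(ler_nat R) -(ler_pM2r h0); apply: le_trans qg _; apply: le_trans gM _.
  by rewrite /h mulrCA divff ?gt_eqF// mulr1.
(* Differences to the index of [ord0] determine the diagonal, with [+ n] keeping them natural; the
   parity of that index separates the two cells that may remain on it. *)
pose code x : {ffun 'I_N -> 'I_(2 * n).+1} * bool :=
  ([ffun j => inord (q x (lift ord0 j) + n - q x ord0)%N], odd (q x ord0)).
have codeP x y : S x -> S y -> code x = code y -> forall i, q x i = q y i.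
  move=> Sx Sy [/ffunP cxy oxy].
  have dq j : (q x (lift ord0 j) + n - q x ord0 = q y (lift ord0 j) + n - q y ord0)%N.
    have := cxy j; rewrite !ffunE => /(congr1 val) /=.
    have small z : S z -> (q z (lift ord0 j) + n - q z ord0 < (2 * n).+1)%N.
      move=> Sz; rewrite ltnS (leq_trans (leq_subr _ _))// mul2n -addnn leq_add2r.
      exact: qn.
    by rewrite !inordK ?small.
  have dd i : (q x i + q y ord0 = q y i + q x ord0)%N.
    case: (unliftP ord0 i) => [j ->|-> //]; last by rewrite addnC.
    have := dq j; have := qn x ord0 Sx; have := qn y ord0 Sy; lia.
  have strict z z' : S z -> S z' -> (forall i, q z i + q z' ord0 = q z' i + q z ord0)%N ->
      (q z ord0 + 2 <= q z' ord0)%N -> False.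
    move=> Sz Sz' dzz lt2; apply: (anti z z' Sz Sz') => i.
    have -> : s i * (f z' i - f z i) = g z' i - g z i by rewrite /g; ring.
    rewrite subr_gt0.
    have /andP[_ zg] := qP z i Sz; have /andP[zg' _] := qP z' i Sz'.
    apply: lt_le_trans zg _; apply: le_trans zg'; rewrite ler_pM2r// ler_nat.
    by have := dzz i; lia.
  have q00 : q x ord0 = q y ord0.
    have [lt|lt|//] := ltngtP (q x ord0) (q y ord0).
      have [lt2|] := leqP (q x ord0 + 2) (q y ord0); first by case: (strict x y Sx Sy dd lt2).
      move=> lt2; have E : q y ord0 = (q x ord0).+1 by lia.
      by move: oxy; rewrite E /=; case: odd.
    have [lt2|] := leqP (q y ord0 + 2) (q x ord0).
      by case: (strict y x Sy Sx (fun i => esym (dd i)) lt2).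
    move=> lt2; have E : q x ord0 = (q y ord0).+1 by lia.
    by move: oxy; rewrite E /=; case: odd.
  by move=> i; have := dd i; rewrite q00; lia.
(* One point of [S] per code becomes the centre of its box; codes that do not occur receive the
   default [x0]. *)
have /choice[rep Hrep] : forall c, exists z, S z /\
    ((exists2 x, S x & code x = c) -> code z = c).
  move=> c; have [[x Sx xc]|nx] := pselect (exists2 x, S x & code x = c).
    by exists x.
  by exists x0; split=> // /nx.
exists ({ffun 'I_N -> 'I_(2 * n).+1} * bool)%type.
exists (fun c i => rep c i - C * h), (fun c i => rep c i + C * h).
have Ch : 0 <= C * h by rewrite mulr_ge0// ltW.
split=> [c i|x Sx|]; first by lra.
  exists (code x) => i; have [Sr Hr] := Hrep (code x).
  have {}Hr := Hr (ex_intro2 _ _ x Sx erefl).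
  suff : `|x i - rep (code x) i| <= C * h.
    by rewrite ler_norml => /andP[? ?]; apply/andP; split; lra.
  apply: fC => // [|j]; first exact: ltW.
  rewrite gB; have := codeP _ _ Sr Sx Hr j => E.
  have /andP[a1 a2] := qP x j Sx; have /andP[b1 b2] := qP _ j Sr.
  move: b1 b2 a2; rewrite E -natr1 mulrDl mul1r => b1 b2 a2.
  by apply/ler_normlP; split; lra.
rewrite (eq_bigr (fun=> (2 * (C * h)) ^+ N.+1)); last first.
  move=> c _; rewrite /volume (eq_bigr (fun=> 2 * (C * h))) ?prodr_const ?card_ord//.
  by move=> i _; ring.
rewrite sumr_const card_prod card_bool card_ffun !card_ord -[leLHS]mulr_natr natrM natrX.
have n3 : (2 * n).+1%:R <= 3 * n%:R :> R.
  by rewrite -natrM ler_nat; lia.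
apply: (@le_trans _ _ ((2 * (C * h)) ^+ N.+1 * ((3 * n%:R) ^+ N * 2))).
  apply: ler_wpM2l; first by rewrite exprn_ge0// mulr_ge0.
  by rewrite ler_wpM2r// lerXn2r ?nnegrE// mulr_ge0.
have -> : (2 * (C * h)) ^+ N.+1 * ((3 * n%:R) ^+ N * 2) = D / n%:R.
  have gen (u v : R) : u ^+ N.+1 * (v ^+ N * 2) = 2 * u * (u * v) ^+ N.
    by rewrite exprS exprMn; ring.
  rewrite gen; have -> : 2 * (C * h) * (3 * n%:R) = 12 * C * M.
    by rewrite /h; field; rewrite gt_eqF.
  by rewrite /D /h; ring.
by rewrite ler_pdivrMr// mulrC -ler_pdivrMr//; exact: ltW.
Qed.

End AntichainNull.

Section Lifts.
Variables (R : realType) (N : nat).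

Lemma coupled_field_shift (K : R) (a : 'I_N -> 'I_N -> R) (x : 'I_N -> R)
    (l : 'I_N -> int) i :
  coupled_field K a (fun j => x j + 2 * pi * (l j)%:~R) i = coupled_field K a x i.
Proof.
rewrite /coupled_field; congr (_ * _); apply: eq_bigr => j _; congr (_ * _).
have -> : x j + 2 * pi * (l j)%:~R - (x i + 2 * pi * (l i)%:~R) =
    x j - x i + pi * (2 * (l j - l i))%:~R.
  by rewrite intrM intrB; ring.
by rewrite sinDzpi /parity_sign abszM exprM sqrrN expr1n expr1n mul1r.
Qed.

Lemma ode_solution_shift (K : R) (a : R -> 'I_N -> 'I_N -> R) z (l : 'I_N -> int) :
  ode_solution (fun t => coupled_field K (a t)) z ->
  ode_solution (fun t => coupled_field K (a t))
    (fun t j => z t j + 2 * pi * (l j)%:~R).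
Proof.
move=> Hz i; split=> [t|t t0].
  by apply: cvgD; [exact: (Hz i).1|exact: cvg_cst].
rewrite coupled_field_shift -[X in rder _ _ X]addr0.
by apply: rderD; [exact: (Hz i).2|exact: rder_cst].
Qed.

Lemma parity_sign_even (d : int) : parity_sign R d = 1 -> exists l : int, d = 2 * l.
Proof.
rewrite /parity_sign -signr_odd; case E: (odd _).
  by rewrite expr1 => h; have := oner_neq0 R; move: h; lra.
move=> _; have E2 : (`|d| = 2 * `|d|./2)%N by rewrite mul2n -[LHS]odd_double_half E.
have [d0|d0] := leP 0 d.
  by exists (`|d|./2)%:Z; rewrite -PoszM -E2 gez0_abs.
by exists (- (`|d|./2)%:Z); rewrite mulrN -PoszM -E2 ltz0_abs// opprK.
Qed.

Definition spread (x : 'I_N -> R) : R := \sum_i \sum_j (x i - x j) ^+ 2.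

Lemma spread_le (x : 'I_N -> R) (e : R) : 0 <= e -> (forall i j, `|x i - x j| <= e) ->
  spread x <= (N%:R * e) ^+ 2.
Proof.
move=> e0 H.
have b i j : (x i - x j) ^+ 2 <= e ^+ 2.
  by rewrite -[leLHS]real_normK ?num_real// lerXn2r ?nnegrE.
apply: le_trans (ler_sum _ (fun i _ => ler_sum _ (fun j _ => b i j))) _.
rewrite !sumr_const !card_ord -(mulr_natr (e ^+ 2 *+ N)) -(mulr_natr (e ^+ 2)).
by apply: le_of_eq; ring.
Qed.

Lemma spread_coord (x : 'I_N -> R) i j : (x i - x j) ^+ 2 <= spread x.
Proof.
rewrite /spread (bigD1 i)//= (bigD1 j)//= -addrA lerDl addr_ge0//.
  by apply: sumr_ge0 => k _; exact: sqr_ge0.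
by apply: sumr_ge0 => k _; apply: sumr_ge0 => l _; exact: sqr_ge0.
Qed.

End Lifts.

Lemma null_set0 (R : realType) (N : nat) : (0 < N)%N -> null_set (@set0 ('I_N -> R)).
Proof.
move=> N0; apply: null_set_finite_cover => // e e0.
by exists 'I_0, (fun _ _ => 0), (fun _ _ => 0); split=> //; rewrite big_ord0 ltW.
Qed.

Lemma null_set_countable_union (R : realType) (N : nat) (I : countType)
    (S : I -> set ('I_N -> R)) : (0 < N)%N ->
  (forall i, null_set (S i)) -> null_set [set x | exists i, S i x].
Proof.
move=> N0 nS.
apply: (@null_set_subset _ _ _ (\bigcup_n
    (if unpickle n is Some i then S i else set0))).
  by move=> x [i Six]; exists (pickle i) => //; rewrite pickleK.
by apply: null_set_bigcup => n; case: unpickle => [i|]; [exact: nS|exact: null_set0].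
Qed.

(** * Full measure of the synchronising phases *)

Section Exceptional.
Variables (R : realType) (N : nat) (K m : R).
Hypotheses (K0 : 0 < K) (m0 : 0 < m).
Local Notation sol := (mean_solution (N := N.+1) K m).
Local Notation cube := [set x : 'I_N.+1 -> R | forall i, 0 <= x i < 2 * pi].

(** On the cell of phases nearest to the pattern [k], the sum of sines is strictly increasing for
    the order reflected by the parities, so its zero set is an antichain; the inner map is the
    identity. *)
Lemma incoherent_null (k : 'I_N.+1 -> int) :
  null_set (cube `&` [set x | sin_sum x = 0 /\
    forall i, `|x i - pi * (k i)%:~R| <= pi / 2]).
Proof.
have p0 := pi_gt0 R.
apply: (@antichain_preimage_null R N _ id (fun i => parity_sign R (k i)) 1 (2 * pi)) => //.
- by rewrite mulr_gt0.
- by move=> i; case: (parity_sign_cases R (k i)) => ->; rewrite ?normrN normr1.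
- by move=> x i [/(_ i) /andP[x0 x1] _]; rewrite ger0_norm// ltW.
- by move=> x y r _ _ _ H i; rewrite mul1r; exact: H.
move=> x y [_ [x0 xk]] [_ [y0 yk]] H.
suff : sin_sum x < sin_sum y by rewrite x0 y0 ltxx.
have lt_sin i : sin (x i) < sin (y i).
  rewrite -(subrK (pi * (k i)%:~R) (x i)) -(subrK (pi * (k i)%:~R) (y i)) !sinDzpi.
  have := H i; have := xk i; have := yk i; rewrite /= !ler_norml.
  case: (parity_sign_cases R (k i)) => -> /andP[? ?] /andP[? ?] ?.
    by rewrite !mul1r ltr_sin ?in_itv /=; lra.
  by rewrite !mulN1r ltrN2 ltr_sin ?in_itv /=; lra.
rewrite /sin_sum; apply: ltr_sum => //.
by apply/hasP; exists ord0; rewrite ?mem_index_enum.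
Qed.

(** By [cluster_order_expands] the states at time [n] form an antichain. [E] is the Lipschitz
    constant of the inverse time-[n] map, and phases in the cube move by at most [K * m * n].
    Natural times keep the number of cases countable. *)
Lemma cluster_null (phi : ('I_N.+1 -> R) -> R -> 'I_N.+1 -> R) (n : nat)
    (k : 'I_N.+1 -> int) :
  (forall x, sol (phi x) /\ phi x 0 = x) ->
  null_set (cube `&` [set x | (exists i j, parity_sign R (k i) != parity_sign R (k j)) /\
    forall t i j, n%:R <= t -> `|phi x t i - phi x t j - pi * (k i - k j)%:~R| <= 1]).
Proof.
move=> Hphi; have p0 := pi_gt0 R; have n0 : 0 <= n%:R :> R by [].
pose c := 2 * #|'I_N.+1|%:R * (2 * K * m) * n%:R.
pose E : R := Num.sqrt (#|'I_N.+1|%:R * expR c).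
apply: (@antichain_preimage_null R N _ (fun x => phi x n%:R)
  (fun i => parity_sign R (k i)) E (2 * pi + K * m * n%:R)).
- exact: sqrtr_ge0.
- by rewrite ltr_pwDl ?mulr_gt0// !mulr_ge0// ltW.
- by move=> i; case: (parity_sign_cases R (k i)) => ->; rewrite ?normrN normr1.
- move=> x i [/(_ i) /andP[x0 x1] _].
  have := mean_solution_lip K0 m0 i (Hphi x).1 (lexx 0) n0; rewrite (Hphi x).2 subr0 => h.
  rewrite -[phi _ _ _](subrK (x i)) addrC; apply: le_trans (ler_normD _ _) _.
  by rewrite lerD// ger0_norm// ltW.
- move=> x y r _ _ r0 H i.
  have := sqdist_backward (mean_lipschitz_field _ K0 m0) (Hphi x).1 (Hphi y).1 n0.
  rewrite (Hphi x).2 (Hphi y).2 -/c => h.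
  have := sqdist_coord_norm x y i; move=> /le_trans; apply.
  rewrite -[r]ger0_norm// -sqrtr_sqr -sqrtrM ?mulr_ge0 ?expR_ge0//.
  rewrite ler_wsqrtr//; apply: le_trans h _.
  rewrite [X in _ <= X]mulrAC ler_wpM2r ?expR_ge0//.
  exact: sqdist_le.
- move=> x y [_ [kij xn]] [_ [_ yn]].
  by apply: (cluster_order_expands K0 m0 _ (Hphi x).1 (Hphi y).1).
Qed.

(** The threshold 1/4 leaves room for the random perturbation: [spread_close] turns it into a spread
    below 1, where contraction takes over. *)
Definition sync_basin (n : nat) : set (torus R N.+1) :=
  [set al | exists z, [/\ sol z, forall i, angle (z 0 i) = al i &
    spread (z n%:R) < 4^-1]].

Theorem sync_basin_full : full_measure (\bigcup_n sync_basin n).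
Proof.
apply: null_set_lebesgue_outer.
have p0 := pi_gt0 R.
have L0 : 0 < 2 * K * m by rewrite !mulr_gt0.
have /choice[phi Hphi] : forall x, exists z, sol z /\ z 0 = x.
  move=> x; have [z [z0 Hz _]] := ode_exists L0 (mean_lipschitz_field _ K0 m0) x.
  by exists z.
pose S1 (k : {ffun 'I_N.+1 -> int}) := (cube `&` [set x | sin_sum x = 0 /\
    forall i, `|x i - pi * (k i)%:~R| <= pi / 2]).
pose S2 (nk : nat * {ffun 'I_N.+1 -> int}) := (cube `&` [set x |
    (exists i j, parity_sign R (nk.2 i) != parity_sign R (nk.2 j)) /\
    forall t i j, nk.1%:R <= t ->
      `|phi x t i - phi x t j - pi * (nk.2 i - nk.2 j)%:~R| <= 1]).
pose S s := match s with inl k => S1 k | inr nk => S2 nk end.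
apply: (@null_set_subset _ _ _ [set x | exists s, S s x]); last first.
  apply: null_set_countable_union => // -[k|[n k]] /=; first exact: incoherent_null.
  exact: cluster_null.
move=> x [xc xO].
have [U0|U0] := leP (order_sq x) 0.
  have s0 : sin_sum x = 0.
    apply/eqP; rewrite -sqrf_eq0 eq_le sqr_ge0 andbT.
    by apply: le_trans U0; rewrite /order_sq lerDr sqr_ge0.
  have /choice[k Hk] : forall i, exists k : int, `|x i - pi * k%:~R| <= pi / 2.
    by move=> i; exact: nearest_multiple_pi.
  exists (inl (finfun k)); split=> //; split=> // i.
  by rewrite ffunE; exact: Hk.
have [sx x0] := Hphi x; rewrite -x0 in U0.
have [k Hk] := mean_flow_settles K0 m0 (ltn0Sn N) sx U0.
have [kij|kij] := pselect (exists i j, parity_sign R (k i) != parity_sign R (k j)).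
  have [T [T0 HT]] := Hk 1 ltr01.
  exists (inr ((Num.truncn T).+1, finfun k)); split=> //; split=> /=.
    by have [i [j ij]] := kij; exists i, j; rewrite !ffunE.
  move=> t i j nt; rewrite !ffunE; apply: HT; apply: le_trans nt.
  by apply: ltW; rewrite truncnS_gt.
(* With all parities equal the integers [k i] differ by even numbers, so the lift shifted by
   multiples of 2 pi has phases that really meet. *)
exfalso; apply: xO.
have same i : parity_sign R (k i - k ord0) = 1.
  rewrite parity_signB; have [->|h] := eqVneq (parity_sign R (k i)) (parity_sign R (k ord0)).
    by case: (parity_sign_cases R (k ord0)) => ->; rewrite ?mulrNN mul1r.
  by case: kij; exists i, ord0.
have /choice[l Hl] : forall i, exists l : int, k i - k ord0 = 2 * l.
  by move=> i; apply: parity_sign_even; exact: same.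
(* With this precision [spread_le] gives 1/16, below the threshold 1/4. *)
have e0 : 0 < (4 * N.+1%:R)^-1 :> R by rewrite invr_gt0 mulr_gt0.
have [T [T0 HT]] := Hk _ e0.
exists (Num.truncn T).+1 => //.
exists (fun t i => phi x t i + 2 * pi * (- l i)%:~R); split.
- exact: (@ode_solution_shift R N.+1 K (fun _ _ _ => m)).
- move=> i; apply/angleE; exists (- l i); rewrite x0.
  by rewrite addrAC subrr add0r.
- apply: (@le_lt_trans _ _ ((N.+1%:R * (4 * N.+1%:R)^-1) ^+ 2)).
    apply: spread_le => [|i j]; first exact: ltW.
    have := HT (Num.truncn T).+1%:R i j (ltW (truncnS_gt _)).
    have -> : k i - k j = 2 * (l i - l j) by rewrite mulrBr -!Hl; ring.
    congr (_ <= _); congr Num.norm; rewrite intrM !intrN intrB; ring.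
  have -> : N.+1%:R * (4 * N.+1%:R)^-1 = 4^-1 :> R by field; rewrite gt_eqF.
  by rewrite expr2; lra.
Qed.

End Exceptional.

(** * Averaging along a path *)

Section TorusTopology.
Variables (R : realType).

Lemma angle_continuous : continuous (@angle R).
Proof. exact: pi_continuous. Qed.

Lemma angle_shift (x : R) (l : int) : angle (x + 2 * pi * l%:~R) = angle x.
Proof. by apply/angleE; exists l; rewrite addrAC subrr add0r. Qed.

(** A point whose class meets the ball is carried into it by a fixed translation by a multiple of 2
    pi, and so are the nearby points. *)
Lemma angle_ball_open (c e : R) : open ((@angle R) @` ball c e).
Proof.
rewrite /open /= /quotient_open openE => x /= [u cu xu].
have /angleE[l Hl] : angle u = angle x by [].
rewrite /interior; near=> x'; rewrite /preimage /=.
exists (x' + 2 * pi * l%:~R); last exact: angle_shift.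
near: x'; have cs : {for x, continuous (fun x' : R => x' + 2 * pi * l%:~R)}.
  by apply: cvgD; [exact: cvg_id|exact: cvg_cst].
apply: cs; have -> : x + 2 * pi * l%:~R = u by rewrite -Hl; ring.
by apply: open_nbhs_nbhs; split=> //; exact: ball_open.
Unshelve. all: by end_near. Qed.

Variables (N : nat) (K m : R).
Hypotheses (K0 : 0 < K) (m0 : 0 < m).

Lemma spread_close (x y : 'I_N.+1 -> R) (e : R) : 0 <= e ->
  (forall i, `|x i - y i| <= e) ->
  spread x <= 2 * spread y + 8 * (N.+1%:R * e) ^+ 2.
Proof.
move=> e0 H.
have b i j : (x i - x j) ^+ 2 <= 2 * (y i - y j) ^+ 2 + 8 * e ^+ 2.
  set p := (x i - y i) - (x j - y j); set d := y i - y j.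
  have -> : x i - x j = d + p by rewrite /d /p; ring.
  have p2 : p ^+ 2 <= (2 * e) ^+ 2.
    rewrite -[leLHS]real_normK ?num_real// lerXn2r ?nnegrE ?mulr_ge0//.
    by apply: le_trans (ler_normB _ _) _; have := H i; have := H j; lra.
  have -> : (d + p) ^+ 2 = 2 * d ^+ 2 + 2 * p ^+ 2 - (d - p) ^+ 2 by ring.
  by have := sqr_ge0 (d - p); move: p2; rewrite exprMn; lra.
apply: le_trans (ler_sum _ (fun i _ => ler_sum _ (fun j _ => b i j))) _.
under eq_bigr do rewrite big_split /= -mulr_sumr sumr_const card_ord.
rewrite big_split /= -mulr_sumr sumr_const card_ord lerD2l.
rewrite -(mulr_natr (8 * e ^+ 2 *+ N.+1)) -(mulr_natr (8 * e ^+ 2)).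
by apply: le_of_eq; ring.
Qed.

Lemma spread_lt_near (y : 'I_N.+1 -> R) (c : R) : spread y < c ->
  exists e, 0 < e /\ forall x, (forall i, `|x i - y i| <= e) -> spread x < c.
Proof.
move=> yc; pose D := 4 * (Num.sqrt (spread y) + 1).
have D0 : 0 < D by rewrite mulr_gt0// ltr_wpDl// sqrtr_ge0.
pose q := c - spread y; have q0 : 0 < q by rewrite subr_gt0.
have N1 : 0 < N.+1%:R ^+ 2 :> R by rewrite exprn_gt0.
pose e := Num.min 1 (q / (2 * (N.+1%:R ^+ 2 * D))).
have e0 : 0 < e by rewrite lt_min ltr01 divr_gt0// !mulr_gt0.
exists e; split=> // x H.
have e1 : e <= 1 by rewrite /e ge_min lexx.
have eq2 : N.+1%:R ^+ 2 * (e * D) <= q / 2.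
  have : e <= q / (2 * (N.+1%:R ^+ 2 * D)) by rewrite /e ge_min lexx orbT.
  by rewrite ler_pdivlMr ?mulr_gt0//; move=> h; lra.
have b i j : (x i - x j) ^+ 2 <= (y i - y j) ^+ 2 + e * D.
  set p := (x i - y i) - (x j - y j); set d := y i - y j.
  have -> : x i - x j = d + p by rewrite /d /p; ring.
  have p2 : `|p| <= 2 * e.
    by apply: le_trans (ler_normB _ _) _; have := H i; have := H j; lra.
  have d2 : `|d| <= Num.sqrt (spread y).
    by rewrite -sqrtr_sqr ler_wsqrtr// spread_coord.
  have -> : (d + p) ^+ 2 = d ^+ 2 + p * (2 * d + p) by ring.
  rewrite lerD2l; apply: le_trans (ler_norm _) _; rewrite normrM.
  have h : `|2 * d + p| <= D / 2.
    by apply: le_trans (ler_normD _ _) _; rewrite normrM ger0_norm// /D; lra.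
  by apply: le_trans (ler_pM _ _ p2 h) _ => //; lra.
apply: le_lt_trans (ler_sum _ (fun i _ => ler_sum _ (fun j _ => b i j))) _.
under eq_bigr do rewrite big_split /= sumr_const card_ord.
rewrite big_split /= sumr_const card_ord -/(spread y).
rewrite -(mulr_natr (e * D *+ N.+1)) -(mulr_natr (e * D)).
by move: eq2; rewrite /q; lra.
Qed.

(** Forward Gronwall: an initial error [d] in each coordinate grows to at most [e] by time [n].
    Nearby torus points are lifted next to [z 0] coordinate by coordinate. *)
Lemma sync_basin_open n : open (@sync_basin R N K m n : set (torus R N.+1)).
Proof.
rewrite openE => al [z [Hz z0 zn]].
have [e [e0 He]] := spread_lt_near zn.
have L0 : 0 < 2 * K * m by rewrite !mulr_gt0.
pose c := 2 * #|'I_N.+1|%:R * (2 * K * m) * n%:R.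
pose d := e / Num.sqrt (#|'I_N.+1|%:R * expR c).
have s0 : 0 < Num.sqrt (#|'I_N.+1|%:R * expR c).
  by rewrite sqrtr_gt0 mulr_gt0 ?expR_gt0// card_ord ltr0n.
have d0 : 0 < d by rewrite divr_gt0.
have near_al : nbhs (al : torus R N.+1)
    [set be | forall i, ((@angle R) @` ball (z 0 i) d) (be i)].
  apply: (@filter_forall (torus R N.+1) 'I_N.+1
    (fun i => [set be | ((@angle R) @` ball (z 0 i) d) (be i)]) (nbhs al)) => i.
  have := @proj_continuous 'I_N.+1 (fun=> circle R) i al.
  apply; apply: open_nbhs_nbhs; split; first exact: angle_ball_open.
  by exists (z 0 i); [exact: ballxx|exact: z0].
apply: (@filterS _ _ (@nbhs_filter (torus R N.+1) al) _ _ _ near_al) => be Hbe.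
have /choice[x Hx] : forall i, exists y, ball (z 0 i) d y /\ angle y = be i.
  by move=> i; have [y] := Hbe i; exists y.
have [z' [z'0 Hz' _]] := ode_exists L0 (mean_lipschitz_field _ K0 m0) x.
exists z'; split=> //; first by move=> i; rewrite z'0; have [_ ->] := Hx i.
apply: He => i.
have n0 : 0 <= n%:R :> R by [].
have := sqdist_forward (mean_lipschitz_field _ K0 m0) Hz' Hz n0; rewrite -/c => h.
apply: le_trans (sqdist_coord_norm _ _ _) _.
have -> : e = Num.sqrt (#|'I_N.+1|%:R * expR c * d ^+ 2).
  rewrite sqrtrM ?mulr_ge0 ?expR_ge0// sqrtr_sqr gtr0_norm// /d mulrC.
  by rewrite mulfVK// gt_eqF.
rewrite ler_wsqrtr//; apply: le_trans h _.
rewrite [leRHS]mulrAC ler_wpM2r ?expR_ge0//.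
apply: sqdist_le; first exact: ltW.
by move=> j; rewrite z'0; have [+ _] := Hx j; rewrite /ball /= distrC => /ltW.
Qed.

(** Compactness bounds the entry time. The individual [n] is kept, as the basins are not shown to
    increase with [n]. *)
Lemma compact_sync_basin (A : set (torus R N.+1)) : compact A ->
  A `<=` \bigcup_n sync_basin K m n ->
  exists n0, forall al, A al -> exists2 n, (n <= n0)%N & sync_basin K m n al.
Proof.
move=> cA Acov.
move: cA => /compact_near_coveringP cA.
pose P (n : nat) (al : torus R N.+1) :=
  exists2 k, (k <= n)%N & @sync_basin R N K m k al.
have [|n0 _ Hn0] := cA nat \oo P _ _.
  move=> al /Acov[k _ kal].
  exists (@sync_basin R N K m k, [set n | (k <= n)%N]) => /=.
    split; last by exists k.
    by have := @sync_basin_open k; rewrite openE; apply.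
  by move=> [be n] /= [kbe kn]; exists k.
by exists n0 => al Aal; exact: (Hn0 n0 (leqnn _) al Aal).
Qed.

End TorusTopology.

(** * Solutions driven by one realisation of the walks *)

Section PathSolutions.
Variables (R : realType) (V : finType) (N : nat) (w : V -> V -> R) (K : R).
Hypotheses (K0 : 0 < K).
Implicit Types (X : R -> 'I_N -> V).

Record regular_path X : Prop := {
  path_measurable : forall g : ('I_N -> V) -> R,
    measurable_fun (`[0, +oo[ : set R) (fun s => g (X s));
  path_right_cst : forall t, 0 <= t -> \forall s \near t^'+, X s = X t }.

Definition path_coupling X (t : R) (i j : 'I_N) := w (X t i) (X t j).

(** Starting the maximum at 1 keeps the constant positive even without vertices. *)
Definition coupling_max : R := \big[Num.max/1]_u \big[Num.max/1]_v `|w u v|.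

Lemma coupling_maxP u v : `|w u v| <= coupling_max.
Proof.
rewrite /coupling_max (bigD1 u)//= le_max; apply/orP; left.
by rewrite (bigD1 v)//= le_max lexx.
Qed.

Lemma coupling_max_ge1 : 1 <= coupling_max.
Proof.
rewrite /coupling_max; elim/big_rec: _ => // u x _ x1.
by rewrite le_max x1 orbT.
Qed.

Lemma path_right_cvg X (g : ('I_N -> V) -> R) t : regular_path X -> 0 <= t ->
  g (X s) @[s --> t^'+] --> g (X t).
Proof.
move=> rX t0; apply: cvg_near_cst.
by apply: filterS (path_right_cst rX t0) => s ->.
Qed.

Lemma path_coupling_admissible X : regular_path X ->
  admissible_coupling coupling_max (path_coupling X).
Proof.
move=> rX; split=> [t i j _|i j|t i j t0]; first exact: coupling_maxP.
  exact: (path_measurable rX (fun x => w (x i) (x j))).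
rewrite /path_coupling.
exact: (@path_right_cvg X (fun x => w (x i) (x j)) t rX t0).
Qed.

Lemma path_lipschitz_field X : regular_path X ->
  lipschitz_field (fun t => coupled_field K (path_coupling X t))
    (K * coupling_max) (2 * K * coupling_max).
Proof.
move=> rX; apply: coupled_field_lipschitz => //.
  by have := coupling_max_ge1; lra.
exact: path_coupling_admissible.
Qed.

Lemma krw_fieldE X s (y : 'I_N -> R) i :
  krw_field w K (fun=> 0) (X s) y i = coupled_field K (path_coupling X s) y i.
Proof. by rewrite /krw_field add0r. Qed.

Lemma max0_lipschitz (a b : R) : `|Num.max a 0 - Num.max b 0| <= `|a - b|.
Proof.
case: (leP a 0) => a0; case: (leP b 0) => b0; case: (ger0P (a - b)) => ab;
  by rewrite ?ler_norml; lra.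
Qed.

(** A lift in [krw_solution] is only continuous within [[0, +oo[]; freezing it at its initial value
    for negative times gives the total path required by [ode_solution]. *)
Lemma within_continuous_clamp (f : R -> R) :
  {within `[0, +oo[, continuous f} -> continuous (fun t : R => f (Num.max t 0)).
Proof.
move=> /subspace_continuousP cf t; apply/cvgrPdist_lt => e e0.
have t0 : [set` `[0, +oo[] (Num.max t 0 : R).
  by rewrite /= in_itv /= andbT le_max lexx orbT.
have /cvgrPdist_lt/(_ e e0)[d /= d0 Hd] := cf _ t0.
exists d => //= s ts; apply: Hd; last by rewrite /= in_itv /= andbT le_max lexx orbT.
apply: le_lt_trans ts.
exact: max0_lipschitz.
Qed.

(** For uniqueness, a competing lift differs from [y] initially by multiples of 2 pi. The field is
    invariant under such shifts, so it agrees with a shift of [y] and has the same image on the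
    torus. *)
Theorem unique_krw_solution_exists X (al : torus R N) (y0 : 'I_N -> R) :
  regular_path X -> (forall i, angle (y0 i) = al i) ->
  exists y, [/\ y 0 = y0, ode_solution (fun t => coupled_field K (path_coupling X t)) y &
    unique_krw_solution w K (fun=> 0) X al (fun t i => angle (y t i))].
Proof.
move=> rX y0al.
have FH := path_lipschitz_field rX.
have L0 : 0 < 2 * K * coupling_max.
  by rewrite !mulr_gt0//; have := coupling_max_ge1; lra.
have [y [yy0 Hy inty]] := ode_exists L0 FH y0.
exists y; split=> //; split.
  split; first by apply: funext => i; rewrite yy0 y0al.
  exists y => i; split=> [|t t0].
    by apply: continuous_subspaceT; exact: (Hy i).1.
  split=> //.
    rewrite (_ : (fun s => _) = EFin \o (fun s => coupled_field K (path_coupling X s) (y s) i)).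
      exact: (primitive_integrable _ (@field_path_bounded _ _ _ _ _ FH y i (ode_path Hy))).
    by apply: funext => s; rewrite krw_fieldE.
  rewrite inty//; congr (_ + _); apply: eq_Rintegral => s _.
  by rewrite krw_fieldE.
move=> th' [th'0 [y' Hy']] t t0.
pose yt s i := y' (Num.max s 0) i.
have cyt : continuous_path yt.
  by move=> i; apply: (@within_continuous_clamp (fun t => y' t i)); have [] := Hy' i.
have ytE s : 0 <= s -> yt s = y' s by move=> s0; rewrite /yt max_l.
have Hyt : ode_solution (fun t => coupled_field K (path_coupling X t)) yt.
  apply: (integral_ode_solution FH) => // i s s0.
  have [_ /(_ s s0)[_ _ ys]] := Hy' i.
  rewrite ytE// ytE// ys; congr (_ + _); apply: eq_Rintegral => u.
  by rewrite inE /= in_itv /= => /andP[u0 _]; rewrite krw_fieldE ytE.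
have /choice[l Hl] : forall i, exists l : int, y' 0 i - y 0 i = 2 * pi * l%:~R.
  move=> i; apply/angleE; have [_ /(_ 0 (lexx _))[h _ _]] := Hy' i.
  by rewrite -h th'0 yy0 y0al.
have Hys := ode_solution_shift l Hy.
have E := ode_unique FH Hyt Hys _ t0.
apply: funext => i; have [_ /(_ t t0)[-> _ _]] := Hy' i.
rewrite -ytE// E ?angle_shift//.
by apply: funext => j; rewrite ytE// -Hl; ring.
Qed.

End PathSolutions.

Section Averaging.
Variables (R : realType) (N : nat) (K m M : R).
Hypotheses (K0 : 0 < K) (m0 : 0 < m) (M0 : 0 <= M) (N0 : (0 < N)%N).

Lemma mean_norm_le_ord (f : 'I_N -> R) (C : R) : 0 <= C -> (forall j, `|f j| <= C) ->
  `|K / N%:R * \sum_j f j| <= K * C.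
Proof.
move=> C0 H; rewrite -mulrA normrM gtr0_norm// ler_pM2l//.
by have := mean_norm_le C0 H; rewrite card_ord.
Qed.

(** The square root is the Gronwall bound for the corrected error with rate [c]; the last [K] is the
    size of the corrector. The common factor [gamma] is taken out. *)
Definition averaging_constant (T : R) : R :=
  let c := 2 * N%:R * (2 * K * M) + N%:R in
  Num.sqrt (N%:R * (2 * K * M * K + 2 * K ^+ 2 * m) ^+ 2 / c * expR (c * T)) + K.

(* The corrector (K / N) sum_j P_ij sin (z_j - z_i), with P_ij a primitive of
   a_ij - m, absorbs the fluctuating part of the field: y - z minus the corrector
   has a derivative of order gamma. *)
Lemma averaging_estimate (a : R -> 'I_N -> 'I_N -> R) y z (T gamma : R) :
  admissible_coupling M a ->
  ode_solution (fun t => coupled_field K (a t)) y ->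
  mean_solution K m z -> y 0 = z 0 -> 0 <= T -> 0 <= gamma ->
  (forall i j t, i != j -> 0 <= t <= T ->
     `|primitive (fun s => a s i j - m) t| <= gamma) ->
  forall i, `|y T i - z T i| <= averaging_constant T * gamma.
Proof.
move=> Ha Hy Hz yz0 T0 g0 HP.
have N1 : 0 < N%:R :> R by rewrite ltr0n.
have LF := coupled_field_lipschitz K0 M0 Ha.
pose P t i j := primitive (fun s => a s i j - m) t.
have bP i j : bounded_measurable (M + m) (fun s => a s i j - m).
  split; first by apply: measurable_realfun.measurable_funB;
    [exact: coupling_measurable Ha _ _|exact: measurable_cst].
  move=> s s0; apply: le_trans (ler_normB _ _) _.
  by rewrite (gtr0_norm m0) lerD2r; exact: coupling_bound Ha _ _ _ s0.
pose sg t i j := sin (z t j - z t i).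
pose f t i := coupled_field K (fun _ _ => m) (z t) i.
have dsg t i j : 0 <= t -> rder (fun s => sg s i j) t (cos (z t j - z t i) * (f t j - f t i)).
  move=> t0; apply: (@rder_comp R sin (fun s => z s j - z s i)).
    by apply: cvgB; exact: (Hz _).1.
  by apply: rderB; exact: (Hz _).2.
have csg i j : continuous (fun s => sg s i j).
  move=> s; apply: (@continuous_comp _ _ _ (fun s => z s j - z s i) sin).
    by apply: cvgB; exact: (Hz _).1.
  exact: continuous_sin.
have dP t i j : 0 <= t -> rder (fun s => P s i j) t (a t i j - m).
  move=> t0; apply: (@primitive_rder R (M + m) (fun s => a s i j - m)) => //.
  by apply: cvgB; [exact: coupling_right_cvg Ha _ _ _ t0|exact: cvg_cst].
have cP i j : continuous (fun s => P s i j) by exact: primitive_continuous (bP i j).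
pose c t i := K / N%:R * \sum_j P t i j * sg t i j.
have cc i : continuous (fun s => c s i).
  move=> s; apply: cvgM; first exact: cvg_cst.
  by apply: cvg_sumr => j _; apply: cvgM; [exact: cP|exact: csg].
have fB t i : `|f t i| <= K * m.
  exact: (field_bound (mean_lipschitz_field _ K0 m0) _ _ (lexx 0)).
(* The diagonal drops out here, and again in [r] because the two velocities coincide. This matters
   because the diagonal couplings in general do not average to [m]. *)
have sgii t i : sg t i i = 0 by rewrite /sg subrr sin0.
have cB t i : 0 <= t <= T -> `|c t i| <= K * gamma.
  move=> tT; apply: mean_norm_le_ord => // j.
  have [->|ij] := eqVneq i j; first by rewrite sgii mulr0 normr0.
  rewrite normrM -[leRHS]mulr1; apply: ler_pM => //; last exact: sin_max.
  exact: HP.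
pose v t i := y t i - z t i - c t i.
pose r t i := K / N%:R * \sum_j P t i j * (cos (z t j - z t i) * (f t j - f t i)).
have rB t i : 0 <= t <= T -> `|r t i| <= K * (gamma * (2 * (K * m))).
  move=> tT; apply: mean_norm_le_ord => [|j].
    by rewrite !mulr_ge0// ltW.
  have [->|ij] := eqVneq i j; first by rewrite [f t j - f t j]subrr !mulr0 normr0 !mulr_ge0// ltW.
  rewrite normrM; apply: ler_pM => //; first exact: HP.
  rewrite normrM -[leRHS]mul1r; apply: ler_pM => //; first exact: cos_max.
  by apply: le_trans (ler_normB _ _) _; have := fB t i; have := fB t j; lra.
have dv t i : 0 <= t ->
    rder (fun s => v s i) t (coupled_field K (a t) (y t) i - coupled_field K (a t) (z t) i - r t i).
  move=> t0.
  have dc : rder (fun s => c s i) t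
      (K / N%:R * \sum_j ((a t i j - m) * sg t i j + P t i j * (cos (z t j - z t i) * (f t j - f t i)))).
    by apply: rderZ; apply: rder_sum => j _; apply: rderM; [exact: csg|exact: dP|exact: dsg].
  (* Differentiating the primitive turns [m] into [a t i j] in the field of [z], so that both fields
     carry the same coupling and the Lipschitz bound applies. *)
  have := rderB (rderB ((Hy i).2 t t0) ((Hz i).2 t t0)) dc.
  congr (rder _ _ _); rewrite big_split /= mulrDr opprD addrA; congr (_ - _).
  rewrite -addrA; congr (_ + _); rewrite -opprD; congr (- _).
  rewrite /coupled_field -mulrDr -big_split /=; congr (_ * _); apply: eq_bigr => j _.
  by rewrite /sg; ring.
have cv i : continuous (fun s => v s i).
  move=> s; apply: cvgB; last exact: cc.
  by apply: cvgB; [exact: (Hy i).1|exact: (Hz i).1].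
pose u t := \sum_i v t i ^+ 2.
have u0 t : 0 <= u t by apply: sumr_ge0 => i _; exact: sqr_ge0.
have vu t i : `|v t i| <= Num.sqrt (u t).
  rewrite -sqrtr_sqr ler_wsqrtr// /u (bigD1 i)//= lerDl sumr_ge0// => j _.
  exact: sqr_ge0.
pose D := gamma * (2 * K * M * K + 2 * K ^+ 2 * m).
have D0 : 0 <= D by rewrite /D !(mulr_ge0, addr_ge0, exprn_ge0)// ltW.
pose cst := 2 * N%:R * (2 * K * M) + N%:R.
have cst0 : 0 < cst by rewrite ltr_wpDl// !mulr_ge0// ltW.
have uT : u T <= (u 0 + N%:R * D ^+ 2 / cst) * expR (cst * (T - 0)).
  apply: gronwall_affine_rder => //.
  - move=> s; apply: cvg_sumr => i _; apply: cvgM; exact: cv.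
  - move=> t /andP[t0 tT]; have tT' : 0 <= t <= T by rewrite t0 ltW.
    pose l i := coupled_field K (a t) (y t) i - coupled_field K (a t) (z t) i - r t i.
    exists (\sum_i (l i * v t i + v t i * l i)).
      by apply: rder_sum => i _; apply: rderM; [exact: cv|exact: dv|exact: dv].
    set q := Num.sqrt (u t).
    have q0 : 0 <= q by exact: sqrtr_ge0.
    have q2 : u t = q ^+ 2 by rewrite sqr_sqrtr.
    have lB i : `|l i| <= 2 * K * M * q + D.
      apply: le_trans (ler_normB _ _) _.
      have h : `|coupled_field K (a t) (y t) i - coupled_field K (a t) (z t) i| <= 2 * K * M * (q + K * gamma).
        apply: (field_lip LF) => // j.
        have -> : y t j - z t j = v t j + c t j by rewrite /v; ring.
        apply: le_trans (ler_normD _ _) _; exact: lerD (vu t j) (cB t j tT').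
      by have := rB t i tT'; rewrite /D; lra.
    have -> : cst * u t + N%:R * D ^+ 2 = \sum_(i < N) (2 * (2 * K * M) * q ^+ 2 + q ^+ 2 + D ^+ 2).
      by rewrite sumr_const card_ord -[RHS]mulr_natr q2 /cst; ring.
    apply: ler_sum => i _.
    (* The cross term [2 * D * q] is at most [q ^+ 2 + D ^+ 2]; this is the origin of the summand
       [N] in [cst]. *)
    have h : `|l i * v t i| <= (2 * K * M * q + D) * q.
      by rewrite normrM; apply: ler_pM => //; exact: vu.
    have := le_trans (ler_norm _) h; rewrite [v t i * _]mulrC.
    by have := sqr_ge0 (q - D); lra.
  - by rewrite mulr_ge0 ?sqr_ge0.
have uz : u 0 = 0.
  rewrite /u big1// => i _; rewrite /v yz0 subrr sub0r /c.
  rewrite big1 ?mulr0 ?oppr0 ?expr0n// => j _.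
  by rewrite /P primitive0 mul0r.
move: uT; rewrite uz add0r subr0 => uT i.
have -> : y T i - z T i = v T i + c T i by rewrite /v; ring.
apply: le_trans (ler_normD _ _) _.
rewrite /averaging_constant -/cst mulrDl; apply: lerD; last first.
  by apply: cB; rewrite T0 lexx.
apply: le_trans (vu T i) _.
rewrite -[gamma]ger0_norm// -sqrtr_sqr -sqrtrM; last first.
  by rewrite mulr_ge0 ?expR_ge0// divr_ge0 ?(ltW cst0)// mulr_ge0 ?sqr_ge0.
rewrite ler_wsqrtr//; apply: le_trans uT _.
by rewrite /D; apply: le_of_eq; ring.
Qed.

End Averaging.

(** * Contraction of nearly synchronised phases *)

Section SyncPhase.
Variables (R : realType) (N : nat) (K M : R).
Hypotheses (K0 : 0 < K) (M0 : 0 <= M) (N0 : (0 < N)%N).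
Variables (a : R -> 'I_N -> 'I_N -> R) (beta : R -> R) (y : R -> 'I_N -> R) (T : R).
Hypotheses (Ha : admissible_coupling M a)
  (Hy : ode_solution (fun t => coupled_field K (a t)) y)
  (a_sym : forall t i j, a t i j = a t j i)
  (beta_le : forall t i j, 0 <= t -> beta t <= a t i j)
  (beta0 : forall t, 0 <= t -> 0 <= beta t)
  (beta_bm : bounded_measurable M beta)
  (beta_cvg : forall t, 0 <= t -> beta s @[s --> t^'+] --> beta t)
  (T0 : 0 <= T) (yT : spread (y T) < 1).

Let f t i := coupled_field K (a t) (y t) i.

Lemma double_sum_antisym (g : 'I_N -> 'I_N -> R) : (forall i j, g i j = - g j i) ->
  \sum_i \sum_j g i j = 0.
Proof.
move=> H; set s := LHS; suff : s = - s by lra.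
rewrite {1}/s exchange_big /= -sumrN; apply: eq_bigr => i _.
by rewrite -sumrN; apply: eq_bigr => j _; exact: H.
Qed.

Lemma field_sum0 t : \sum_i f t i = 0.
Proof.
rewrite /f /coupled_field -mulr_sumr double_sum_antisym ?mulr0// => i j.
by rewrite a_sym -mulrN -sinN opprB.
Qed.

(** Since the field sums to zero, the derivative reduces to [4 * N * \sum_i f t i * y t i];
    exchanging [i] and [j] under the symmetric coupling turns this into a sum over differences. *)
Lemma spread_rder t : 0 <= t -> rder (fun s => spread (y s)) t
  (- (2 * K) * \sum_i \sum_j a t i j * ((y t i - y t j) * sin (y t i - y t j))).
Proof.
move=> t0.
have cd i j : continuous (fun s => y s i - y s j).
  by move=> s; apply: cvgB; exact: (Hy _).1.
have dd i j : rder (fun s => y s i - y s j) t (f t i - f t j).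
  by apply: rderB; exact: (Hy _).2.
have : rder (fun s => spread (y s)) t
  (\sum_i \sum_j ((f t i - f t j) * (y t i - y t j) + (y t i - y t j) * (f t i - f t j))).
  by apply: rder_sum => i _; apply: rder_sum => j _; exact: (rderM (cd i j t) (dd i j) (dd i j)).
congr (rder _ _ _).
have N1 : N%:R != 0 :> R by rewrite pnatr_eq0 -lt0n.
pose S := \sum_j y t j.
have E1 : \sum_i \sum_j ((f t i - f t j) * (y t i - y t j) + (y t i - y t j) * (f t i - f t j)) =
   4 * N%:R * \sum_i f t i * y t i.
  transitivity (\sum_i (2 * (f t i * y t i) *+ N - 2 * (f t i * S) + 2 * (\sum_j f t j * y t j) - 2 * y t i * \sum_j f t j)).
    apply: eq_bigr => i _.
    have cN (c : R) : c *+ N = \sum_(j < N) c by rewrite sumr_const card_ord.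
    rewrite /S !mulr_sumr cN -sumrB -big_split -sumrB /=; apply: eq_bigr => j _.
    by ring.
  under eq_bigr do rewrite field_sum0 mulr0 subr0.
  rewrite big_split /= sumrB sumr_const card_ord -!mulr_sumr -mulr_suml field_sum0 mul0r mulr0 subr0.
  by rewrite sumrMnl -(mulr_natr (\sum_(i < N) _)) -(mulr_natr (2 * _)) -mulr_sumr; ring.
rewrite E1 /f /coupled_field.
have E2 : \sum_i (K / N%:R * \sum_j a t i j * sin (y t j - y t i)) * y t i =
    K / N%:R * \sum_i \sum_j a t i j * sin (y t j - y t i) * y t i.
  by rewrite mulr_sumr; apply: eq_bigr => i _; rewrite -mulrA mulr_suml.
have E3 : \sum_i \sum_j a t i j * ((y t i - y t j) * sin (y t i - y t j)) =
    - 2 * \sum_i \sum_j a t i j * sin (y t j - y t i) * y t i.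
  apply/eqP; rewrite -subr_eq0 mulr_sumr -sumrB.
  under eq_bigr do rewrite mulr_sumr -sumrB.
  apply/eqP; apply: double_sum_antisym => i j.
  by rewrite (a_sym t j i) -(opprB (y t j)) sinN; ring.
by rewrite E2 E3; field.
Qed.

Lemma spread_continuous : continuous (fun s => spread (y s)).
Proof.
move=> s; apply: cvg_sumr => i _; apply: cvg_sumr => j _.
by apply: cvgM; apply: cvgB; exact: (Hy _).1.
Qed.

(** A spread below 1 keeps every difference [d] in [[-1, 1]], where [d ^+ 2 <= 2 * (d * sin d)]. *)
Lemma spread_dissipation t : 0 <= t -> spread (y t) < 1 ->
  - (2 * K) * \sum_i \sum_j a t i j * ((y t i - y t j) * sin (y t i - y t j)) <=
  - (K * beta t) * spread (y t).
Proof.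
move=> t0 st; rewrite mulNr mulNr lerN2 -2!mulrA [2 * _]mulrCA ler_pM2l//.
rewrite /spread !mulr_sumr; apply: ler_sum => i _; rewrite !mulr_sumr; apply: ler_sum => j _.
set d := y t i - y t j.
have d1 : `|d| <= 1.
  rewrite -(ler_pXn2r (n := 2))// ?nnegrE// real_normK ?num_real// expr1n.
  by apply: le_trans (ltW st); exact: spread_coord.
have ds : d ^+ 2 <= 2 * (d * sin d).
  move: d1 => /ler_normlP[d1 d2]; have [d0|/ltW d0] := leP 0 d.
    have := @sin_expansive R 0 d ltac:(lra) d0 d2; rewrite sin0 => h; nra.
  have := @sin_expansive R d 0 ltac:(lra) d0 ltac:(lra); rewrite sin0 => h; nra.
by rewrite [leRHS]mulrCA; apply: ler_pM; [exact: beta0|exact: sqr_ge0|exact: beta_le|exact: ds].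
Qed.

(** Bootstrap: below 1 the spread cannot increase, so it never leaves the region where the
    dissipation estimate holds. *)
Lemma spread_stays t : T <= t -> spread (y t) <= spread (y T).
Proof.
have nonincr u v : T <= u -> u <= v -> (forall s, u <= s < v -> spread (y s) < 1) ->
    spread (y v) <= spread (y u).
  move=> Tu uv H; apply: (@nonincr_rder R (fun s => spread (y s))) => //.
    exact: spread_continuous.
  move=> s usv; have s0 : 0 <= s by have := T0; lra.
  eexists; first exact: spread_rder.
  apply: le_trans (spread_dissipation s0 (H s usv)) _.
  rewrite mulNr oppr_le0 !mulr_ge0 ?(ltW K0) ?beta0//.
  by apply: sumr_ge0 => i _; apply: sumr_ge0 => j _; exact: sqr_ge0.
move: t; apply: real_induction => // [t Tt H|t Tt H].
- have st : spread (y t) < 1 by apply: le_lt_trans yT; apply: H; lra.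
  have p0 : 0 < 1 - spread (y t) by rewrite subr_gt0.
  have /cvgrPdist_lt/(_ _ p0)[d /= d0 Hd] := @spread_continuous t.
  exists d; split=> // s /andP[ts sd].
  apply: le_trans (H t ltac:(lra)); apply: nonincr => // r trs.
  have := Hd r; rewrite /= distrC ger0_norm; last by lra.
  by move=> /(_ ltac:(lra)); rewrite distrC => /ltr_normlP[_]; lra.
- apply: nonincr => //; first exact: ltW.
  by move=> s /H h; exact: le_lt_trans h yT.
Qed.

Lemma spread_decay t : T <= t ->
  spread (y t) <= spread (y T) * expR (- K * (primitive beta t - primitive beta T)).
Proof.
move=> Tt.
pose h s := K * (primitive beta s - primitive beta T).
have ch : continuous h.
  move=> s; apply: cvgM; first exact: cvg_cst.
  by apply: cvgB; [exact: primitive_continuous beta_bm _|exact: cvg_cst].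
have ce : continuous (expR \o h).
  by move=> s; apply: continuous_comp; [exact: ch|exact: continuous_expR].
have : spread (y t) * expR (h t) <= spread (y T) * expR (h T).
  apply: (@nonincr_rder R (fun s => spread (y s) * (expR \o h) s)) => //.
    by move=> s; apply: cvgM; [exact: spread_continuous|exact: ce].
  move=> s /andP[Ts st]; have s0 : 0 <= s by exact: le_trans T0 Ts.
  have dh : rder h s (K * (beta s - 0)).
    apply: rderZ; apply: rderB; last exact: rder_cst.
    exact: (primitive_rder beta_bm s0 (beta_cvg s0)).
  have de : rder (expR \o h) s (expR (h s) * (K * (beta s - 0))).
    by apply: rder_comp => //; exact: ch.
  eexists; first by apply: rderM; [exact: ce|exact: spread_rder|exact: de].
  have ys : spread (y s) < 1 by apply: le_lt_trans yT; exact: spread_stays.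
  have := spread_dissipation s0 ys; set l := - (2 * K) * _ => hl.
  have e0 := expR_gt0 (h s); rewrite /= subr0.
  have -> : l * expR (h s) + spread (y s) * (expR (h s) * (K * beta s)) =
    (l - - (K * beta s) * spread (y s)) * expR (h s) by ring.
  by rewrite mulr_le0_ge0//; lra.
rewrite {2}/h subrr mulr0 expR0 mulr1 mulNr -/(h t) expRN.
by rewrite ler_pdivlMr ?expR_gt0.
Qed.

(** This average of the lift is conserved, since the field sums to zero, and hence is the only
    possible common limit. *)
Definition mean_phase t : R := N%:R^-1 * \sum_i y t i.

Lemma mean_phase_cst t : T <= t -> mean_phase t = mean_phase T.
Proof.
move=> Tt.
have := @rder_lipschitz R (fun s => \sum_i y s i) T t 0 Tt.
rewrite mul0r => H; congr (_ * _); apply/eqP; rewrite -subr_eq0 -normr_le0; apply: H.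
  by move=> s; apply: cvg_sumr => i _; exact: (Hy i).1.
move=> s /andP[Ts _]; exists (\sum_i f s i).
  by apply: rder_sum => i _; apply: (Hy i).2; exact: le_trans T0 Ts.
by rewrite field_sum0 normr0.
Qed.

Lemma phase_to_mean t i : (y t i - mean_phase t) ^+ 2 <= spread (y t).
Proof.
rewrite -[leLHS]real_normK ?num_real// -[leRHS]sqr_sqrtr; last first.
  by apply: sumr_ge0 => k _; apply: sumr_ge0 => j _; exact: sqr_ge0.
rewrite lerXn2r ?nnegrE// ?sqrtr_ge0//.
have -> : y t i - mean_phase t = #|'I_N|%:R^-1 * \sum_j (y t i - y t j).
  rewrite sumrB sumr_const !card_ord mulrBr -[y t i *+ N]mulr_natl mulrA mulVf ?mul1r//.
  by rewrite pnatr_eq0 -lt0n.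
apply: mean_norm_le; first exact: sqrtr_ge0.
by move=> j; rewrite -sqrtr_sqr ler_wsqrtr// spread_coord.
Qed.

Theorem sync_phase : (forall q : R, exists2 t, 0 <= t & q <= primitive beta t) ->
  forall i, y t i @[t --> +oo] --> mean_phase T.
Proof.
move=> Hdiv i; apply/cvgrPdist_lt => e e0.
(* With this [q], the inequality [1 + x <= expR x] puts the decayed spread below [e ^+ 2]. *)
pose q : R := primitive beta T + (1 + spread (y T) / e ^+ 2) / K.
have s0 : 0 <= spread (y T).
  by apply: sumr_ge0 => k _; apply: sumr_ge0 => j _; exact: sqr_ge0.
have [t0 t00 qt0] := Hdiv q.
have mono s t : 0 <= s -> s <= t -> primitive beta s <= primitive beta t.
  move=> s0' st; have := @nonincr_rder R (fun r => - primitive beta r) s t st.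
  rewrite lerN2; apply; first by move=> r; apply: cvgN; exact: primitive_continuous beta_bm _.
  move=> r /andP[sr _]; have r0 : 0 <= r by lra.
  exists (- beta r); last by rewrite oppr_le0; exact: beta0.
  by apply: rderN; exact: (primitive_rder beta_bm r0 (beta_cvg r0)).
near=> t.
have Tt : T <= t by near: t; apply: nbhs_pinfty_ge; exact: num_real.
have t0t : t0 <= t by near: t; apply: nbhs_pinfty_ge; exact: num_real.
rewrite -(mean_phase_cst Tt) distrC.
rewrite -(ltr_pXn2r (n := 2))// ?nnegrE ?(ltW e0)// real_normK ?num_real//.
apply: le_lt_trans (phase_to_mean t i) _; apply: le_lt_trans (spread_decay Tt) _.
rewrite mulNr expRN ltr_pdivrMr ?expR_gt0// mulrC -ltr_pdivrMr ?exprn_gt0//.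
apply: (@lt_le_trans _ _ (1 + K * (primitive beta t - primitive beta T))); last exact: expR_ge1Dx.
apply: (@lt_le_trans _ _ (1 + K * (q - primitive beta T))); last first.
  rewrite lerD2l ler_pM2l// lerB// ; apply: le_trans qt0 _; exact: mono.
have -> : K * (q - primitive beta T) = 1 + spread (y T) / e ^+ 2.
  by rewrite /q; field; rewrite !gt_eqF.
by lra.
Unshelve. all: by end_near. Qed.

End SyncPhase.

(** * Mixing of the walks *)

Section WalkMixing.
Variables (R : realType) (V : finType) (w : V -> V -> R).
Hypothesis hw : weighted_graph w.
Local Notation Q := (step_prob w).

Definition degree u := \sum_v w u v.
Definition stationary u := degree u / \sum_z degree z.

Lemma degree_gt0 u : 0 < degree u.
Proof.
rewrite /degree (bigD1 u)//= ltr_wpDr//; last exact: weight_loop hw u.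
by apply: sumr_ge0 => v _; exact: weight_ge0 hw _ _.
Qed.

Lemma total_degree_gt0 (v : V) : 0 < \sum_z degree z.
Proof.
rewrite (bigD1 v)//= ltr_wpDr//; last exact: degree_gt0.
by apply: sumr_ge0 => u _; exact: ltW (degree_gt0 u).
Qed.

Lemma stationary_gt0 u : 0 < stationary u.
Proof. by rewrite divr_gt0 ?degree_gt0// (total_degree_gt0 u). Qed.

Lemma stationary_sum (v : V) : \sum_u stationary u = 1.
Proof. by rewrite -mulr_suml divff// gt_eqF// (total_degree_gt0 v). Qed.

Lemma stationary_le1 u : stationary u <= 1.
Proof.
rewrite -(stationary_sum u) (bigD1 u)//= lerDl sumr_ge0// => v _.
exact: ltW (stationary_gt0 v).
Qed.

Lemma step_prob_ge0 u v : 0 <= Q u v.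
Proof. by rewrite divr_ge0 ?(weight_ge0 hw)// ltW// degree_gt0. Qed.

Lemma step_prob_gt0 u v : 0 < w u v -> 0 < Q u v.
Proof. by move=> uv; rewrite divr_gt0// degree_gt0. Qed.

Lemma step_prob_sum u : \sum_v Q u v = 1.
Proof. by rewrite -mulr_suml divff// gt_eqF// degree_gt0. Qed.

Lemma stationary_step v : \sum_u stationary u * Q u v = stationary v.
Proof.
rewrite /stationary /step_prob {3}/degree [in RHS]mulr_suml; apply: eq_bigr => u _.
rewrite -/(degree u) (weight_sym hw v u) mulrC mulrA divfK// gt_eqF//.
exact: degree_gt0.
Qed.

Definition step_op (f : V -> R) u := \sum_v Q u v * f v.
(** The [k]-step transition kernel, read off from the averaging operator on indicators, so that
    kernel facts become facts on iterates. *)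
Definition step_iter k u v := iter k step_op (fun z => (z == v)%:R) u.

Lemma iter_step_op k f u : iter k step_op f u = \sum_v step_iter k u v * f v.
Proof.
elim: k u => [|k IH] u.
  rewrite /step_iter /= (bigD1 u)//= eqxx mul1r big1 ?addr0// => v vu.
  by rewrite eq_sym (negbTE vu) mul0r.
rewrite iterS {1}/step_op; under eq_bigr do rewrite IH mulr_sumr.
rewrite exchange_big /=; apply: eq_bigr => v _.
rewrite -[RHS]/(step_op ((step_iter k)^~ v) u * f v) /step_op mulr_suml; apply: eq_bigr => z _.
by rewrite mulrA.
Qed.

Lemma step_iterSr k u v : step_iter k.+1 u v = \sum_z step_iter k u z * Q z v.
Proof.
rewrite /step_iter iterSr iter_step_op; apply: eq_bigr => z _; congr (_ * _).
rewrite /step_op (bigD1 v)//= eqxx mulr1 big1 ?addr0// => y yv.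
by rewrite (negbTE yv) mulr0.
Qed.

Lemma step_iter_ge0 k u v : 0 <= step_iter k u v.
Proof.
elim: k u => [|k IH] u; first exact: ler0n.
by apply: sumr_ge0 => z _; rewrite mulr_ge0 ?step_prob_ge0//; exact: IH.
Qed.

Lemma step_iter_sum k u : \sum_v step_iter k u v = 1.
Proof.
have := @iter_step_op k (fun=> 1) u.
under eq_bigr do rewrite mulr1.
move=> <-; elim: k u => // k IH u; rewrite iterS /step_op.
under eq_bigr do rewrite IH mulr1.
exact: step_prob_sum.
Qed.

Lemma step_iter_le1 k u v : step_iter k u v <= 1.
Proof.
rewrite -(step_iter_sum k u) (bigD1 v)//= lerDl sumr_ge0// => z _.
exact: step_iter_ge0.
Qed.

Lemma step_iter_extend k u x v :
  0 < w u x -> 0 < step_iter k x v -> 0 < step_iter k.+1 u v.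
Proof.
move=> ux h; rewrite /step_iter iterS /step_op (bigD1 x)//= ltr_wpDr//.
  by apply: sumr_ge0 => z _; rewrite mulr_ge0 ?step_prob_ge0//; exact: step_iter_ge0.
by rewrite mulr_gt0//; exact: step_prob_gt0.
Qed.

(** Self-loops allow a path to be lengthened at its start, so the largest of the connecting lengths
    serves all pairs. *)
Lemma step_iter_primitive : exists m, forall u v, 0 < step_iter m u v.
Proof.
have pos u v : exists k, 0 < step_iter k u v.
  have /connectP[p] := weight_connected hw u v.
  elim: p u => [|x p IH] u /=; first by move=> _ ->; exists 0%N; rewrite /step_iter /= eqxx.
  move=> /andP[ux xp] vE; have [k Hk] := IH x xp vE; exists k.+1.
  exact: step_iter_extend ux Hk.
have /choice[k Hk] : forall uv : V * V, exists k, 0 < step_iter k uv.1 uv.2.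
  by move=> [u v]; exact: pos.
exists (\max_uv k uv) => u v.
have : (k (u, v) <= \max_uv k uv)%N by exact: leq_bigmax.
move/subnK <-; elim: (_ - _)%N => [|j IH]; first exact: (Hk (u, v)).
by rewrite addSn; exact: step_iter_extend (weight_loop hw u) IH.
Qed.

Lemma step_op_stationary f : \sum_u stationary u * step_op f u = \sum_u stationary u * f u.
Proof.
rewrite /step_op; under eq_bigr do rewrite mulr_sumr.
rewrite exchange_big /=; apply: eq_bigr => v _.
by under eq_bigr do rewrite mulrA; rewrite -mulr_suml stationary_step.
Qed.

Lemma iter_step_op_bound k f C : 0 <= C -> (forall u, `|f u| <= C) ->
  forall u, `|iter k step_op f u| <= C.
Proof.
move=> C0 fC u; rewrite iter_step_op.
apply: le_trans (ler_norm_sum _ _ _) _.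
rewrite -[leRHS]mul1r -(step_iter_sum k u) mulr_suml; apply: ler_sum => v _.
by rewrite normrM ger0_norm ?step_iter_ge0// ler_wpM2l ?step_iter_ge0.
Qed.

(* Doeblin's argument: step_iter m dominates rho times the stationary law. *)
Lemma step_iter_cvg (delta : R) : 0 < delta ->
  exists n, forall k u v, (n <= k)%N -> `|step_iter k u v - stationary v| <= delta.
Proof.
move=> d0; have [m Hm] := step_iter_primitive.
pose rho := \big[Num.min/1]_u \big[Num.min/1]_v step_iter m u v.
have rho0 : 0 < rho.
  rewrite /rho; elim/big_ind: _ => // [a b a0 b0|u _]; first by rewrite lt_min a0.
  by elim/big_ind: _ => // a b a0 b0; rewrite lt_min a0.
have rhole u v : rho <= step_iter m u v.
  by rewrite /rho (bigD1 u)//= (bigD1 v)//= !ge_min lexx.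
have rho1 : rho <= 1.
  rewrite /rho; elim/big_ind: _ => // [a b a1 b1|u _]; first by rewrite ge_min a1.
  by elim/big_ind: _ => // [a b a1 b1|v _]; [rewrite ge_min a1|exact: step_iter_le1].
(* On functions of stationary mean zero, [rho * stationary v] can be subtracted from the kernel at
   no cost; what remains is nonnegative of total mass [1 - rho]. *)
have contract f C : 0 <= C -> (forall u, `|f u| <= C) -> \sum_u stationary u * f u = 0 ->
    forall u, `|iter m step_op f u| <= (1 - rho) * C.
  move=> C0 fC f0 u.
  have -> : iter m step_op f u = \sum_v (step_iter m u v - rho * stationary v) * f v.
    under [RHS]eq_bigr do rewrite mulrBl -mulrA.
    by rewrite sumrB -mulr_sumr f0 mulr0 subr0 iter_step_op.
  apply: le_trans (ler_norm_sum _ _ _) _.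
  have -> : 1 - rho = \sum_v (step_iter m u v - rho * stationary v).
    by rewrite sumrB step_iter_sum -mulr_sumr (stationary_sum u) mulr1.
  rewrite mulr_suml; apply: ler_sum => v _.
  have c0 : 0 <= step_iter m u v - rho * stationary v.
    rewrite subr_ge0; apply: le_trans (rhole u v).
    by rewrite ler_piMr ?stationary_le1// ltW.
  by rewrite normrM ger0_norm// ler_wpM2l.
have iters j f : (forall u, `|f u| <= 1) -> \sum_u stationary u * f u = 0 ->
    forall u, `|iter (j * m) step_op f u| <= (1 - rho) ^+ j.
  move=> f1 f0; elim: j => [|j IH] u; first by rewrite mul0n expr0 /=.
  rewrite mulSn iterD exprS; apply: contract => //.
    by rewrite exprn_ge0// subr_ge0.
  elim: (j * m)%N {IH} => [|k IHk]; first exact: f0.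
  by rewrite iterS step_op_stationary.
have [j Hj] : exists j, (1 - rho) ^+ j <= delta.
  have : `|1 - rho| < 1 by rewrite ger0_norm ?subr_ge0//; lra.
  move=> /cvg_expr /cvgrPdist_le/(_ delta d0)[j _ Hj]; exists j.
  by have := Hj j (leqnn _); rewrite /= sub0r normrN ger0_norm// exprn_ge0// subr_ge0.
exists (j * m)%N => k u v jk; apply: le_trans Hj.
pose f z : R := (z == v)%:R - stationary v.
have f1 z : `|f z| <= 1.
  have := stationary_gt0 v; have := stationary_le1 v; rewrite /f.
  by case: (z == v) => /= ? ?; apply/ler_normlP; split; lra.
have f0 : \sum_z stationary z * f z = 0.
  rewrite /f; under eq_bigr do rewrite mulrBr.
  rewrite sumrB -mulr_suml (stationary_sum v) mul1r (bigD1 v)//= eqxx mulr1 big1 ?addr0 ?subrr//.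
  by move=> z zv; rewrite (negbTE zv) mulr0.
have -> : step_iter k u v - stationary v = iter k step_op f u.
  rewrite iter_step_op /f; under [RHS]eq_bigr do rewrite mulrBr.
  rewrite sumrB -mulr_suml step_iter_sum mul1r; congr (_ - _).
  rewrite (bigD1 v)//= eqxx mulr1 big1 ?addr0// => z zv.
  by rewrite (negbTE zv) mulr0.
rewrite -(subnK jk) iterD; apply: iter_step_op_bound; last by move=> z; exact: iters.
by rewrite exprn_ge0// subr_ge0.
Qed.

Lemma norm_prodB (I : Type) (r : seq I) (a b : I -> R) :
  (forall i, 0 <= a i <= 1) -> (forall i, 0 <= b i <= 1) ->
  `|\prod_(i <- r) a i - \prod_(i <- r) b i| <= \sum_(i <- r) `|a i - b i|.
Proof.
move=> Ha Hb; elim: r => [|i r IH]; first by rewrite !big_nil subrr normr0.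
rewrite !big_cons; set A := \prod_(j <- r) a j; set B := \prod_(j <- r) b j.
have -> : a i * A - b i * B = (a i - b i) * B + a i * (A - B) by ring.
have B01 : 0 <= B <= 1.
  apply/andP; split; first by apply: prodr_ge0 => j _; have /andP[] := Hb j.
  by apply: prodr_ile1 => j _; exact: Hb.
apply: le_trans (ler_normD _ _) _; rewrite !normrM; apply: lerD.
  by rewrite ler_piMr// ger0_norm//; case/andP: B01.
apply: le_trans _ IH; rewrite ler_piMl//.
by have /andP[a0 a1] := Ha i; rewrite ger0_norm.
Qed.

Variable N : nat.
Local Notation config := {ffun 'I_N -> V}.

Definition stationary_config (x : config) := \prod_i stationary (x i).

Definition centered (G : config -> R) := \sum_x stationary_config x * G x = 0.

Lemma stationary_config_sum (v : V) : \sum_x stationary_config x = 1.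
Proof.
rewrite /stationary_config -(bigA_distr_bigA (fun _ : 'I_N => stationary)) /=.
by rewrite big1// => i _; exact: stationary_sum v.
Qed.

(** Every walk has its own number of steps, because each follows its own clock. *)
Definition mixed_after (G : config -> R) (n : nat) (delta : R) :=
  forall (k : 'I_N -> nat) (x : config), (forall i, (n <= k i)%N) ->
    `|\sum_y G y * \prod_i step_iter (k i) (x i) (y i)| <= delta.

(** Centring allows the stationary product to be subtracted, and the difference of the two products
    is at most the sum of the one-walk errors. *)
Lemma config_mixing (G : config -> R) (B delta : R) : 0 < delta -> centered G ->
  0 <= B -> (forall x, `|G x| <= B) ->
  exists n, mixed_after G n delta.
Proof.
move=> d0 Gc B0 GB.
pose D := #|{: config}|%:R * B * N%:R + 1.
have D0 : 0 < D by rewrite ltr_wpDl// !mulr_ge0.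
have [n Hn] := step_iter_cvg (divr_gt0 d0 D0).
exists n => k x nk.
have -> : \sum_y G y * \prod_i step_iter (k i) (x i) (y i) =
    \sum_y G y * (\prod_i step_iter (k i) (x i) (y i) - stationary_config y).
  under [RHS]eq_bigr do rewrite mulrBr.
  by rewrite sumrB; under [X in _ - X]eq_bigr do rewrite mulrC; rewrite Gc subr0.
apply: le_trans (ler_norm_sum _ _ _) _.
have b y : `|G y * (\prod_i step_iter (k i) (x i) (y i) - stationary_config y)| <=
    B * (N%:R * (delta / D)).
  rewrite normrM; apply: ler_pM => //.
  apply: le_trans (norm_prodB _ _ _) _.
  - by move=> i; rewrite step_iter_ge0 step_iter_le1.
  - by move=> i; rewrite (ltW (stationary_gt0 _)) stationary_le1.
  apply: le_trans (ler_sum _ (fun i _ => Hn (k i) (x i) (y i) (nk i))) _.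
  by rewrite sumr_const card_ord mulr_natl.
apply: le_trans (ler_sum _ (fun y _ => b y)) _.
rewrite sumr_const -[leLHS]mulr_natl.
have -> : #|config|%:R * (B * (N%:R * (delta / D))) = (D - 1) / D * delta.
  by rewrite /D; ring.
by rewrite ler_piMl ?(ltW d0)// ler_pdivrMr// mul1r; lra.
Qed.

End WalkMixing.

(** * Lower tails of Poisson laws *)

Section PoissonTail.
Variable R : realType.

(** The exponential is bounded below by the power [n.+1], one more than [x ^+ k] can use up, which
    leaves the decay [1 / x]. *)
Lemma power_expR_bound (n k : nat) (x : R) : 1 <= x -> (k <= n)%N ->
  x ^+ k * expR (- x) <= n.+1%:R ^+ n.+1 / x.
Proof.
move=> x1 kn; have x0 : 0 < x by lra.
have n0 : 0 < n.+1%:R :> R by [].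
have e1 : (x / n.+1%:R) ^+ n.+1 <= expR x.
  have -> : expR x = expR (x / n.+1%:R) ^+ n.+1.
    by rewrite -expRM_natl -mulr_natl; congr expR; field; rewrite gt_eqF.
  rewrite lerXn2r ?nnegrE ?expR_ge0//; first by rewrite divr_ge0// ltW.
  by apply: le_trans (expR_ge1Dx _); rewrite lerDr.
rewrite expRN ler_pdivrMr ?expR_gt0//.
apply: (@le_trans _ _ (n.+1%:R ^+ n.+1 / x * (x / n.+1%:R) ^+ n.+1)); last first.
  by rewrite ler_wpM2l// divr_ge0 ?exprn_ge0// ltW.
have -> : n.+1%:R ^+ n.+1 / x * (x / n.+1%:R) ^+ n.+1 = x ^+ n.
  rewrite expr_div_n [x ^+ n.+1]exprS; field.
  by rewrite !gt_eqF// exprn_gt0.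
by rewrite ler_weXn2l.
Qed.

Lemma poisson_lower_tail (n : nat) (delta : R) : 0 < delta ->
  exists L, 0 < L /\ forall l, L <= l ->
    (poisson_prob l 0 [set k | (k < n)%N] <= delta%:E)%E.
Proof.
move=> d0; pose D : R := n%:R * n.+1%:R ^+ n.+1.
have D0 : 0 <= D by rewrite mulr_ge0// exprn_ge0.
exists (1 + D / delta); split; first by rewrite ltr_pwDl// divr_ge0// ltW.
move=> l Ll.
have l1 : 1 <= l by apply: le_trans Ll; rewrite lerDl divr_ge0// ltW.
have l0 : 0 < l by lra.
rewrite /poisson_prob l0.
rewrite esum_fset; [|exact: finite_II|by move=> k _; rewrite lee_fin poisson_pmf_ge0].
rewrite -fsbig_ord sumEFin lee_fin.
have b (k : 'I_n) : poisson_pmf l k <= n.+1%:R ^+ n.+1 / l.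
  rewrite /poisson_pmf l0; apply: le_trans (power_expR_bound l1 (ltnW (ltn_ord k))).
  by rewrite ler_wpM2r ?expR_ge0// ler_piMr ?exprn_ge0 ?(ltW l0)// invf_le1 ?ltr0n ?fact_gt0// ler1n fact_gt0.
apply: le_trans (ler_sum _ (fun k _ => b k)) _.
rewrite sumr_const card_ord -[leLHS]mulr_natl mulrA ler_pdivrMr// -/D.
rewrite -ler_pdivrMl// mulrC; apply: le_trans Ll.
by rewrite lerDr.
Qed.

End PoissonTail.

(** * Probabilities of finitely valued observables *)

Section FiniteProbability.
Context (R : realType) (d : measure_display) (T : measurableType d).
Variable P : probability T R.
Implicit Types A B : set T.

Definition pr A : R := fine (P A).

Lemma prE A : measurable A -> P A = (pr A)%:E.
Proof. by move=> mA; rewrite /pr fineK// fin_num_measure. Qed.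

Lemma pr_ge0 A : 0 <= pr A.
Proof. by rewrite /pr fine_ge0. Qed.

Lemma pr_setT : pr setT = 1.
Proof. by rewrite /pr probability_setT. Qed.

Lemma pr_set0 : pr set0 = 0.
Proof. by rewrite /pr measure0. Qed.

Lemma pr_setU A B : measurable A -> measurable B -> A `&` B = set0 ->
  pr (A `|` B) = pr A + pr B.
Proof.
move=> mA mB AB; rewrite /pr measureU// fineD//; exact: fin_num_measure.
Qed.

Lemma pr_split A B : measurable A -> measurable B ->
  pr A = pr (A `&` B) + pr (A `&` ~` B).
Proof.
move=> mA mB; rewrite -pr_setU.
- by rewrite -setIUr setUv setIT.
- exact: measurableI.
- by apply: measurableI => //; exact: measurableC.
- by rewrite setIACA setICr setI0.
Qed.

Lemma pr_le A B : measurable A -> measurable B -> A `<=` B -> pr A <= pr B.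
Proof.
move=> mA mB AB; rewrite (pr_split mB mA) (setIidr AB) lerDl.
exact: pr_ge0.
Qed.

Lemma pr_le1 A : measurable A -> pr A <= 1.
Proof. by move=> mA; rewrite -pr_setT; apply: pr_le. Qed.

Lemma pr_setU_le A B : measurable A -> measurable B -> pr (A `|` B) <= pr A + pr B.
Proof.
move=> mA mB; rewrite (pr_split (measurableU _ _ mA mB) mA) setUK.
rewrite lerD2l; apply: pr_le => //.
  by apply: measurableI; [exact: measurableU|exact: measurableC].
by move=> o [[//|]].
Qed.

Lemma pr_bigcup_le (F : finType) (A : F -> set T) : (forall i, measurable (A i)) ->
  measurable [set o | exists i, A i o] /\ pr [set o | exists i, A i o] <= \sum_i pr (A i).
Proof.
move=> mA.
have H (s : seq F) : let U := [set o | exists2 i, i \in s & A i o] in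
    measurable U /\ pr U <= \sum_(i <- s) pr (A i).
  elim: s => [|i s [mU IH]] /=.
    rewrite (_ : mkset _ = set0); last by apply/seteqP; split => // o [].
    by rewrite big_nil pr_set0; split.
  rewrite (_ : mkset _ = A i `|` [set o | exists2 i, i \in s & A i o]); last first.
    apply/seteqP; split => o /=.
      by move=> [j]; rewrite inE => /orP[/eqP->|js] Ajo; [left|right; exists j].
    by move=> [Aio|[j js Ajo]]; [exists i; rewrite ?mem_head|exists j; rewrite // inE js orbT].
  split; first exact: measurableU.
  rewrite big_cons; apply: le_trans (pr_setU_le (mA i) mU) _.
  by rewrite lerD2l.
have := H (index_enum F); rewrite (_ : mkset _ = [set o | exists i, A i o]) //.
apply/seteqP; split => o /=; first by move=> [i _]; exists i.
by move=> [i Aio]; exists i; rewrite ?mem_index_enum.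
Qed.

(** With values in a finite type all expectations are finite sums, so total probability, second
    moments and the Chebyshev bound need no integration over [T]. *)
Definition finite_rv (F : finType) (Z : T -> F) :=
  forall z, measurable [set o | Z o = z].

Lemma finite_rv_event (F : finType) (Z : T -> F) (B : pred F) : finite_rv Z ->
  measurable [set o | B (Z o)].
Proof.
move=> mZ.
have mA i : measurable (if B i then [set o | Z o = i] else set0).
  by case: ifP => // _.
have [+ _] := pr_bigcup_le mA; congr measurable; apply/seteqP; split => o /=.
  by move=> [i]; case: ifP => // Bi /= Zo; rewrite Zo.
by move=> Bo; exists (Z o); rewrite Bo.
Qed.

Lemma pr_partition (F : finType) (Z : T -> F) A : finite_rv Z -> measurable A ->
  pr A = \sum_z pr (A `&` [set o | Z o = z]).
Proof.
move=> mZ mA.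
have H (s : seq F) : uniq s ->
    pr (A `&` [set o | Z o \in s]) = \sum_(z <- s) pr (A `&` [set o | Z o = z]).
  elim: s => [_|z s IH /= /andP[zs us]].
    by rewrite big_nil (_ : _ `&` _ = set0) ?pr_set0//; apply/seteqP; split => // o [].
  rewrite big_cons -(IH us) -pr_setU.
  - congr pr; apply/seteqP; split => o /=.
      by move=> [Ao]; rewrite inE => /orP[/eqP|]; [left|right].
    by move=> [] [Ao Zo]; split=> //; rewrite inE ?Zo ?eqxx ?orbT.
  - by apply: measurableI => //; exact: mZ.
  - by apply: measurableI => //; exact: (finite_rv_event (fun z => z \in s)).
  - apply/seteqP; split => // o /= [[_ Zo] [_]]; rewrite Zo.
    by rewrite (negbTE zs).
rewrite -big_enum -H ?enum_uniq//; congr pr.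
apply/seteqP; split => o /=; last by case.
by move=> Ao; split=> //; rewrite mem_enum.
Qed.

Lemma pr_event (F : finType) (Z : T -> F) (B : pred F) : finite_rv Z ->
  pr [set o | B (Z o)] = \sum_(z | B z) pr [set o | Z o = z].
Proof.
move=> mZ; rewrite (pr_partition mZ (finite_rv_event B mZ)) [RHS]big_mkcond /=.
apply: eq_bigr => z _; case: ifP => Bz.
  congr pr; apply/seteqP; split => o /=; first by case.
  by move=> Zo; rewrite Zo.
rewrite (_ : _ `&` _ = set0) ?pr_set0//; apply/seteqP; split => // o /= [+ Zo].
by rewrite Zo Bz.
Qed.

Lemma pr_total (F : finType) (Z : T -> F) : finite_rv Z ->
  \sum_z pr [set o | Z o = z] = 1.
Proof.
move=> mZ; rewrite -pr_setT (pr_partition mZ measurableT).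
by apply: eq_bigr => z _; rewrite setTI.
Qed.

Lemma finite_rv_ffun (I F : finType) (Z : I -> T -> F) : (forall i, finite_rv (Z i)) ->
  finite_rv (fun o => [ffun i => Z i o]).
Proof.
move=> mZ f.
rewrite (_ : mkset _ = \bigcap_(i in setT) [set o | Z i o = f i]).
  by apply: fin_bigcap_measurable => // i _; exact: mZ.
apply/seteqP; split => o /=; first by move=> <- i _; rewrite /= ffunE.
by move=> H; apply/ffunP => i; rewrite ffunE; exact: H.
Qed.

Lemma finite_rv_pair (F G : finType) (Z : T -> F) (W : T -> G) :
  finite_rv Z -> finite_rv W -> finite_rv (fun o => (Z o, W o)).
Proof.
move=> mZ mW [z w].
rewrite (_ : mkset _ = [set o | Z o = z] `&` [set o | W o = w]).
  by apply: measurableI; [exact: mZ|exact: mW].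
by apply/seteqP; split => o /=; [case=> -> ->|case=> -> ->].
Qed.

Lemma measurable_nat_event (f : T -> nat) (B : set nat) : measurable_fun setT f ->
  measurable [set o | B (f o)].
Proof. by move=> mf; rewrite -[mkset _]setTI; apply: mf. Qed.

Lemma finite_rv_nat (F : finType) (f : T -> nat) (g : nat -> F) :
  measurable_fun setT f -> finite_rv (fun o => g (f o)).
Proof. by move=> mf z; exact: (measurable_nat_event (fun k => g k = z)). Qed.

Lemma nat_tail (f : T -> nat) (e : R) : measurable_fun setT f -> 0 < e ->
  exists k, pr [set o | (k <= f o)%N] <= e.
Proof.
move=> mf e0.
pose F k := [set o | (k <= f o)%N].
have mF k : measurable (F k) by exact: (measurable_nat_event (fun n => (k <= n)%N)).
have F0 : \bigcap_k F k = set0.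
  by apply/seteqP; split => // o /(_ (f o).+1 I); rewrite /F /= ltnn.
have := @nonincreasing_cvg_mu d T R P F.
rewrite F0 measure0 => H.
have /fine_cvgP[_ /cvgrPdist_le/(_ e e0)[k _ Hk]] : (P \o F) x @[x --> \oo] --> 0%:E.
  apply: H; [by apply: le_lt_trans (probability_le1 P (mF 0%N)) _; rewrite ltry|exact: mF|by []|].
  by move=> n m nm; apply/subsetPset => o; exact: leq_trans.
exists k; have := Hk k (leqnn _); rewrite /= sub0r normrN ger0_norm//.
exact: pr_ge0.
Qed.

Lemma process_events_preimage (I S : Type) (D : set I) (Z : I -> T -> S) t (B : set S) :
  D t -> process_events D Z [set o | B (Z t o)].
Proof. by move=> Dt; apply: sub_gen_smallest; exists t => //; exists B. Qed.

Lemma process_eventsI (I S : Type) (D : set I) (Z : I -> T -> S) A B :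
  process_events D Z A -> process_events D Z B -> process_events D Z (A `&` B).
Proof.
move=> HA HB.
exact: (@measurableI _ (g_sigma_algebraType (\bigcup_(t in D) range (preimage (Z t)))) A B HA HB).
Qed.

Lemma pr_indep (I : finType) (F G : I -> set_system T) (A B : I -> set T) :
  mutually_independent P (fun k : I + I => match k with inl i => F i | inr i => G i end) ->
  (forall i, F i (A i)) -> (forall i, G i (B i)) ->
  (forall i, measurable (A i)) -> (forall i, measurable (B i)) ->
  pr [set o | (forall i, A i o) /\ (forall i, B i o)] =
  (\prod_i pr (A i)) * (\prod_i pr (B i)).
Proof.
move=> ind FA GB mA mB.
pose E (k : I + I) := match k with inl i => A i | inr i => B i end.
have mE k : measurable (E k) by case: k => i; [exact: mA|exact: mB].
have := ind (index_enum _) E (index_enum_uniq _).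
have -> : \bigcap_(i in [set` index_enum (I + I)%type]) E i =
    [set o | (forall i, A i o) /\ (forall i, B i o)].
  apply/seteqP; split => o /=.
    move=> H; split => i; [have := H (inl i)|have := H (inr i)];
    by apply; rewrite /= mem_index_enum.
  by move=> [HA HB] [i|i] _ /=; [exact: HA|exact: HB].
move=> H; rewrite [LHS]/pr H; last by case=> i _; [exact: FA|exact: GB].
rewrite (eq_bigr (fun k => (pr (E k))%:E)); last by move=> k _; exact: prE.
rewrite prodEFin /= big_sumType //=.
Qed.

End FiniteProbability.

(** * Joint laws of the jump chain *)

Section JumpChain.
Context (R : realType) (d : measure_display) (T : measurableType d).
Variables (P : probability T R) (V : finType) (w : V -> V -> R) (x0 : V).
Variable Y : nat -> T -> V.
Hypothesis HY : jump_chain P w x0 Y.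

Lemma chain_finite_rv n : finite_rv (Y n).
Proof. by move=> v; exact: chain_measurable HY n v. Qed.

Let W n o := [ffun i : 'I_n.+1 => Y i o].

Let W_rv n : finite_rv (W n).
Proof. by apply: finite_rv_ffun => i; exact: chain_finite_rv. Qed.

(** Continuing the history by [v] lets one function describe the path event both at [n] and at
    [n.+1]. *)
Let W_path n (p : {ffun 'I_n.+1 -> V}) v :
  let q j := if (j <= n)%N then p (inord j) else v in
  [set o | W n o = p] = chain_path Y n q /\
  [set o | W n o = p] `&` [set o | Y n.+1 o = v] = chain_path Y n.+1 q.
Proof.
move=> q; have E : [set o | W n o = p] = chain_path Y n q.
  apply/seteqP; split => o /=.
    by move=> Wp k kn; rewrite /q kn -Wp ffunE inordK.
  move=> H; apply/ffunP => i; rewrite ffunE H; last by rewrite -ltnS ltn_ord.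
  by rewrite /q -ltnS ltn_ord inord_val.
split=> //; rewrite E; apply/seteqP; split => o /=.
  move=> [H Yv] k; rewrite leq_eqVlt => /orP[/eqP->|]; last by rewrite ltnS; exact: H.
  by rewrite /q ltnn.
move=> H; split=> [k kn|]; first by apply: H; exact: leqW.
by rewrite H// /q ltnn.
Qed.

(** [chain_step] only speaks of whole paths; summing over the histories compatible with the two
    values gives the Markov property in the presence of an earlier time. *)
Lemma chain_one_step k n x u v : (k <= n)%N ->
  pr P [set o | [/\ Y k o = x, Y n o = u & Y n.+1 o = v]] =
  pr P [set o | Y k o = x /\ Y n o = u] * step_prob w u v.
Proof.
move=> kn.
have mA : measurable [set o | Y k o = x /\ Y n o = u].
  by apply: measurableI; exact: chain_finite_rv.
rewrite (_ : mkset _ = [set o | Y k o = x /\ Y n o = u] `&` [set o | Y n.+1 o = v]); last first.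
  by apply/seteqP; split => o /=; [case=> -> -> ->|case=> [[-> ->] ->]].
have mB : measurable ([set o | Y k o = x /\ Y n o = u] `&` [set o | Y n.+1 o = v]).
  by apply: measurableI => //; exact: chain_finite_rv.
rewrite (pr_partition P (@W_rv n) mB) (pr_partition P (@W_rv n) mA) mulr_suml.
apply: eq_bigr => p _.
have [pxu|pxu] := boolP ((p (inord k) == x) && (p ord_max == u)); last first.
  have E A : ([set o | Y k o = x /\ Y n o = u] `&` A) `&` [set o | W n o = p] = set0.
    apply/seteqP; split => // o /= [[[Yk Yn] _] Wp]; move: pxu; rewrite -Wp !ffunE.
    by rewrite inordK ?ltnS// Yk Yn !eqxx.
  by rewrite E -[X in X `&` [set o | W n o = p]]setIT E pr_set0 mul0r.
have [E1 E2] := W_path p v.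
have A1 : [set o | W n o = p] `<=` [set o | Y k o = x /\ Y n o = u].
  move=> o /= Wp; case/andP: pxu => /eqP <- /eqP <-; rewrite -Wp !ffunE.
  by rewrite inordK ?ltnS.
rewrite (setIidr A1) setIAC (setIidr A1) E2 E1 /pr (chain_step HY).
rewrite fineM//; last first.
  by rewrite -E1 fin_num_measure//; exact: W_rv.
congr (_ * _); rewrite leqnn ltnn; congr (step_prob w _ _).
case/andP: pxu => _ /eqP <-; congr (p _); apply: val_inj.
by rewrite /= inordK.
Qed.

Lemma chain_two_times k m x v :
  pr P [set o | Y k o = x /\ Y (k + m)%N o = v] =
  pr P [set o | Y k o = x] * step_iter w m x v.
Proof.
elim: m v => [|m IH] v.
  rewrite addn0 /step_iter /=; have [->|xv] := eqVneq x v.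
    rewrite mulr1; congr pr; apply/seteqP; split => o /=; [by case|by []].
  rewrite mulr0 (_ : mkset _ = set0) ?pr_set0//; apply/seteqP; split => // o /= [-> ] /eqP.
  by rewrite (negbTE xv).
have mB : measurable [set o | Y k o = x /\ Y (k + m).+1 o = v].
  by apply: measurableI; exact: chain_finite_rv.
rewrite addnS (pr_partition P (@chain_finite_rv (k + m)) mB) step_iterSr mulr_sumr.
apply: eq_bigr => u _; rewrite mulrA -IH -chain_one_step ?leq_addr//; congr pr.
by apply/seteqP; split => o /=; [case=> [[-> ->] ->]|case=> -> -> ->].
Qed.

End JumpChain.

(** * Time correlations of the walks *)

Section Walks.
Context (R : realType) (d : measure_display) (T : measurableType d).
Variables (P : probability T R) (V : finType) (w : V -> V -> R) (N : nat).
Variables (rate : R) (x0 : 'I_N -> V) (X : R -> T -> 'I_N -> V).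
Variables (Y : 'I_N -> nat -> T -> V) (C : 'I_N -> R -> T -> nat).
Hypothesis hw : weighted_graph w.
Hypothesis HY : forall i, jump_chain P w (x0 i) (Y i).
Hypothesis HC : forall i, poisson_process P rate (C i).
Hypothesis Hind : mutually_independent P (fun k : 'I_N + 'I_N =>
  match k with
  | inl i => process_events setT (Y i)
  | inr i => process_events [set t : R | 0 <= t] (C i)
  end).
Hypothesis HX : forall t o i, 0 <= t -> X t o i = Y i (C i t o) o.
Local Notation config := {ffun 'I_N -> V}.

Definition walk_config t o : config := [ffun i => X t o i].

Lemma clock_measurable i t : 0 <= t -> measurable_fun setT (C i t).
Proof. exact: poisson_measurable (HC i) t. Qed.

Lemma chain_rv i n : finite_rv (Y i n).
Proof. exact: (@chain_finite_rv _ _ _ _ _ _ _ _ (HY i)). Qed.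

Lemma clock_mono i o s t : 0 <= s -> s <= t -> (C i s o <= C i t o)%N.
Proof. exact: poisson_mono (HC i) o s t. Qed.

Lemma clock_gap_measurable i u v n : 0 <= u -> 0 <= v ->
  measurable [set o | (C i v o - C i u o < n)%N].
Proof.
move=> u0 v0; rewrite (_ : mkset _ =
  \bigcup_k ([set o | C i u o = k] `&` [set o | (C i v o - k < n)%N])).
  apply: bigcup_measurable => k _; apply: measurableI.
    exact: (measurable_nat_event (fun m => m = k) (clock_measurable i u0)).
  exact: (measurable_nat_event (fun m => (m - k < n)%N) (clock_measurable i v0)).
apply/seteqP; split => o /=; first by move=> E; exists (C i u o).
by move=> [k _ [/= -> ]].
Qed.

Lemma walk_config_rv t : 0 <= t -> finite_rv (walk_config t).
Proof.
move=> t0; apply: finite_rv_ffun => i v.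
rewrite (_ : mkset _ = \bigcup_k ([set o | Y i k o = v] `&` [set o | C i t o = k])).
  apply: bigcup_measurable => k _; apply: measurableI.
    exact: (@chain_rv i).
  exact: (measurable_nat_event (fun n => n = k) (clock_measurable i t0)).
apply/seteqP; split => o /=; rewrite HX//.
  by move=> Yv; exists (C i t o).
by move=> [k _ /= [Yv Ck]]; rewrite Ck.
Qed.

Lemma union_bound (A : set T) (B : 'I_N -> set T) : measurable A ->
  (forall i, measurable (B i)) -> (forall o, A o -> exists i, B i o) ->
  pr P A <= \sum_i pr P (B i).
Proof.
move=> mA mB AB; have [mU Ule] := pr_bigcup_le P mB.
by apply: le_trans Ule; apply: pr_le.
Qed.

(* Given the clock readings at times u and v, cut off at M to stay finite, the
   chains are still unconditioned; a pair of readings is good when every chain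
   makes at least n steps between u and v. *)
Section TwoTimes.
Variables (u v : R) (G : config -> R) (B delta : R) (n : nat).
Hypotheses (u0 : 0 <= u) (uv : u <= v) (B0 : 0 <= B) (GB : forall x, `|G x| <= B)
  (delta0 : 0 <= delta).
Hypothesis mixing : mixed_after w G n delta.

Let v0 : 0 <= v. Proof. exact: le_trans uv. Qed.

Variable M : nat.

Let clock i o : 'I_M.+1 * 'I_M.+1 :=
  (inord (minn (C i u o) M), inord (minn (C i v o) M)).

Let clocks o : {ffun 'I_N -> 'I_M.+1 * 'I_M.+1} := [ffun i => clock i o].

Local Notation cell c := [set o | clocks o = c].

Let clock_rv i : finite_rv (clock i).
Proof.
apply: finite_rv_pair; apply: finite_rv_nat (fun k => inord (minn k M)) _ => //;
exact: clock_measurable.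
Qed.

Let clocks_rv : finite_rv clocks.
Proof. by apply: finite_rv_ffun => i; exact: clock_rv. Qed.

Let clock_events i c : process_events [set t : R | 0 <= t] (C i) [set o | clock i o = c].
Proof.
case: c => a b.
rewrite (_ : mkset _ = [set o | inord (minn (C i u o) M) = a] `&`
                       [set o | inord (minn (C i v o) M) = b]); last first.
  apply/seteqP; split => o /=; first by rewrite /clock => -[-> ->].
  by rewrite /clock => -[-> ->].
apply: process_eventsI.
  exact: (@process_events_preimage d T R nat [set t | 0 <= t] (C i) u
    [set k | inord (minn k M) = a] u0).
exact: (@process_events_preimage d T R nat [set t | 0 <= t] (C i) v
  [set k | inord (minn k M) = b] v0).
Qed.

Let pair_event x y := [set o | walk_config u o = x /\ walk_config v o = y].

Let pair_event_measurable x y : measurable (pair_event x y).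
Proof. by apply: measurableI; exact: walk_config_rv. Qed.

Let good (c : {ffun 'I_N -> 'I_M.+1 * 'I_M.+1}) :=
  [forall i, ((c i).2 < M)%N && (n + (c i).1 <= (c i).2)%N].

Let pr_clocks c : pr P (cell c) = \prod_i pr P [set o | clock i o = c i].
Proof.
have h1 i : process_events setT (Y i) setT.
  exact: (@process_events_preimage d T nat V setT (Y i) 0%N setT I).
have H := pr_indep Hind h1 (fun i => @clock_events i (c i)) (fun=> measurableT)
  (fun i => @clock_rv i (c i)).
rewrite [RHS](_ : _ = (\prod_(i < N) pr P setT) * \prod_i pr P [set o | clock i o = c i]).
  rewrite -H; congr pr; apply/seteqP; split => o /=.
    by move=> <-; split=> // i; rewrite ffunE.
  by move=> [_ Hc]; apply/ffunP => i; rewrite ffunE.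
by rewrite [X in _ = X * _]big1 ?mul1r// => i _; exact: pr_setT.
Qed.

Let pr_pair_good c x y : good c ->
  pr P (pair_event x y `&` cell c) =
  pr P (cell c) *
  (\prod_i pr P [set o | Y i (c i).1 o = x i] *
   \prod_i step_iter w ((c i).2 - (c i).1) (x i) (y i)).
Proof.
move=> /forallP gc.
have c2 i : ((c i).2 < M)%N by have /andP[] := gc i.
have c12 i : ((c i).1 <= (c i).2)%N.
  by have /andP[_] := gc i; apply: leq_trans; rewrite leq_addl.
pose A i := [set o | Y i (c i).1 o = x i /\ Y i ((c i).1 + ((c i).2 - (c i).1))%N o = y i].
(* A minimum strictly below the cut-off [M] is the true reading, hence the strict inequality in
   [good]. The event then splits into chain events and clock events, which are independent. *)
have exact_clock i o : clock i o = c i -> C i u o = (c i).1 /\ C i v o = (c i).2.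
  move=> E; have E1 : inord (minn (C i u o) M) = (c i).1 by rewrite -E.
  have E2 : inord (minn (C i v o) M) = (c i).2 by rewrite -E.
  have := c2 i; have := leq_ltn_trans (c12 i) (c2 i).
  rewrite -E1 -E2 !inordK ?ltnS ?geq_minr//.
  have lt_minn a : (minn a M < M)%N -> a = minn a M.
    by rewrite gtn_min ltnn orbF => /ltnW/minn_idPl->.
  by move=> h1 h2; split; exact: lt_minn.
rewrite (_ : _ `&` _ = [set o | (forall i, A i o) /\ (forall i, [set o | clock i o = c i] o)]); last first.
  apply/seteqP; split => o /=.
    move=> [[Xu Xv] Zc].
    have cl i : clock i o = c i by rewrite -Zc ffunE.
    split=> // i; have [C1 C2] := exact_clock i o (cl i).
    by rewrite /A /= subnKC// -Xu -Xv !ffunE !HX// C1 C2.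
  move=> [HA Hc]; split; last by apply/ffunP => i; rewrite ffunE Hc.
  split; apply/ffunP => i; rewrite ffunE HX//; have [C1 C2] := exact_clock i o (Hc i);
    have [A1 A2] := HA i; first by rewrite C1.
  by rewrite C2 -A2 subnKC.
have mA i : measurable (A i) by apply: measurableI; exact: (@chain_rv i).
have h1 i : process_events setT (Y i) (A i).
  apply: process_eventsI.
    exact: (@process_events_preimage d T nat V setT (Y i) _ [set z | z = x i] I).
  exact: (@process_events_preimage d T nat V setT (Y i) _ [set z | z = y i] I).
rewrite (pr_indep Hind h1 (fun i => @clock_events i (c i)) mA (fun i => @clock_rv i (c i))).
rewrite mulrC pr_clocks; congr (_ * _); rewrite -big_split /=; apply: eq_bigr => i _.
by rewrite /A (chain_two_times (HY i)).
Qed.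

Let initial_sum c : \sum_x \prod_i pr P [set o | Y i (c i : 'I_M.+1 * 'I_M.+1).1 o = (x : config) i] = 1.
Proof.
rewrite -(bigA_distr_bigA (fun i z => pr P [set o | Y i (c i).1 o = z])) /=.
by rewrite big1// => i _; apply: pr_total; exact: (@chain_rv i).
Qed.

Let correlation_cell c : \sum_x \sum_y G x * G y * pr P (pair_event x y `&` cell c) <=
  (if good c then B * delta else B ^+ 2) * pr P (cell c).
Proof.
have [gc|gc] := boolP (good c); last first.
  have mc : measurable (cell c) by exact: clocks_rv.
  have -> : pr P (cell c) =
      \sum_x \sum_y pr P (pair_event x y `&` cell c).
    rewrite (pr_partition P (walk_config_rv u0) mc); apply: eq_bigr => x _.
    have mcx : measurable (cell c `&` [set o | walk_config u o = x]).
      by apply: measurableI => //; exact: walk_config_rv.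
    rewrite (pr_partition P (walk_config_rv v0) mcx); apply: eq_bigr => y _.
    congr pr; apply/seteqP; split => o /=; first by rewrite /pair_event /= => -[[-> ->] ->].
    by rewrite /pair_event /= => -[[-> ->] ->].
  rewrite mulr_sumr; apply: ler_sum => x _; rewrite mulr_sumr; apply: ler_sum => y _.
  apply: ler_wpM2r; first exact: pr_ge0.
  apply: le_trans (ler_norm _) _; rewrite normrM expr2.
  by apply: ler_pM.
have -> : \sum_x \sum_y G x * G y * pr P (pair_event x y `&` cell c) =
   pr P (cell c) * \sum_x (G x * \prod_i pr P [set o | Y i (c i).1 o = x i]) *
     \sum_y G y * \prod_i step_iter w ((c i).2 - (c i).1) (x i) (y i).
  rewrite mulr_sumr; apply: eq_bigr => x _; rewrite !mulr_sumr; apply: eq_bigr => y _.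
  by rewrite pr_pair_good//; ring.
rewrite mulrC; apply: ler_wpM2r; first exact: pr_ge0.
rewrite -[leRHS]mulr1 -[X in _ <= _ * X](initial_sum c) mulr_sumr; apply: ler_sum => x _.
apply: le_trans (ler_norm _) _; rewrite !normrM.
have p0 : 0 <= \prod_i pr P [set o | Y i (c i).1 o = x i] by apply: prodr_ge0 => i _; exact: pr_ge0.
rewrite (ger0_norm p0) mulrAC; apply: ler_wpM2r => //.
apply: ler_pM => //; apply: mixing => i.
by have /forallP/(_ i)/andP[_ h] := gc; rewrite leq_subRL//; [rewrite addnC|apply: leq_trans h; rewrite leq_addl].
Qed.

Lemma correlation_truncated :
  \sum_x \sum_y G x * G y * pr P (pair_event x y) <=
  B * delta + B ^+ 2 * (\sum_i pr P [set o | (C i v o - C i u o < n)%N] +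
                        \sum_i pr P [set o | (M <= C i v o)%N]).
Proof.
have m1 i : measurable [set o | (C i v o - C i u o < n)%N].
  exact: clock_gap_measurable.
have m2 i : measurable [set o | (M <= C i v o)%N].
  exact: (measurable_nat_event (fun m => (M <= m)%N) (clock_measurable i v0)).
have -> : \sum_x \sum_y G x * G y * pr P (pair_event x y) =
    \sum_c \sum_x \sum_y G x * G y * pr P (pair_event x y `&` cell c).
  rewrite [RHS]exchange_big /=; apply: eq_bigr => x _.
  rewrite [RHS]exchange_big /=; apply: eq_bigr => y _.
  by rewrite -mulr_sumr -(pr_partition P clocks_rv (pair_event_measurable x y)).
apply: le_trans (ler_sum _ (fun c _ => correlation_cell c)) _.
rewrite (bigID good) /=; apply: lerD.
  rewrite (eq_bigr (fun c => B * delta * pr P (cell c))); last by move=> c ->.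
  rewrite -mulr_sumr -(pr_event P good clocks_rv) ler_piMr ?mulr_ge0//.
  exact: (pr_le1 P (finite_rv_event P good clocks_rv)).
rewrite (eq_bigr (fun c => B ^+ 2 * pr P (cell c))); last by move=> c /negbTE ->.
rewrite -mulr_sumr -(pr_event P (fun c => ~~ good c) clocks_rv) ler_wpM2l ?sqr_ge0//.
rewrite -big_split /=.
have m12 i : measurable ([set o | (C i v o - C i u o < n)%N] `|` [set o | (M <= C i v o)%N]).
  exact: measurableU.
apply: le_trans (union_bound _ m12 _) _.
- exact: (finite_rv_event P (fun c => ~~ good c) clocks_rv).
- move=> o /= /forallPn[i]; rewrite negb_and -!leqNgt -ltnNge ffunE /= => H.
  exists i; have [Mv|vM] := leqP M (C i v o); first by right.
  left; move: H; have uM : (C i u o < M)%N by apply: leq_ltn_trans vM; exact: clock_mono.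
  rewrite !inordK ?ltnS ?geq_minr// (minn_idPl (ltnW vM)) (minn_idPl (ltnW uM)).
  rewrite leqNgt vM /= => h; have := clock_mono i o u0 uv; lia.
by apply: ler_sum => i _; exact: pr_setU_le.
Qed.
End TwoTimes.

(** The cut-off is released: for the given [v] it is taken so large that each clock reaches it with
    probability at most [e1]. *)
Lemma pair_correlation (u v : R) (G : config -> R) (B delta : R) (n : nat) :
  0 <= u -> u <= v -> 0 <= B -> (forall x, `|G x| <= B) -> 0 <= delta ->
  mixed_after w G n delta ->
  (forall i, pr P [set o | (C i v o - C i u o < n)%N] <= delta) ->
  \sum_x \sum_y G x * G y * pr P [set o | walk_config u o = x /\ walk_config v o = y] <=
  B * delta + B ^+ 2 * (N%:R * delta).
Proof.
move=> u0 uv B0 GB d0 mix gap; have v0 : 0 <= v by exact: le_trans uv.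
apply/ler_addgt0Pr => e e0.
pose e1 := e / (B ^+ 2 * N%:R + 1).
have D0 : 0 < B ^+ 2 * N%:R + 1 by rewrite ltr_wpDl// mulr_ge0// sqr_ge0.
have e10 : 0 < e1 by rewrite divr_gt0.
have /choice[M HM] : forall i, exists k, pr P [set o | (k <= C i v o)%N] <= e1.
  by move=> i; apply: nat_tail => //; exact: clock_measurable.
pose MM := (\max_i M i)%N.
apply: le_trans (correlation_truncated u0 uv B0 GB d0 mix MM) _.
have tail i : pr P [set o | (MM <= C i v o)%N] <= e1.
  apply: le_trans (HM i); apply: pr_le.
  - exact: (measurable_nat_event (fun m => (MM <= m)%N) (clock_measurable i v0)).
  - exact: (measurable_nat_event (fun m => (M i <= m)%N) (clock_measurable i v0)).
  - by move=> o /=; apply: leq_trans; exact: leq_bigmax.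
have S1 : \sum_i pr P [set o | (C i v o - C i u o < n)%N] <= N%:R * delta.
  apply: le_trans (ler_sum _ (fun i _ => gap i)) _.
  by rewrite sumr_const card_ord mulr_natl.
have S2 : \sum_i pr P [set o | (MM <= C i v o)%N] <= N%:R * e1.
  apply: le_trans (ler_sum _ (fun i _ => tail i)) _.
  by rewrite sumr_const card_ord mulr_natl.
have ee : B ^+ 2 * (N%:R * e1) <= e.
  have -> : B ^+ 2 * (N%:R * e1) = e * ((B ^+ 2 * N%:R) / (B ^+ 2 * N%:R + 1)).
    by rewrite /e1; field; rewrite gt_eqF.
  apply: ler_piMr; first exact: ltW.
  by rewrite ler_pdivrMr// mul1r lerDl.
have := ler_wpM2l (sqr_ge0 B) (lerD S1 S2); lra.
Qed.

(** The autocorrelation of the process [G (walk_config t)]. *)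
Definition pairing (G : config -> R) u v := \sum_x \sum_y
  G x * G y * pr P [set o | walk_config u o = x /\ walk_config v o = y].

Lemma pairingC G u v : pairing G u v = pairing G v u.
Proof.
rewrite /pairing exchange_big; apply: eq_bigr => x _; apply: eq_bigr => y _.
rewrite (mulrC (G y)); congr (_ * pr P _).
by apply/seteqP; split => o /= [].
Qed.

Lemma walk_pair_rv u v : 0 <= u -> 0 <= v ->
  finite_rv (fun o => (walk_config u o, walk_config v o)).
Proof. by move=> u0 v0; apply: finite_rv_pair; exact: walk_config_rv. Qed.

Lemma pairingE G u v : pairing G u v =
  \sum_p G p.1 * G p.2 * pr P [set o | (walk_config u o, walk_config v o) = p].
Proof.
rewrite /pairing pair_big /=; apply: eq_bigr => -[x y] _ /=; congr (_ * pr P _).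
by apply/seteqP; split => o /=; [case=> -> ->|case=> -> ->].
Qed.

Lemma pairing_le G B u v : 0 <= u -> 0 <= v -> (forall x, `|G x| <= B) ->
  pairing G u v <= B ^+ 2.
Proof.
move=> u0 v0 GB; rewrite pairingE -[leRHS]mulr1 -(pr_total P (walk_pair_rv u0 v0)).
rewrite mulr_sumr; apply: ler_sum => p _; apply: ler_wpM2r; first exact: pr_ge0.
apply: le_trans (ler_norm _) _; rewrite normrM expr2.
by apply: ler_pM.
Qed.

Definition jumps o t : nat := (\sum_i C i t o)%N.

Lemma jumps_mono o s t : 0 <= s -> s <= t -> (jumps o s <= jumps o t)%N.
Proof. by move=> s0 st; apply: leq_sum => i _; exact: clock_mono. Qed.

Lemma jumps_cst o s t : 0 <= s -> s <= t -> jumps o s = jumps o t -> X s o = X t o.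
Proof.
move=> s0 st E; apply: funext => i; rewrite !HX ?(le_trans s0)//; congr (Y i _ o).
have le_rest : (\sum_(j | j != i) C j s o <= \sum_(j | j != i) C j t o)%N.
  by apply: leq_sum => j _; exact: clock_mono.
have := clock_mono i o s0 st.
by move: E le_rest; rewrite /jumps (bigD1 i)//= [RHS](bigD1 i)//=; lia.
Qed.

Lemma walk_regular o : regular_path (X ^~ o).
Proof.
split=> [g|t t0]; last first.
  have : \forall s \near t^'+, forall i, C i s o = C i t o.
    by apply: filter_forall => i; exact: poisson_rcont (HC i) o t t0.
  move=> H; near=> s; apply: funext => i.
  have ts : t <= s by apply: ltW; near: s; exact: nbhs_right_gt.
  rewrite !HX ?(le_trans t0)//; congr (Y i _ o).
  by move: i; near: s.
move=> _ B mB.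
rewrite (_ : _ `&` _ =
  \bigcup_k [set s | [/\ 0 <= s, jumps o s = k & B (g (X s o))]]); last first.
  apply/seteqP; split => s /=; rewrite in_itv /= andbT.
    by move=> [s0 Bs]; exists (jumps o s).
  by move=> [k _ [s0 _ Bs]].
(* On a level set of the nondecreasing count [jumps o] the path is constant, so each of these sets
   is an interval. *)
apply: bigcup_measurable => k _; apply: measurable_realfun.is_interval_measurable => s t /= [s0 sk Bs] [t0 tk _] u.
move=> /andP[su ut]; have u0 := le_trans s0 su.
have uk : jumps o u = k.
  apply/eqP; rewrite eqn_leq; apply/andP; split.
    by rewrite -tk jumps_mono.
  by rewrite -sk jumps_mono.
by split=> //; rewrite -(jumps_cst s0 su)// uk.
Unshelve. all: by end_near.
Qed.

Lemma walk_bounded (G : config -> R) B o : (forall x, `|G x| <= B) ->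
  bounded_measurable B (fun s => G (walk_config s o)).
Proof.
move=> GB; split; last by move=> s _; exact: GB.
exact: (path_measurable (walk_regular o) (fun x => G [ffun i => x i])).
Qed.

(** A cell without a jump contributes no error and any other cell at most [2 * B * h], so the total
    number of jumps bounds the number of bad cells. *)
Lemma riemann_error (G : config -> R) B o m (h : R) : 0 <= B -> 0 < h ->
  (forall x, `|G x| <= B) ->
  `|primitive (fun s => G (walk_config s o)) (h * m%:R) -
    h * \sum_(k < m) G (walk_config (h * k.+1%:R) o)| <=
  2 * B * h * (jumps o (h * m%:R))%:R.
Proof.
move=> B0 h0 GB; have bG := walk_bounded o GB.
elim: m => [|m IH].
  by rewrite mulr0 primitive0 big_ord0 mulr0 subrr normr0 !mulr_ge0// ltW.
have m0 : 0 <= h * m%:R by rewrite mulr_ge0// ltW.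
have mS : h * m%:R <= h * m.+1%:R by rewrite ler_pM2l// ler_nat.
have hE : h * m.+1%:R - h * m%:R = h by rewrite -mulrBr -natrB// subSnn mulr1.
have JJ := jumps_mono o m0 mS.
have := @primitive_increment _ _ _ _ _ (G (walk_config (h * m.+1%:R) o))
  (2 * B * (jumps o (h * m.+1%:R) - jumps o (h * m%:R))%N%:R) bG m0 mS.
rewrite hE => H; rewrite big_ord_recr /= mulrDr.
have /H {}H : forall u, h * m%:R < u <= h * m.+1%:R ->
    `|G (walk_config u o) - G (walk_config (h * m.+1%:R) o)| <=
    2 * B * (jumps o (h * m.+1%:R) - jumps o (h * m%:R))%N%:R.
  move=> u /andP[mu um]; have u0 := le_trans m0 (ltW mu).
  have J1 := jumps_mono o m0 (ltW mu); have J2 := jumps_mono o u0 um.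
  have [E|NE] := eqVneq (jumps o u) (jumps o (h * m.+1%:R)).
    have -> : walk_config u o = walk_config (h * m.+1%:R) o.
      by apply/ffunP => i; rewrite !ffunE (jumps_cst u0 um E).
    by rewrite subrr normr0 !mulr_ge0.
  have J3 : 1 <= (jumps o (h * m.+1%:R) - jumps o (h * m%:R))%N%:R :> R.
    by rewrite (ler_nat _ 1); lia.
  apply: le_trans (ler_normB _ _) _; have := GB (walk_config u o).
  have := GB (walk_config (h * m.+1%:R) o).
  by have := ler_wpM2l B0 J3; lra.
move: H IH; rewrite natrB//.
set a := primitive _ _; set b := primitive _ _; set c := h * G _.
set e := h * \sum_(_ < _) _; set p := _%:R; set q := _%:R => H1 H2.
have -> : a - (e + c) = (a - b - c) + (b - e) by ring.
apply: le_trans (ler_normD _ _) _; apply: le_trans (lerD H1 H2) _.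
by apply: le_of_eq; ring.
Qed.

(** * Second-moment bounds for time integrals *)

Section Deviation.
Variables (G : config -> R) (B delta L : R) (n : nat).
Hypotheses (B0 : 0 <= B) (GB : forall x, `|G x| <= B) (delta0 : 0 <= delta)
  (L0 : 0 < L) (rate0 : 0 < rate).
Hypothesis mixing : mixed_after w G n delta.
Hypothesis lower_tail : forall l, L <= l ->
  (poisson_prob l 0 [set k | (k < n)%N] <= delta%:E)%E.
Local Notation D := (B * delta + B ^+ 2 * (N%:R * delta)).

Lemma pairing_far u v : 0 <= u -> 0 <= v -> L <= rate * `|v - u| ->
  pairing G u v <= D.
Proof.
wlog uv : u v / u <= v.
  move=> H u0 v0 far; have [uv|vu] := leP u v; first exact: H.
  by rewrite pairingC; apply: H => //; [exact: ltW|rewrite distrC].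
move=> u0 v0; rewrite ger0_norm ?subr_ge0// => far.
apply: pair_correlation (mixing) _ => // i.
rewrite /pr (poisson_law (HC i) u0 uv [set k | (k < n)%N]).
rewrite -lee_fin fineK; first exact: lower_tail.
rewrite -(poisson_law (HC i) u0 uv [set k | (k < n)%N]).
apply: fin_num_measure; exact: clock_gap_measurable.
Qed.

Lemma sum_close m (k : nat) Q :
  (\sum_(l < m) ((k < l + Q) && (l < k + Q)) <= 2 * Q)%N.
Proof.
have : (\sum_(l < m) ((k < l + Q) && (l < k + Q)) <= minn m (k + Q) - (k - Q))%N.
  elim: m => [|m IH]; first by rewrite big_ord0.
  rewrite big_ord_recr /=; move: IH; set S := (\sum_(_ < _) _)%N.
  by case: ltnP; case: ltnP => /=; lia.
lia.
Qed.

(** [Q] cells span a lag of at least [L / rate]. Pairs at least [Q] apart contribute at most [D]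
    each; in a row at most [2 * Q] pairs are closer, and these are bounded by [B ^+ 2]. *)
Lemma riemann_second_moment m h : 0 < h ->
  h ^+ 2 * \sum_(k < m) \sum_(l < m) pairing G (h * k.+1%:R) (h * l.+1%:R) <=
  (m%:R * h) ^+ 2 * D + 2 * (m%:R * h) * (L / rate + h) * B ^+ 2.
Proof.
move=> h0; pose Q := (Num.truncn (L / (rate * h))).+1.
have D0 : 0 <= D by rewrite addr_ge0// !mulr_ge0// ?sqr_ge0.
have LQ : L / (rate * h) <= Q%:R by apply: ltW; exact: truncnS_gt.
have QL : Q%:R * h <= L / rate + h.
  have : (Num.truncn (L / (rate * h)))%:R <= L / (rate * h) :> R.
    by rewrite truncn_le// divr_ge0 ?mulr_ge0// ltW.
  move=> /(ler_wpM2r (ltW h0)); rewrite /Q -natr1 mulrDl mul1r lerD2r => /le_trans; apply.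
  by rewrite invfM mulrA mulfVK// gt_eqF.
have cell (k l : 'I_m) : pairing G (h * k.+1%:R) (h * l.+1%:R) <=
    D + ((k < l + Q) && (l < k + Q))%N%:R * B ^+ 2.
  have p0 j : 0 <= h * j.+1%:R :> R by rewrite mulr_ge0// ltW.
  case E : (_ && _); first by apply: le_trans (pairing_le (p0 k) (p0 l) GB) _; rewrite mul1r lerDr.
  rewrite mul0r addr0; apply: pairing_far => //.
  rewrite -mulrBr normrM (gtr0_norm h0) mulrA -ler_pdivrMl ?mulr_gt0//.
  rewrite mulrC; apply: le_trans LQ _.
  have [kl|lk] := leqP k l.
    rewrite ger0_norm ?subr_ge0 ?ler_nat ?ltnS// -natrB ?ltnS// ler_nat subSS; lia.
  rewrite distrC ger0_norm ?subr_ge0 ?ler_nat ?ltnS 1?ltnW// -natrB ?ltnS 1?ltnW// ler_nat subSS; lia.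
have row (k : 'I_m) : \sum_(l < m) pairing G (h * k.+1%:R) (h * l.+1%:R) <=
    m%:R * D + 2 * Q%:R * B ^+ 2.
  apply: le_trans (ler_sum _ (fun l _ => cell k l)) _.
  rewrite big_split /= sumr_const card_ord -[X in X + _ <= _]mulr_natl lerD2l -mulr_suml.
  by apply: ler_wpM2r; rewrite ?sqr_ge0// -natr_sum -natrM ler_nat sum_close.
apply: le_trans (ler_wpM2l (sqr_ge0 h) (ler_sum _ (fun k _ => row k))) _.
rewrite sumr_const card_ord.
have -> : h ^+ 2 * ((m%:R * D + 2 * Q%:R * B ^+ 2) *+ m) =
    (m%:R * h) ^+ 2 * D + 2 * (m%:R * h) * (Q%:R * h) * B ^+ 2.
  by rewrite -[X in _ * X]mulr_natl; ring.
rewrite lerD2l; apply: ler_wpM2r; first exact: sqr_ge0.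
by apply: ler_wpM2l => //; rewrite !mulr_ge0// ltW.
Qed.

(** Chebyshev for the finite joint law of the [m] sampled configurations. *)
Lemma riemann_tail m (h gamma : R) : 0 < h -> 0 < gamma ->
  let E := [set o : T | gamma < `|h * \sum_(k < m) G (walk_config (h * k.+1%:R) o)|] in
  d.-measurable E /\
  pr P E <= ((m%:R * h) ^+ 2 * D + 2 * (m%:R * h) * (L / rate + h) * B ^+ 2) / gamma ^+ 2.
Proof.
move=> h0 g0 E.
have p0 j : 0 <= h * j.+1%:R :> R by rewrite mulr_ge0// ltW.
pose W o : {ffun 'I_m -> config} := [ffun k : 'I_m => walk_config (h * k.+1%:R) o].
have W_rv : finite_rv W by apply: finite_rv_ffun => k; exact: walk_config_rv.
pose S (f : {ffun 'I_m -> config}) := h * \sum_k G (f k).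
have SW o : S (W o) = h * \sum_(k < m) G (walk_config (h * k.+1%:R) o).
  by rewrite /S; congr (_ * _); apply: eq_bigr => k _; rewrite ffunE.
have EW : E = [set o | (gamma < `|S (W o)|)].
  by apply/seteqP; split => o; rewrite /E /= SW.
have mE : measurable E.
  by rewrite EW; exact: (finite_rv_event P (fun f => gamma < `|S f|) W_rv).
split=> //.
have g20 : 0 < gamma ^+ 2 by rewrite exprn_gt0.
rewrite ler_pdivlMr//; apply: le_trans (riemann_second_moment m h0).
have -> : h ^+ 2 * \sum_(k < m) \sum_(l < m) pairing G (h * k.+1%:R) (h * l.+1%:R) =
    \sum_f S f ^+ 2 * pr P [set o | W o = f].
  under [RHS]eq_bigr => f _ do rewrite /S exprMn -mulrA [in X in _ * (X * _)]expr2 mulr_suml mulr_suml.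
  rewrite -mulr_sumr; congr (_ * _); rewrite [RHS]exchange_big; apply: eq_bigr => k _.
  under [RHS]eq_bigr => f _ do rewrite mulr_sumr mulr_suml.
  rewrite [RHS]exchange_big; apply: eq_bigr => l _ /=.
  rewrite pairingE [RHS](partition_big (fun f : {ffun 'I_m -> config} => (f k, f l)) predT)//=.
  apply: eq_bigr => p _.
  rewrite (_ : [set o | _ = p] = [set o | (W o k, W o l) == p]); last first.
    by apply/seteqP; split => o /=; rewrite !ffunE => /eqP.
  rewrite (pr_event P (fun f : {ffun 'I_m -> config} => (f k, f l) == p) W_rv) mulr_sumr.
  by apply: eq_bigr => f /eqP <-.
rewrite EW (pr_event P (fun f => gamma < `|S f|) W_rv) mulr_suml.
rewrite [leRHS](bigID (fun f => gamma < `|S f|)) /= -[leLHS]addr0; apply: lerD.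
  apply: ler_sum => f gS; rewrite mulrC; apply: ler_wpM2r; first exact: pr_ge0.
  by rewrite -(real_normK (num_real (S f))) lerXn2r// ?nnegrE ltW// (lt_trans g0).
by apply: sumr_ge0 => f _; rewrite mulr_ge0 ?sqr_ge0 ?pr_ge0.
Qed.
Lemma integral_tail (t gamma eta : R) : 0 < t -> 0 < gamma -> 0 < eta ->
  exists A : set T, [/\ measurable A,
    forall o, A o -> `|primitive (fun s => G (walk_config s o)) t| <= gamma &
    pr P (~` A) <= 4 / gamma ^+ 2 * (t ^+ 2 * D + 2 * t * (L / rate) * B ^+ 2) + eta].
Proof.
move=> t0 g0 e0; have N1 : 0 < 2 * N.+1%:R :> R by rewrite mulr_gt0.
have /choice[M HM] : forall i, exists k, pr P [set o | (k <= C i t o)%N] <= eta / (2 * N.+1%:R).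
  by move=> i; apply: nat_tail; [exact: clock_measurable (ltW t0)|exact: divr_gt0].
pose J := (\sum_i M i)%N.
(* [a1] keeps the Riemann error for at most [J] jumps below [gamma / 2]. [a2] puts the mesh term of
   the second moment below [eta / 2]; the other half of [eta] pays for too many jumps. *)
pose a1 := 4 * B * t * J%:R / gamma; pose a2 := 16 * t ^+ 2 * B ^+ 2 / (gamma ^+ 2 * eta).
have [a10 a20] : 0 <= a1 /\ 0 <= a2.
  by split; rewrite !mulr_ge0// ?sqr_ge0// ?invr_ge0 ?mulr_ge0 ?sqr_ge0// ltW.
pose m := (Num.bound (a1 + a2)).+1.
have am : a1 + a2 <= m%:R.
  apply: ltW; apply: lt_trans (archi_boundP _) _; first exact: addr_ge0.
  by rewrite ltr_nat.
have m0 : 0 < m%:R :> R by rewrite ltr0n.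
pose h := t / m%:R; have h0 : 0 < h by exact: divr_gt0.
have hm : m%:R * h = t by rewrite /h mulrC mulfVK ?gt_eqF.
have g20 : 0 < gamma / 2 by rewrite divr_gt0.
have [mE Etail] := riemann_tail m h0 g20.
set E := [set o | _] in mE Etail.
have mF i : d.-measurable [set o | (M i <= C i t o)%N].
  exact: (measurable_nat_event (fun k => (M i <= k)%N) (clock_measurable i (ltW t0))).
have [mU Utail] := pr_bigcup_le P mF.
set U := [set o | _] in mU Utail.
exists (~` (E `|` U)); split.
- by apply: measurableC; exact: measurableU.
- move=> o /= /not_orP[nE nU].
  have RG : `|h * \sum_(k < m) G (walk_config (h * k.+1%:R) o)| <= gamma / 2.
    by rewrite leNgt; apply/negP.
  have JJ : (jumps o t <= J)%N.
    apply: leq_sum => i _; rewrite leqNgt; apply/negP => /ltnW lt; apply: nU.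
    by exists i.
  have := riemann_error o m B0 h0 GB; rewrite [h * m%:R]mulrC hm => err.
  have : 2 * B * h * (jumps o t)%:R <= gamma / 2.
    apply: le_trans (_ : 2 * B * h * J%:R <= _).
      by apply: ler_wpM2l; rewrite ?ler_nat// !mulr_ge0// ltW.
    have -> : 2 * B * h * J%:R = a1 * gamma / 2 / m%:R.
      by rewrite /h /a1; field; rewrite !gt_eqF.
    rewrite ler_pdivrMr// -mulrA [leRHS]mulrC; apply: ler_wpM2r; first exact: ltW.
    by apply: le_trans am; rewrite lerDl.
  move: err RG; set p := primitive _ _; set q := h * _ => err RG cc.
  have -> : p = (p - q) + q by ring.
  by apply: le_trans (ler_normD _ _) _; lra.
rewrite setCK; apply: le_trans (pr_setU_le P mE mU) _.
apply: le_trans (lerD Etail Utail) _; rewrite hm.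
have U2 : \sum_i pr P [set o | (M i <= C i t o)%N] <= eta / 2.
  apply: le_trans (ler_sum _ (fun i _ => HM i)) _.
  rewrite sumr_const card_ord -[leLHS]mulr_natl.
  have -> : N%:R * (eta / (2 * N.+1%:R)) = eta / 2 * (N%:R / N.+1%:R) :> R.
    by field; rewrite !gt_eqF.
  apply: ler_piMr; first by rewrite divr_ge0// ltW.
  by rewrite ler_pdivrMr ?ltr0n// mul1r ler_nat.
apply: le_trans (lerD (lexx _) U2) _.
have E2 : 2 * t * h * B ^+ 2 * 4 / gamma ^+ 2 <= eta / 2.
  have -> : 2 * t * h * B ^+ 2 * 4 / gamma ^+ 2 = a2 * (eta / 2) / m%:R.
    by rewrite /h /a2; field; rewrite !gt_eqF.
  rewrite ler_pdivrMr// [leRHS]mulrC; apply: ler_wpM2r; first by rewrite divr_ge0// ltW.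
  by apply: le_trans am; rewrite lerDr.
have -> : (t ^+ 2 * D + 2 * t * (L / rate + h) * B ^+ 2) / (gamma / 2) ^+ 2 =
    4 / gamma ^+ 2 * (t ^+ 2 * D + 2 * t * (L / rate) * B ^+ 2) +
    2 * t * h * B ^+ 2 * 4 / gamma ^+ 2.
  by field; rewrite !gt_eqF.
lra.
Qed.
End Deviation.

End Walks.

(** * Averaging and synchronisation with high probability *)

Section SmallTime.
Context (R : realType) (V : finType) (w : V -> V -> R) (N : nat).
Hypothesis hw : weighted_graph w.
Local Notation config := {ffun 'I_N -> V}.

Lemma walks_regular d (T : measurableType d) (P : probability T R) rate x0
    (X : R -> T -> 'I_N -> V) : independent_walks P w rate x0 X ->
  forall o, regular_path (X ^~ o).
Proof. by move=> [Y [C [_ HC _ HX]]]; exact: walk_regular HC HX. Qed.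

Lemma walks_bounded d (T : measurableType d) (P : probability T R) rate x0
    (X : R -> T -> 'I_N -> V) (G : config -> R) (B : R) o :
  independent_walks P w rate x0 X -> (forall x, `|G x| <= B) ->
  bounded_measurable B (fun s => G (walk_config X s o)).
Proof. by move=> [Y [C [_ HC _ HX]]] GB; exact: (walk_bounded HC HX o GB). Qed.

(** [L] is fixed before the probability space, the rate and the starting point; the uniformity of
    all later estimates rests on this order of quantifiers. *)
Lemma mean_square_tail (G : config -> R) (B kappa : R) : centered w G -> 0 <= B ->
  (forall x, `|G x| <= B) -> 0 < kappa ->
  exists2 L, 0 < L & forall (d : measure_display) (T : measurableType d)
    (P : probability T R) rate x0 (X : R -> T -> 'I_N -> V),
    0 < rate -> independent_walks P w rate x0 X ->
    forall t gamma eta, 0 < t -> 0 < gamma -> 0 < eta -> exists A : set T,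
    [/\ d.-measurable A,
        forall o, A o -> `|primitive (fun s => G (walk_config X s o)) t| <= gamma &
        pr P (~` A) <=
          4 / gamma ^+ 2 * (t ^+ 2 * kappa + 2 * t * (L / rate) * B ^+ 2) + eta].
Proof.
move=> Gc B0 GB k0; pose S := B + B ^+ 2 * N%:R + 1.
have S0 : 0 < S by rewrite ltr_wpDl// addr_ge0// mulr_ge0// sqr_ge0.
pose delta := kappa / S; have d0 : 0 < delta by exact: divr_gt0.
have [n mixing] := config_mixing hw d0 Gc B0 GB.
have [L [L0 lower_tail]] := poisson_lower_tail n d0.
exists L => // d T P rate x0 X r0 [Y [C [HY HC Hind HX]]] t gamma eta t0 g0 e0.
have [A [mA HA tA]] := integral_tail HY HC Hind HX B0 GB (ltW d0) L0 r0 mixing lower_tail t0 g0 e0.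
exists A; split=> //; apply: le_trans tA _; rewrite lerD2r.
apply: ler_wpM2l; first by rewrite divr_ge0// sqr_ge0.
rewrite lerD2r; apply: ler_wpM2l; first exact: sqr_ge0.
have -> : B * delta + B ^+ 2 * (N%:R * delta) = kappa * ((B + B ^+ 2 * N%:R) / S).
  by rewrite /delta; field; rewrite gt_eqF.
apply: ler_piMr; first exact: ltW.
by rewrite ler_pdivrMr// mul1r lerDl.
Qed.

Lemma pr_inter_tail d (T : measurableType d) (P : probability T R) (F : finType)
    (A : F -> set T) (eta : R) : 0 < eta -> (forall k, d.-measurable (A k)) ->
  (forall k, pr P (~` A k) <= eta / #|F|.+1%:R) ->
  exists2 U : set T, d.-measurable U /\ pr P (~` U) <= eta & forall o, U o -> forall k, A k o.
Proof.
move=> e0 mA tA; have mC k : d.-measurable (~` A k) by exact: measurableC.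
have [mU tU] := pr_bigcup_le P mC; exists (~` [set o | exists k, (~` A k) o]).
  split; first exact: measurableC.
  rewrite setCK; apply: le_trans tU _; apply: le_trans (ler_sum _ (fun k _ => tA k)) _.
  rewrite sumr_const -[leLHS]mulr_natl mulrCA; apply: ler_piMr; first exact: ltW.
  by rewrite ler_pdivrMr ?ltr0n// mul1r ler_nat.
by move=> o Uo k; apply: contrapT => nA; apply: Uo; exists k.
Qed.

Definition likely_small (G : config -> R) (Th gamma eta eps0 : R) : Prop :=
  forall (d : measure_display) (T : measurableType d) (P : probability T R) eps x0
    (X : R -> T -> 'I_N -> V), 0 < eps -> eps < eps0 ->
  independent_walks P w eps^-1 x0 X -> exists A : set T, [/\ d.-measurable A,
    forall o, A o -> forall t, 0 <= t <= Th ->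
      `|primitive (fun s => G (walk_config X s o)) t| <= gamma &
    pr P (~` A) <= eta].

(** The primitive is [B]-Lipschitz, so control by [gamma / 2] at [J] grid times of mesh [tau], with
    [B * tau <= gamma / 2], extends to all times up to [Th]. *)
Lemma sup_tail (G : config -> R) (B Th gamma eta : R) : centered w G -> 0 <= B ->
  (forall x, `|G x| <= B) -> 0 < Th -> 0 < gamma -> 0 < eta ->
  exists2 eps0, 0 < eps0 & likely_small G Th gamma eta eps0.
Proof.
move=> Gc B0 GB T0 g0 e0.
pose J := (Num.bound (2 * Th * B / gamma)).+1.
have J0 : 0 < J%:R :> R by rewrite ltr0n.
pose tau := Th / J%:R; have tau0 : 0 < tau by exact: divr_gt0.
have Btau : B * tau <= gamma / 2.
  have -> : B * tau = 2 * Th * B / gamma * (gamma / 2) / J%:R.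
    by rewrite /tau; field; rewrite !gt_eqF.
  rewrite ler_pdivrMr// [leRHS]mulrC; apply: ler_wpM2r; first by rewrite divr_ge0// ltW.
  apply: ltW; apply: lt_trans (archi_boundP _) _; last by rewrite ltr_nat.
  by rewrite divr_ge0// ?mulr_ge0// ltW.
pose e1 := eta / #|'I_J|.+1%:R; have e10 : 0 < e1 by rewrite divr_gt0// ltr0n.
(* [kappa] and [eps0] are each calibrated to use [e1 / 3] of the failure probability at a grid time;
   the threshold [gamma / 2] brings the factor 16 inside 48 and 96. *)
pose kappa := gamma ^+ 2 * e1 / (48 * Th ^+ 2).
have k0 : 0 < kappa by rewrite divr_gt0// mulr_gt0// exprn_gt0.
have [L L0 HL] := mean_square_tail Gc B0 GB k0.
pose eps0 := e1 * gamma ^+ 2 / (96 * Th * L * (B ^+ 2 + 1)).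
have B1 : 0 < B ^+ 2 + 1 by rewrite ltr_wpDl// sqr_ge0.
have eps00 : 0 < eps0 by rewrite divr_gt0 ?mulr_gt0// exprn_gt0.
exists eps0 => // d T P eps x0 X ep0 epe HX.
have g20 : 0 < gamma / 2 by rewrite divr_gt0.
have e30 : 0 < e1 / 3 by rewrite divr_gt0.
have t0 (k : 'I_J) : 0 < tau * k.+1%:R by rewrite mulr_gt0// ltr0n.
have rate0 : 0 < eps^-1 by rewrite invr_gt0.
have /choice[A HA] : forall k : 'I_J, exists A : set T, [/\ d.-measurable A,
    forall o, A o -> `|primitive (fun s => G (walk_config X s o)) (tau * k.+1%:R)| <= gamma / 2 &
    pr P (~` A) <= e1].
  move=> k; have [A [mA HA tA]] := HL d T P _ x0 X rate0 HX _ _ _ (t0 k) g20 e30.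
  exists A; split=> //; apply: le_trans tA _; rewrite invrK.
  have tT : tau * k.+1%:R <= Th.
    by rewrite /tau mulrAC ler_pdivrMr// ler_wpM2l ?(ltW T0)// ler_nat.
  have gg : 0 <= 4 / (gamma / 2) ^+ 2 by rewrite divr_ge0// sqr_ge0.
  have H1 : 4 / (gamma / 2) ^+ 2 * ((tau * k.+1%:R) ^+ 2 * kappa) <= e1 / 3.
    have -> : e1 / 3 = 4 / (gamma / 2) ^+ 2 * (Th ^+ 2 * kappa).
      by rewrite /kappa; field; rewrite !gt_eqF.
    apply: ler_wpM2l => //; apply: ler_wpM2r; first exact: ltW.
    by rewrite lerXn2r// ?nnegrE ltW.
  have H2 : 4 / (gamma / 2) ^+ 2 * (2 * (tau * k.+1%:R) * (L * eps) * B ^+ 2) <= e1 / 3.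
    have -> : e1 / 3 = 4 / (gamma / 2) ^+ 2 * (2 * Th * (L * eps0) * (B ^+ 2 + 1)).
      by rewrite /eps0; field; rewrite !gt_eqF.
    apply: ler_wpM2l => //; apply: ler_pM; [|exact: sqr_ge0| |by rewrite lerDl].
      by rewrite !mulr_ge0// ltW.
    apply: ler_pM; [| | |by apply: ler_wpM2l; exact: ltW].
    - by rewrite mulr_ge0// ltW.
    - by rewrite mulr_ge0// ltW.
    - exact: ler_wpM2l.
  move: H1 H2; rewrite mulrDr; lra.
have [||U [mU tU] HU] := @pr_inter_tail d T P _ A eta e0; try by move=> k; case: (HA k).
exists U; split=> // o Uo t /andP[t00 tTh].
have bG := walks_bounded o HX GB.
pose k := Num.truncn (t / tau).
have /andP[kt tk] : k%:R <= t / tau < k.+1%:R by apply: truncn_itv; rewrite divr_ge0// ltW.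
have kt' : tau * k%:R <= t by rewrite mulrC -ler_pdivlMr.
have tk' : t - tau * k%:R <= tau.
  by move: tk; rewrite ltr_pdivrMr// -natr1 => /ltW; rewrite mulrDl mul1r; lra.
have k00 : 0 <= tau * k%:R by rewrite mulr_ge0// ltW.
have near : `|primitive (fun s => G (walk_config X s o)) t -
    primitive (fun s => G (walk_config X s o)) (tau * k%:R)| <= gamma / 2.
  apply: le_trans (primitive_lipschitz bG kt') _; apply: le_trans Btau.
  exact: ler_wpM2l.
have grid : `|primitive (fun s => G (walk_config X s o)) (tau * k%:R)| <= gamma / 2.
  have kJ : (k <= J)%N.
    rewrite -(ler_nat R); apply: le_trans kt _; rewrite ler_pdivrMr//.
    by rewrite /tau mulrC mulfVK// gt_eqF.
  case: k kJ {kt tk kt' tk' k00 near} => [_|k kJ].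
    by rewrite mulr0 primitive0 normr0 ltW.
  by have [_ H _] := HA (Ordinal kJ); apply: H; exact: HU.
move: near grid; set p := primitive _ t; set q := primitive _ _ => near grid.
have -> : p = (p - q) + q by ring.
by apply: le_trans (ler_normD _ _) _; lra.
Qed.

Lemma finite_lower_bound (F : finType) (f : F -> R) : (forall i, 0 < f i) ->
  exists2 c, 0 < c & forall i, c <= f i.
Proof.
move=> f0.
have H (s : seq F) : exists2 c, 0 < c & forall i, i \in s -> c <= f i.
  elim: s => [|i s [c c0 Hc]]; first by exists 1.
  exists (Num.min c (f i)); first by rewrite lt_min c0 f0.
  move=> j; rewrite inE => /orP[/eqP->|/Hc cj]; rewrite ge_min ?lexx ?orbT//.
  by rewrite cj.
by have [c c0 Hc] := H (index_enum F); exists c => // i; exact/Hc/mem_index_enum.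
Qed.

Definition mean_weight := \sum_u \sum_v stationary w u * stationary w v * w u v.

Lemma stationary_pair (F : V -> V -> R) (i j : 'I_N) : i != j ->
  \sum_(x : config) stationary_config w x * F (x i) (x j) =
  \sum_u \sum_v stationary w u * stationary w v * F u v.
Proof.
move=> ij; have ji : (j == i) = false by rewrite eq_sym; exact: negbTE.
(* Prescribing coordinates [i] and [j] through indicators keeps the summand a product over the
   walks, so the sum over configurations factorises. *)
pose c u v (k : 'I_N) z := stationary w z *
  (if k == i then z == u else if k == j then z == v else true)%:R.
have cE u v (x : config) : \prod_k c u v k (x k) =
    stationary_config w x * ((x i == u)%:R * (x j == v)%:R).
  rewrite big_split /=; congr (_ * _).
  rewrite (bigD1 i)//= eqxx (bigD1 j) 1?eq_sym//= ji eqxx.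
  rewrite big1 ?mulr1// => k /andP[ki kj].
  by rewrite (negbTE ki) (negbTE kj).
have pick a (f : V -> R) : \sum_z f z * (a == z)%:R = f a.
  rewrite (bigD1 a)//= eqxx mulr1 big1 ?addr0// => z za.
  by rewrite eq_sym (negbTE za) mulr0.
have cS u v : \sum_(x : config) \prod_k c u v k (x k) = stationary w u * stationary w v.
  rewrite -(bigA_distr_bigA (c u v)) (bigD1 i)//= (bigD1 j) 1?eq_sym//=.
  rewrite [X in _ * (_ * X)]big1 ?mulr1.
    rewrite /c eqxx ji eqxx.
    by congr (_ * _); under eq_bigr do rewrite eq_sym; exact: pick.
  move=> k /andP[ki kj]; rewrite -[RHS](stationary_sum hw u); apply: eq_bigr => z _.
  by rewrite /c (negbTE ki) (negbTE kj) mulr1.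
transitivity (\sum_(x : config) \sum_u \sum_v F u v * \prod_k c u v k (x k)).
  apply: eq_bigr => x _.
  under [RHS]eq_bigr => u _ do under eq_bigr => v _ do rewrite cE mulrCA mulrA mulrA.
  under [RHS]eq_bigr => u _ do rewrite pick.
  rewrite -(pick (x i) (fun u => stationary_config w x * F u (x j))).
  by apply: eq_bigr => u _; ring.
rewrite exchange_big; apply: eq_bigr => u _; rewrite exchange_big; apply: eq_bigr => v _ /=.
by rewrite -mulr_sumr cS mulrC.
Qed.

Lemma mean_weight_gt0 : V -> 0 < mean_weight.
Proof.
move=> v; have s0 u : 0 < stationary w u by exact: stationary_gt0.
have t0 u z : 0 <= stationary w u * stationary w z * w u z.
  by apply: mulr_ge0 (weight_ge0 hw u z); apply: mulr_ge0; apply: ltW.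
rewrite /mean_weight (bigD1 v)//= ltr_wpDr//.
  by apply: sumr_ge0 => u _; exact: sumr_ge0.
rewrite (bigD1 v)//= ltr_wpDr//; first exact: sumr_ge0.
by apply: mulr_gt0 (weight_loop hw v); exact: mulr_gt0.
Qed.

Lemma averaging_event (Th gamma eta : R) : V -> 0 < Th -> 0 < gamma -> 0 < eta ->
  exists2 eps0, 0 < eps0 & forall (d : measure_display) (T : measurableType d)
    (P : probability T R) eps x0 (X : R -> T -> 'I_N -> V),
    0 < eps -> eps < eps0 -> independent_walks P w eps^-1 x0 X ->
    exists A : set T, [/\ d.-measurable A,
      forall o, A o -> forall i j t, i != j -> 0 <= t <= Th ->
        `|primitive (fun s => path_coupling w (X ^~ o) s i j - mean_weight) t| <= gamma &
      pr P (~` A) <= eta].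
Proof.
move=> v0 T0 g0 e0.
pose e1 := eta / #|{: 'I_N * 'I_N}|.+1%:R; have e10 : 0 < e1 by rewrite divr_gt0// ltr0n.
(* Diagonal pairs are replaced by 0: [w (x i) (x i)] minus [mean_weight] is in general not
   centred. *)
pose G (p : 'I_N * 'I_N) (x : config) := if p.1 != p.2 then w (x p.1) (x p.2) - mean_weight else 0.
pose B := coupling_max w + mean_weight.
have m0 := mean_weight_gt0 v0.
have B0 : 0 <= B by have := coupling_max_ge1 w; rewrite /B; lra.
have GB p x : `|G p x| <= B.
  rewrite /G; case: ifP => _; last by rewrite normr0.
  apply: le_trans (ler_normB _ _) _; rewrite (gtr0_norm m0) lerD2r.
  exact: coupling_maxP.
have Gc p : centered w (G p).
  rewrite /centered /G; case: (boolP (p.1 != p.2)) => ij; last by rewrite big1// => x _; rewrite mulr0.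
  under eq_bigr do rewrite mulrBr.
  rewrite sumrB stationary_pair// -mulr_suml (stationary_config_sum hw N v0) mul1r.
  by rewrite subrr.
have /choice[ep Hep] p : exists ep, 0 < ep /\ likely_small (G p) Th gamma e1 ep.
  by have [ep ep0 H] := sup_tail (Gc p) B0 (GB p) T0 g0 e10; exists ep.
have [eps0 eps00 Heps] := finite_lower_bound (fun p => (Hep p).1).
exists eps0 => // d T P eps x0 X ep0 epe HX.
have /choice[A HA] p := (Hep p).2 d T P eps x0 X ep0 (lt_le_trans epe (Heps p)) HX.
have [||U [mU tU] HU] := @pr_inter_tail d T P _ A eta e0; try by move=> k; case: (HA k).
exists U; split=> // o Uo i j t ij tT.
have [_ H _] := HA (i, j); have := H o (HU o Uo (i, j)) t tT.
rewrite (_ : (fun s => _) = (fun s => path_coupling w (X ^~ o) s i j - mean_weight))//.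
by apply: funext => s; rewrite /G /= ij !ffunE.
Qed.

Lemma countable_inter_tail d (T : measurableType d) (P : probability T R)
    (A : nat -> set T) (eta : R) : 0 < eta -> (forall k, d.-measurable (A k)) ->
  (forall k, pr P (~` A k) <= eta / (2 ^ k.+1)%:R) ->
  d.-measurable (\bigcap_k A k) /\ pr P (~` \bigcap_k A k) <= eta.
Proof.
move=> e0 mA tA; have mI : d.-measurable (\bigcap_k A k) by exact: bigcapT_measurable.
split=> //; rewrite -lee_fin -prE; last exact: measurableC.
have mC k : d.-measurable (~` A k) by exact: measurableC.
apply: le_trans (measure_sigma_subadditive P mC (measurableC mI) _) _.
  by rewrite setC_bigcap.
apply: le_trans (half_series e0); apply: lee_nneseries => [k _ _|k _]; first exact: measure_ge0.
by have := tA k; rewrite -lee_fin -(prE P (mC k)).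
Qed.

(** At a fixed rate the second-moment bound for the time average tends to a multiple of [kappa] as
    [t] grows, so at a late time the integral is at least [mbar * t / 2] outside a small event.
    Summable failure probabilities over the levels [M] give divergence. *)
Lemma divergence_event (beta : config -> R) (B mbar : R) : (forall x, `|beta x| <= B) ->
  0 < mbar -> centered w (fun x => beta x - mbar) ->
  forall (d : measure_display) (T : measurableType d) (P : probability T R) rate x0
    (X : R -> T -> 'I_N -> V) (eta : R), 0 < rate -> independent_walks P w rate x0 X ->
  0 < eta -> exists A : set T, [/\ d.-measurable A,
    forall o, A o -> forall q : R, exists2 t, 0 <= t &
      q <= primitive (fun s => beta (walk_config X s o)) t &
    pr P (~` A) <= eta].
Proof.
move=> Hbeta m0 Gc d T P rate x0 X eta r0 HX e0.
set G := fun x => _ in Gc; pose B' := `|B| + mbar.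
have B0 : 0 <= B' by rewrite addr_ge0// ltW.
have GB x : `|G x| <= B'.
  apply: le_trans (ler_normB _ _) _; rewrite (gtr0_norm m0) lerD2r.
  by apply: le_trans (Hbeta x) (ler_norm _).
pose c := mbar / 2; have c0 : 0 < c by rewrite divr_gt0.
have /choice[A HA] : forall M : nat, exists A : set T, [/\ d.-measurable A,
    forall o, A o -> exists2 t, 0 <= t &
      M%:R <= primitive (fun s => beta (walk_config X s o)) t &
    pr P (~` A) <= eta / (2 ^ M.+1)%:R].
  move=> M; pose e1 := eta / (2 ^ M.+1)%:R.
  have e10 : 0 < e1 by rewrite divr_gt0// ltr0n expn_gt0.
  pose kappa := c ^+ 2 * e1 / 12.
  have k0 : 0 < kappa by rewrite divr_gt0// mulr_gt0// exprn_gt0.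
  have [L L0 HL] := mean_square_tail Gc B0 GB k0.
  pose a := 24 * L * B' ^+ 2 / (rate * c ^+ 2 * e1).
  have a0 : 0 <= a by rewrite divr_ge0// !mulr_ge0 ?sqr_ge0// ltW.
  pose b := M%:R / c; have b0 : 0 <= b by rewrite divr_ge0// ltW.
  (* [b] makes [c * t] at least [M], and [a] keeps the correlation term below [e1 / 3]. *)
  pose t := 1 + b + a; have t0 : 0 < t by rewrite /t; lra.
  have g0 : 0 < c * t by rewrite mulr_gt0.
  have e30 : 0 < e1 / 3 by rewrite divr_gt0.
  have [A [mA HA tA]] := HL d T P rate x0 X r0 HX _ _ _ t0 g0 e30.
  exists A; split=> //; last first.
    apply: le_trans tA _.
    have -> : 4 / (c * t) ^+ 2 * (t ^+ 2 * kappa + 2 * t * (L / rate) * B' ^+ 2) =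
        e1 / 3 + e1 / 3 * (a / t).
      by rewrite /kappa /a; field; rewrite !gt_eqF.
    have : e1 / 3 * (a / t) <= e1 / 3.
      apply: ler_piMr; first exact: ltW.
      by rewrite ler_pdivrMr// mul1r /t; lra.
    by rewrite -/e1; lra.
  move=> o /HA dev; exists t; first exact: ltW.
  have bbeta := walks_bounded o HX Hbeta.
  have E : primitive (fun s => G (walk_config X s o)) t =
      primitive (fun s => beta (walk_config X s o)) t - mbar * t.
    rewrite /primitive RintegralB//; last 2 first.
    - exact: primitive_integrable bbeta.
    - apply: (@primitive_integrable R mbar (fun=> mbar)); split=> [|s _]; first exact: measurable_cst.
      by rewrite gtr0_norm.
    congr (_ - _); rewrite Rintegral_cst//; congr (_ * _).
    have mst : @lebesgue_measure R `[0, t] = t%:E.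
      by rewrite lebesgue_measure_itv /= lte_fin t0 oppr0 adde0.
    by rewrite -[RHS]/(fine t%:E) -mst.
  move: dev; rewrite E ler_norml => /andP[+ _].
  have -> : M%:R = c * b by rewrite /b mulrC divfK// gt_eqF.
  have -> : mbar = 2 * c by rewrite /c mulrC divfK.
  have : c * b <= c * t by rewrite ler_pM2l// /t; lra.
  have : 2 * c * t = 2 * (c * t) by rewrite mulrA.
  lra.
have [||mU tU] := @countable_inter_tail d T P A eta e0; try by move=> k; case: (HA k).
exists (\bigcap_k A k); split=> // o Ao q.
have [_ /(_ o (Ao (Num.bound `|q|) I))[t t0 qt] _] := HA (Num.bound `|q|).
exists t => //; apply: le_trans qt; apply: ltW.
exact: le_lt_trans (ler_norm q) (archi_boundP (normr_ge0 q)).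
Qed.

(* When all walks meet at u, every coupling is w u u, positive thanks to the
   self-loop. *)
Definition meeting_weight (c : R) (x : config) : R :=
  c * [exists u, [forall i, x i == u]]%:R.

Lemma meeting_weight_le c : 0 <= c -> (forall u, c <= w u u) ->
  forall x i j, 0 <= meeting_weight c x /\ meeting_weight c x <= w (x i) (x j).
Proof.
move=> c0 cw x i j; split; first exact: mulr_ge0.
rewrite /meeting_weight; case: existsP => [[u /forallP xu]|_]; last first.
  by rewrite mulr0 (weight_ge0 hw).
by rewrite mulr1 (eqP (xu i)) (eqP (xu j)).
Qed.

Lemma meeting_weight_mean c : 0 < c -> V -> exists2 mbar, 0 < mbar &
  centered w (fun x => meeting_weight c x - mbar).
Proof.
move=> c0 v; exists (\sum_x stationary_config w x * meeting_weight c x).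
  have s0 x : 0 < stationary_config w x by apply: prodr_gt0 => i _; exact: stationary_gt0.
  rewrite (bigD1 [ffun=> v])//= ltr_wpDr//.
    by apply: sumr_ge0 => x _; rewrite mulr_ge0 ?mulr_ge0// ltW.
  rewrite mulr_gt0// /meeting_weight.
  rewrite (_ : [exists u, _] = true) ?mulr1//.
  by apply/existsP; exists v; apply/forallP => i; rewrite ffunE.
rewrite /centered; under eq_bigr do rewrite mulrBr.
by rewrite sumrB -mulr_suml (stationary_config_sum hw N v) mul1r subrr.
Qed.

End SmallTime.

Theorem theorem1p9 (R : realType) (V : finType) (w : V -> V -> R) (K : R)
    (N : nat) (hw : weighted_graph w) (hK : 0 < K) (hN : (2 <= N)%N) :
  exists Omega : set (torus R N), full_measure Omega /\
    forall Omega' : set (torus R N), compact Omega' -> Omega' `<=` Omega ->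
    forall eta : R, 0 < eta ->
    exists eps0 : R, 0 < eps0 /\
      forall eps : R, 0 < eps -> eps < eps0 ->
      forall alpha : torus R N, Omega' alpha ->
      forall (x0 : 'I_N -> V) (d : measure_display) (T : measurableType d)
        (P : probability T R) (X : R -> T -> 'I_N -> V),
        independent_walks P w eps^-1 x0 X ->
        exists A : set T,
          [/\ measurable A,
              forall o, A o -> exists theta : R -> torus R N,
                unique_krw_solution w K (fun=> 0) (X ^~ o) alpha theta /\
                syncs theta &
              ((1 - eta)%:E <= P A)%E].
Proof.
case: N hN => // N _.
(* The set of phases is chosen before any vertex is at hand. Without vertices [m = 1] is a dummy
   value, and later no starting point exists. *)
have [m m0 mV] : exists2 m, 0 < m & V -> m = mean_weight w.
  case: (pickP (pred_of_argType V)) => [v _|V0]; last by exists 1 => // v; have := V0 v.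
  by exists (mean_weight w) => //; exact: mean_weight_gt0.
exists (\bigcup_n sync_basin K m n); split; first exact: sync_basin_full.
move=> Om cOm Omsub eta e0.
have [n0 Hn0] := compact_sync_basin hK m0 cOm Omsub.
case: (pickP (pred_of_argType V)) => [v _|V0]; last first.
  by exists 1; split=> // eps _ _ al _ x0; have := V0 (x0 ord0).
have {}mV := mV v; set M := coupling_max w.
have M1 : 1 <= M by exact: coupling_max_ge1.
have M0 : 0 <= M by lra.
pose Gam n := averaging_constant N.+1 K m M n%:R.
pose S := \sum_(n < n0.+1) `|Gam n| + 1.
have S0 : 0 < S by rewrite ltr_wpDl// sumr_ge0.
(* This makes [N.+1 * (|Gam n| * gamma)] at most 1/4 for all [n <= n0], so that [spread_close]
   yields a spread below [2 / 4 + 8 / 16 = 1]. *)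
pose gamma := (4 * N.+1%:R * S)^-1.
have N1 : 0 < N.+1%:R :> R by rewrite ltr0n.
have g0 : 0 < gamma by rewrite invr_gt0 !mulr_gt0.
have Ggam n : (n <= n0)%N -> N.+1%:R * (`|Gam n| * gamma) <= 4^-1.
  move=> nn0; have GS : `|Gam n| <= S.
    rewrite /S (bigD1 (Ordinal (nn0 : (n < n0.+1)%N)))//= -addrA lerDl addr_ge0//.
    exact: sumr_ge0.
  have -> : N.+1%:R * (`|Gam n| * gamma) = 4^-1 * (`|Gam n| / S).
    by rewrite /gamma; field; rewrite !gt_eqF.
  by apply: ler_piMr => //; rewrite ler_pdivrMr// mul1r.
have Th0 : 0 < n0.+1%:R :> R by rewrite ltr0n.
have e20 : 0 < eta / 2 by rewrite divr_gt0.
have [eps0 eps00 Heps] := averaging_event N.+1 hw v Th0 g0 e20.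
exists eps0; split=> // eps ep0 epe al Om_al x0 d T P X HX.
have [A1 [mA1 HA1 tA1]] := Heps d T P eps x0 X ep0 epe HX.
have [c c0 cw] := finite_lower_bound (weight_loop hw).
have [mbar mbar0 mbarC] := meeting_weight_mean N.+1 hw c0 v.
have meet := meeting_weight_le hw (ltW c0) cw.
have wM u z : w u z <= M by apply: le_trans (coupling_maxP w u z); exact: ler_norm.
have meetM (x : {ffun 'I_N.+1 -> V}) : `|meeting_weight c x| <= M.
  by have [b0 bw] := meet _ x ord0 ord0; rewrite ger0_norm//; exact: le_trans bw _.
have rate0 : 0 < eps^-1 by rewrite invr_gt0.
(* This event exists for the given [eps] whatever its size, so the threshold [eps0] comes from
   averaging alone. *)
have [A2 [mA2 HA2 tA2]] := divergence_event hw meetM mbar0 mbarC rate0 HX e20.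
exists (A1 `&` A2); split; first exact: measurableI.
  move=> o [A1o A2o]; have rX := walks_regular HX o.
  have [n nn0 [z [Hz z0 zs]]] := Hn0 al Om_al.
  have [y [y0 Hy ukrw]] := unique_krw_solution_exists w hK rX z0.
  exists (fun t i => angle (y t i)); split=> //.
  have n00 : 0 <= n%:R :> R by [].
  have dev i : `|y n%:R i - z n%:R i| <= `|Gam n| * gamma.
    apply: le_trans (_ : Gam n * gamma <= _); last first.
      by apply: ler_wpM2r; [exact: ltW|exact: ler_norm].
    apply: (averaging_estimate hK m0 M0 _ (path_coupling_admissible w rX) Hy Hz y0 n00 (ltW g0)) => //.
    move=> j k t jk /andP[t0 tn]; rewrite mV; apply: HA1 => //.
    by rewrite t0 (le_trans tn)// ler_nat leqW.
  have ys : spread (y n%:R) < 1.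
    have g1 : 0 <= `|Gam n| * gamma by rewrite mulr_ge0// ltW.
    apply: le_lt_trans (spread_close g1 dev) _.
    have : (N.+1%:R * (`|Gam n| * gamma)) ^+ 2 <= 4^-1 ^+ 2.
      have Ng0 : 0 <= N.+1%:R * (`|Gam n| * gamma) by rewrite mulr_ge0.
      by rewrite lerXn2r ?nnegrE ?invr_ge0// Ggam.
    by move: zs; lra.
  pose beta s := meeting_weight c (walk_config X s o).
  exists (angle (mean_phase y n%:R)) => i.
  apply: (@continuous_cvg _ _ _ _ _ (fun t => y t i) (@angle R)); first exact: angle_continuous.
  apply: (@sync_phase R N.+1 K M hK _ _ beta) => //.
  - by move=> t j k; rewrite /path_coupling (weight_sym hw).
  - move=> t j k _; have [_] := meet _ (walk_config X t o) j k.
    by rewrite !ffunE.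
  - by move=> t _; have [] := meet _ (walk_config X t o) ord0 ord0.
  - exact: walks_bounded HX meetM.
  - move=> t t0; exact: (@path_right_cvg _ _ _ _ (fun x => meeting_weight c [ffun i => x i]) _ rX t0).
  - exact: HA2.
have mA : d.-measurable (A1 `&` A2) by exact: measurableI.
rewrite prE// lee_fin.
have := pr_setU_le P (measurableC mA1) (measurableC mA2); rewrite -setCI.
have := pr_split P measurableT mA; rewrite !setTI pr_setT.
lra.
Qed.
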